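(* Let $\sigma\ge2$ and $r\ge 2$ be integers. Consider the scaling limit $\sharp\lim_{N\to\infty}$ described in the context, in which $\vec x=(x_1,\dots,x_{r-1})$ varies with the spanning tree $\mathcal{S}(\vec x)$ having $N$ edges and a fixed combinatorial geometry, with $n_v/N\to t_v$ for every $v\in\mathcal{N}\setminus\{o\}$. Suppose that the scaled spanning tree $\mathcal{S}$ does not branch at $o$ (i.e. $o$ has degree $1$ in $\mathcal{S}$). Then $$\sharp\lim_{N\to\infty}\frac{1}{(\sigma-1)N}\,\sigma^{N+1}\,\mathbb{P}(\vec x\in C)=\sum_{v\in\mathcal{N}\setminus\{o\}}\Big(\tfrac12t_v^2+t_v\,m^v_{v_-}\Big)\pi_v,$$ where $$\pi_v=\prod_{\substack{w\in\mathcal{N}\\ o<w<v}}\frac{t_w+m^v_{w_-}}{m^v_w},$$ with the convention that the empty product is $1$.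
   Context: $\mathcal{T}_\sigma$ is the infinite rooted tree in which every vertex has exactly $\sigma$ children, with root $o$. Invasion percolation cluster: assign i.i.d. uniform $(0,1)$ weights to the edges of $\mathcal{T}_\sigma$. Let $I_0=\{o\}$ and, given $I_N$, let $I_{N+1}$ be obtained by adjoining to $I_N$ the edge in its boundary (edges with exactly one endpoint in $I_N$) with smallest weight, together with its other endpoint. Then $C=\bigcup_{N\ge 0} I_N$; its law is $\mathbb{P}$. Let $\vec x=(x_1,\dots,x_{r-1})$ be vertices of $\mathcal{T}_\sigma\setminus\{o\}$ such that no $x_i$ lies on the path from $o$ to any $x_j$, $j\ne i$. $\vec x\in C$ means all $x_i\in C$. $\mathcal{S}(\vec x)$ is the subtree of $\mathcal{T}_\sigma$ obtained by connecting the vertices in $\vec x$ to $o$ (spanning tree); $N$ is its number of edges. Nodes: $\mathcal{N}(\vec x)$ consists of $o$, the vertices in $\vec x$, and any additional vertices where $\mathcal{S}(\vec x)$ branches. For $v\in\mathcal{N}(\vec x)\setminus\{o\}$, $v_-$ is the node immediately below $v$ and $n_v$ is the number of edges in the segment of $\mathcal{S}(\vec x)$ between $v_-$ and $v$. For nodes, $w<v$ means that $w$ is below $v$ (i.e. $w\neq v$ lies on the path from $o$ to $v$). For $w<v$, $M_w^v$ is the number of edges in the subtree obtained from $\mathcal{S}(\vec x)$ by deleting everything above $w$ in the direction of $v$ (i.e. deleting all edges in the branch of $\mathcal{S}(\vec x)$ emerging upward from $w$ that contains $v$). Scaling limit: the geometry (combinatorial tree structure of the nodes) of $\mathcal{S}(\vec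 x)$ stays the same while $N\to\infty$; given $t_v\in(0,1]$ for each $v\in\mathcal{N}(\vec x)\setminus\{o\}$ with $\sum_{v\in\mathcal{N}(\vec x)\setminus\{o\}}t_v=1$, one assumes $n_v/N\to t_v$ for all such $v$. The limit under this assumption is written $\sharp\lim_{N\to\infty}$. Put $m_w^v=\sharp\lim_{N\to\infty}M_w^v/N$ for $w<v$ (this is the sum of the $t_u$ over the segments $u$ not deleted). The scaled spanning tree $\mathcal{S}$ with nodes $\mathcal{N}$ is the limiting tree with the same geometry and with segments of lengths $t_v$, $v\in\mathcal{N}\setminus\{o\}$. *)

(* Defs.v *)
From HB Require Import structures.
From mathcomp Require Import all_boot all_order all_algebra.
From mathcomp Require Import all_classical all_reals all_analysis.

Set Implicit Arguments.
Unset Strict Implicit.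
Unset Printing Implicit Defensive.

Import Order.TTheory GRing.Theory Num.Theory.
Import numFieldNormedType.Exports.

Local Open Scope classical_set_scope.
Local Open Scope ring_scope.

(** The rooted tree in which every vertex has [sigma] children: a vertex is the
    list of the choices made on the path from the root [::] to it, so that
    [prefix w v] says that [w] lies on the path from the root to [v].  The edge
    [(v, i)] joins [v] to its [i]-th child. *)

Definition vertex (sigma : nat) := seq 'I_sigma.
Definition edge (sigma : nat) := (vertex sigma * 'I_sigma)%type.

Definition upper_end (sigma : nat) (e : edge sigma) : vertex sigma :=
  rcons e.1 e.2.

Section InvasionPercolation.
Context {R : realType} {sigma : nat}.
Implicit Types (w : edge sigma -> R) (I : seq (vertex sigma)).

(** The clusters considered below contain the parents of their vertices, so an
    edge with exactly one endpoint in [I] has its lower endpoint in [I]. *)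
Definition boundary I : seq (edge sigma) :=
  [seq e <- [seq (v, i) | v <- I, i <- enum 'I_sigma] | upper_end e \notin I].

(** Ties have probability zero; they are broken by taking the first edge. *)
Definition invade w I : seq (vertex sigma) :=
  if [seq e <- boundary I | all (fun f => w e <= w f) (boundary I)] is e :: _
  then upper_end e :: I else I.

Definition invaded w (N : nat) : seq (vertex sigma) :=
  iter N (invade w) [:: [::]].

Definition invasion_cluster w : set (vertex sigma) :=
  \bigcup_N [set` invaded w N].

End InvasionPercolation.

Definition mutually_independent {R : realType} {d : measure_display}
    {T : measurableType d} (P : probability T R) (I : eqType)
    (X : I -> {RV P >-> R}) : Prop :=
  forall (s : seq I) (A : I -> set R), uniq s -> (forall i, measurable (A i)) ->
    P (\bigcap_(i in [set` s]) (X i @^-1` A i))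
    = (\prod_(i <- s) P (X i @^-1` A i))%E.

Definition iid_uniform {R : realType} {d : measure_display}
    {T : measurableType d} (P : probability T R) (I : eqType)
    (X : I -> {RV P >-> R}) : Prop :=
  mutually_independent X /\
  forall i (A : set R), measurable A ->
    distribution P (X i) A = uniform_prob (@ltr01 R) A.

Section SpanningTree.
Context {sigma : nat}.
Implicit Types (u v w : vertex sigma) (x : seq (vertex sigma)).

Fixpoint path_edges (v : vertex sigma) (s : seq 'I_sigma) : seq (edge sigma) :=
  if s is i :: s' then (v, i) :: path_edges (rcons v i) s' else [::].

(** The edges of the subtree S(x) connecting the vertices in [x] to the root. *)
Definition span_edges x : seq (edge sigma) :=
  undup (flatten [seq path_edges [::] y | y <- x]).

Definition span_size x : nat := size (span_edges x).

Definition in_span x u : bool := has (prefix u) x.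

Definition branches x u : bool :=
  (1 < #|[set i : 'I_sigma | in_span x (rcons u i)]%SET|)%N.

Definition is_node x u : bool := [|| u == [::], u \in x | branches x u].

(** M_w^v, for [w] strictly below [v]: the branch of S(x) emerging from [w] in
    the direction of [v] consists of the edges whose upper endpoint is at or
    above the child of [w] on the path to [v]. *)
Definition remaining_size x w v : nat :=
  count (fun e => ~~ prefix (take (size w).+1 v) (upper_end e)) (span_edges x).

Definition admissible (k : nat) (x : k.-tuple (vertex sigma)) : Prop :=
  (forall i, tnth x i != [::]) /\
  (forall i j, i != j -> ~~ prefix (tnth x i) (tnth x j)).

End SpanningTree.

(** A geometry is a finite poset [V] of nodes, with the root as bottom, ordered
    by the relation "lies on the path from the root to". *)
Section ScalingLimit.
Context {R : realType} {sigma k : nat} {dV : Order.disp_t}.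
Context {V : finBPOrderType dV}.

(** v_-, the node immediately below [v]; meaningful only for [v != \bot]. *)
Definition node_below (v : V) : V :=
  odflt \bot%O
    [pick w | (w < v)%O && [forall u, ~~ ((w < u)%O && (u < v)%O)]].

(** A tuple of vertices, with the actual position of each node of [V]. *)
Definition config := (k.-tuple (vertex sigma) * (V -> vertex sigma))%type.

Definition has_geometry (c : config) : Prop :=
  [/\ admissible c.1,
      forall v w : V, prefix (c.2 v) (c.2 w) = (v <= w)%O &
      forall u, is_node c.1 u <-> exists v, c.2 v = u].

(** n_v, the difference of the depths of [v] and [v_-]. *)
Definition segment_size (c : config) (v : V) : nat :=
  (size (c.2 v) - size (c.2 (node_below v)))%N.

(** The filter of the scaling limit: the geometry is fixed, the number N of
    edges tends to infinity and n_v / N tends to [t v] for each [v != \bot]. *)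
Definition sharp (t : V -> R) : set_system config :=
  filter_from [set p : nat * R | 0 < p.2]
    (fun p => [set c | [/\ has_geometry c, (p.1 <= span_size c.1)%N &
       forall v, v != \bot%O ->
         `| (segment_size c v)%:R / (span_size c.1)%:R - t v | < p.2]]).

Lemma sharp_filter (t : V -> R) : Filter (sharp t).
Proof.
apply: filter_from_filter; first by exists (0%N, 1); rewrite /= ltr01.
move=> [n e] [n' e'] /= e0 e'0.
exists (maxn n n', Num.min e e'); first by rewrite /= lt_min e0.
move=> c [/= gc]; rewrite geq_max => /andP[nc n'c] tc.
by split; split=> // v /tc; rewrite lt_min => /andP[].
Qed.

(** m_w^v, for [w < v], as the scaling limit of M_w^v / N. *)
Definition scaled_remaining (t : V -> R) (w v : V) : R :=
  lim ((fun c : config =>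
          (remaining_size c.1 (c.2 w) (c.2 v))%:R / (span_size c.1)%:R : R)
       @ sharp t).

Definition branch_weight (t : V -> R) (v : V) : R :=
  \prod_(w : V | (\bot < w)%O && (w < v)%O)
     ((t w + scaled_remaining t (node_below w) v) / scaled_remaining t w v).

Definition root_degree : nat :=
  #|[set v : V | (v != \bot%O) && (node_below v == \bot%O)]%SET|.

End ScalingLimit.

#[global] Existing Instance sharp_filter.

Arguments config sigma k {dV} V.
Arguments sharp {R} sigma k {dV V} t.
Arguments scaled_remaining {R} sigma k {dV V} t w v.
Arguments branch_weight {R} sigma k {dV V} t v.
Arguments root_degree {dV} V.

(* Main.v *)
Require Import Defs.
From mathcomp Require Import all_boot all_order all_algebra.
From mathcomp Require Import all_classical all_reals all_analysis.
From mathcomp Require Import ring lra zify.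

(** Almost surely, C contains x unless some edge e of S(x) is blocked: an
    infinite path of edges with weights at most that of e leaves the path from
    the root to e without going through e.  Decomposing according to the edge
    with the largest weight gives an integral equation for the probability that
    no edge above a given vertex is blocked and all of them have weights at
    most p.  In the variable q, the probability that an edge does not start an
    infinite path of weights at most p, the equation unfolds into
      sigma^N P(x in C) = 1 + sum over the edges e of S(x) of I(rho v_e),
    where v_e is obtained by following the path from the root to e: a Markov
    step for each edge, a multiplication by b^g where side branches with g
    edges are left behind.  For a long path the density v_e concentrates near
    q = 1, on the scale 1/N, and I(rho v_e) is close to kappa * A_e, where A_e
    is the product over the branch points passed of (m + 1) / (m + 1 + g), m
    being the number of edges traversed or left behind before.  Finally the identity
      sum over e of A_e (2 m_e + 1 - N) = 0
    turns the sum of the A_e, which are constant on segments, into the sum over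
    segments in the theorem. *)

Set Implicit Arguments.
Unset Strict Implicit.
Unset Printing Implicit Defensive.

Import Order.TTheory GRing.Theory Num.Theory.
Import numFieldNormedType.Exports.

Local Open Scope classical_set_scope.
Local Open Scope ring_scope.

(** The survival probability has no closed form in the level p, whereas p is the explicit function
    1/(1 + q + ... + q^(sigma-1)) of q; hence the variable q, with u = 1 - q^sigma as the variable
    of integration. If rho were the constant kappa and b were a = 1 - kappa u, the densities kappa A
    m a^(m-1) would be preserved exactly, apart from the lower end of the integral: a step turns m
    into m + 1, and a factor a^g turns m into m + g and A into A m/(m + g). This is the origin of
    A_e; kappa is the value of rho at q = 1. The obstacle is uniformity in the tree: a path may
    leave up to N edges behind, and each of them costs an error of the order of the second moment of
    u. The hypothesis on the root supplies a stem of length comparable with N, along which the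
    second moment drops to o(1/N) before anything is left behind, so that all these errors together
    stay small. The integral equation comes from two-sided bounds for the increment between two
    levels: the events used for the upper bound cover it, those for the lower bound are disjoint
    inside it, and the bounds agree to first order. *)

Section Prefix.
Context {T : eqType}.
Implicit Types s t u : seq T.

Lemma prefix_rconsE s t x :
  prefix s (rcons t x) = (s == rcons t x) || prefix s t.
Proof.
apply/idP/idP => [st|/predU1P[->|]]; last 2 first.
- exact: prefix_refl.
- by move=> st; apply: prefix_trans st (prefix_rcons _ _).
have := size_prefix st; rewrite size_rcons leq_eqVlt => /predU1P[e|lt].
  by move: st; rewrite prefixE take_oversize ?size_rcons ?e// eq_sym => ->.
move: st; rewrite !prefixE -cats1 take_cat.
rewrite ltnS leq_eqVlt in lt; case: ltngtP lt => // [_ _ ->|-> _].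
  by rewrite orbT.
by rewrite subnn take0 cats0 take_size => ->; rewrite orbT.
Qed.

Lemma prefix_size_le s t u :
  prefix s u -> prefix t u -> (size s <= size t)%N -> prefix s t.
Proof.
rewrite !prefixE => /eqP su /eqP tu st.
by rewrite -tu take_takel// su.
Qed.

Lemma prefix_eq s t : prefix s t -> (size t <= size s)%N -> s = t.
Proof. by rewrite prefixE => /eqP st ts; rewrite -st take_oversize. Qed.

Lemma prefix_anti s t : prefix s t -> prefix t s -> s = t.
Proof. by move=> st /size_prefix; exact: prefix_eq. Qed.

Lemma prefix_next s t : prefix s t -> s != t ->
  exists i, prefix (rcons s i) t.
Proof.
case/prefixP => -[|i u] ->; first by rewrite cats0 eqxx.
by move=> _; exists i; rewrite -cat_rcons prefix_prefix.
Qed.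

Lemma prefix_rcons_disj s i j t :
  prefix (rcons s i) t -> prefix (rcons s j) t -> i = j.
Proof.
rewrite !prefixE !size_rcons => /eqP h1 /eqP h2.
by have /rcons_inj[] := etrans (esym h1) h2.
Qed.

Lemma rcons_prefixF s i : prefix (rcons s i) s = false.
Proof.
by apply/negP => /size_prefix; rewrite size_rcons ltnn.
Qed.

Lemma prefix_rconsW s i t : prefix (rcons s i) t -> prefix s t.
Proof. exact: prefix_trans (prefix_rcons s i). Qed.

End Prefix.

(** * Weighted integrals over the unit interval *)

Section UnitIntervalPrimitive.
Context {R : realType}.
Implicit Types f g : R -> R.

Definition clamp (x : R) : R := Num.min 1 (Num.max 0 x).

Lemma clamp_ge0 x : 0 <= clamp x.
Proof. by rewrite /clamp le_min ler01 le_max lexx. Qed.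

Lemma clamp_le1 x : clamp x <= 1.
Proof. by rewrite /clamp ge_min lexx. Qed.

Lemma clamp_id x : 0 <= x <= 1 -> clamp x = x.
Proof. by move=> /andP[x0 x1]; rewrite /clamp (max_r x0) (min_r x1). Qed.

Lemma continuous_clamp : continuous clamp.
Proof.
move=> x.
have h : {for x, continuous ((cst 0 : R -> R^o) \max (id : R -> R^o))}.
  have h0 : {for x, continuous (cst 0 : R -> R^o)} by exact: cst_continuous.
  have hi : {for x, continuous (id : R -> R^o)} by [].
  exact: (continuous_max h0 hi).
have h1 : {for x, continuous (cst 1 : R -> R^o)} by exact: cst_continuous.
exact: (continuous_min h1 h).
Qed.

Lemma is_derive_near1 f g (x d : R) :
  {near x, f =1 g} -> is_derive x 1 f d -> is_derive x 1 g d.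
Proof.
move=> fg [df <-]; split; first exact: (near_eq_derivable fg df).
by apply: esym; apply: near_eq_derive.
Qed.

Lemma clamp_near (x : R) : 0 < x < 1 -> {near x, (id : R -> R) =1 clamp}.
Proof.
move=> x01; have := @near_in_itvoo R 0 1 x; rewrite in_itv/= => /(_ x01) xn.
near=> y; rewrite clamp_id //.
have : y \in `]0, 1[%R by near: y.
by rewrite in_itv/= => /andP[/ltW-> /ltW->].
Unshelve. all: by end_near. Qed.

Lemma primitive_exists f : continuous f -> exists F : R -> R,
  [/\ continuous F, F 0 = 0 & forall x : R, 0 < x < 1 -> is_derive x 1 F (f x)].
Proof.
move=> cf.
(* The integral starts at -1 so that 0 and 1 are interior points of the interval on which the
   fundamental theorem of calculus is applied; [clamp] then extends the primitive by constants to a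
   continuous function on the line. *)
pose G (x : R) : R := (\int[lebesgue_measure]_(t in `[-1, x]) f t)%R.
have dG (x : R) : 0 <= x <= 1 -> is_derive x 1 G (f x).
  move=> /andP[x0 x1].
  have fi : lebesgue_measure.-integrable `[-1, 2] (EFin \o f).
    apply: continuous_compact_integrable; first exact: segment_compact.
    exact: continuous_subspaceT.
  have x2 : x < 2 by lra.
  have x1' : -1 < x by lra.
  have [dGx Gx] := continuous_FTC1_closed x2 fi x1' (cf x).
  by split=> //; rewrite -derive1E Gx.
pose F x := G (clamp x) - G 0.
exists F; split.
- move=> x; apply: cvgB; last exact: cvg_cst.
  apply: continuous_comp; first exact: continuous_clamp.
  apply: differentiable_continuous; apply/derivable1_diffP.
  by have [] := dG (clamp x) _; rewrite ?clamp_ge0 ?clamp_le1.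
- by rewrite /F clamp_id ?subrr// lexx ler01.
- move=> x x01; apply: (@is_derive_near1 (fun x => G x - G 0)).
    by near=> y; rewrite /F -(near (clamp_near x01) y).
  have dGx : is_derive x 1 G (f x) by apply: dG; lra.
  rewrite -[f x]subr0; exact: is_deriveB.
Unshelve. all: by end_near. Qed.

(** Only the values on the unit interval are determined. Integrals are handled as antiderivatives:
    the evaluations below rest on exhibiting one. *)
Definition primitive f : R -> R := xget (fun=> 0) [set F |
  [/\ continuous F, F 0 = 0 & forall x : R, 0 < x < 1 -> is_derive x 1 F (f x)]].

Lemma primitiveP f : continuous f ->
  [/\ continuous (primitive f), primitive f 0 = 0 &
    forall x : R, 0 < x < 1 -> is_derive x 1 (primitive f) (f x)].
Proof. by move=> /primitive_exists fF; exact: (xgetPex _ fF). Qed.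

Lemma continuous_primitive f : continuous f -> continuous (primitive f).
Proof. by case/primitiveP. Qed.

Lemma primitive0 f : continuous f -> primitive f 0 = 0.
Proof. by case/primitiveP. Qed.

Lemma is_derive_primitive f (x : R) : continuous f -> 0 < x < 1 ->
  is_derive x 1 (primitive f) (f x).
Proof. by case/primitiveP => _ _; apply. Qed.

Lemma derive_ge0_le01 (D d : R -> R) : continuous D ->
  (forall x : R, 0 < x < 1 -> is_derive x 1 D (d x)) ->
  (forall x : R, 0 < x < 1 -> 0 <= d x) ->
  forall x y : R, 0 <= x -> x <= y -> y <= 1 -> D x <= D y.
Proof.
move=> cD dD d0 x y x0 xy y1.
rewrite -subr_ge0; move: xy; rewrite le_eqVlt => /predU1P[->|xy].
  by rewrite subrr.
have [||c] := @MVT R D d x y xy.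
- by move=> z; rewrite in_itv/= => ?; apply: dD; lra.
- exact: continuous_subspaceT.
rewrite in_itv/= => cxy ->; apply: mulr_ge0; last by lra.
by apply: d0; lra.
Qed.

Lemma derive_eq01 (D E d : R -> R) : continuous D -> continuous E ->
  (forall x : R, 0 < x < 1 -> is_derive x 1 D (d x)) ->
  (forall x : R, 0 < x < 1 -> is_derive x 1 E (d x)) ->
  forall x : R, 0 <= x <= 1 -> D x - D 0 = E x - E 0.
Proof.
move=> cD cE dD dE x x01.
have sub0 (A B : R -> R) : continuous A -> continuous B ->
  (forall x : R, 0 < x < 1 -> is_derive x 1 A (d x)) ->
  (forall x : R, 0 < x < 1 -> is_derive x 1 B (d x)) -> A 0 - B 0 <= A x - B x.
  move=> cA cB dA dB.
  apply: (@derive_ge0_le01 (A \- B) (fun x => d x - d x)); rewrite ?lexx//.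
  - by move=> y; apply: cvgB; [exact: cA|exact: cB].
  - by move=> y y01; apply: is_deriveB; [exact: dA|exact: dB].
  - by move=> y _; rewrite subrr.
  - by case/andP: x01.
  - by case/andP: x01.
have := sub0 _ _ cD cE dD dE; have := sub0 _ _ cE cD dE dD; lra.
Qed.

End UnitIntervalPrimitive.

Section ContinuityRules.
Context {R : realType}.
Implicit Types f g : R -> R.

Lemma cont_cst (c : R) : continuous (fun _ : R => c).
Proof. exact: cst_continuous. Qed.

Lemma contD f g : continuous f -> continuous g ->
  continuous (fun x => f x + g x).
Proof. by move=> cf cg x; apply: cvgD; [exact: cf|exact: cg]. Qed.

Lemma contN f : continuous f -> continuous (fun x => - f x).
Proof. by move=> cf x; apply: cvgN; exact: cf. Qed.

Lemma contB f g : continuous f -> continuous g ->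
  continuous (fun x => f x - g x).
Proof. by move=> cf cg; apply: contD => //; exact: contN. Qed.

Lemma contM f g : continuous f -> continuous g ->
  continuous (fun x => f x * g x).
Proof. by move=> cf cg x; apply: cvgM; [exact: cf|exact: cg]. Qed.

Lemma contX f n : continuous f -> continuous (fun x => f x ^+ n).
Proof.
move=> cf; elim: n => [|n IHn].
  by under eq_fun do rewrite expr0; exact: cont_cst.
by under eq_fun do rewrite exprS; exact: contM.
Qed.

Lemma cont_sum (I : Type) (s : seq I) (F : I -> R -> R) :
  (forall i, continuous (F i)) -> continuous (fun x => \sum_(i <- s) F i x).
Proof.
move=> cF; elim: s => [|i s IHs].
  by under eq_fun do rewrite big_nil; exact: cont_cst.
by under eq_fun do rewrite big_cons; exact: contD.
Qed.

Lemma is_derive_exprn f n (x d : R) : is_derive x 1 f d ->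
  is_derive x 1 (fun q => f q ^+ n.+1) (n.+1%:R * f x ^+ n * d).
Proof.
move=> df; have -> : (fun q => f q ^+ n.+1) = f ^+ n.+1.
  by apply/funext => q; rewrite exprfctE.
exact: (is_deriveX n.+1 df).
Qed.

Lemma is_derive_scale f (c x d : R) : is_derive x 1 f d ->
  is_derive x 1 (fun q => c * f q) (c * d).
Proof. by move=> df; exact: (is_deriveZ c df). Qed.

Lemma is_derive_cst_sub f (c x d : R) : is_derive x 1 f d ->
  is_derive x 1 (fun q => c - f q) (- d).
Proof.
by move=> df; apply: (is_derive_eq (is_deriveB (is_derive_cst c x 1) df)); lra.
Qed.

End ContinuityRules.

Ltac cont := cbv beta; match goal with
  | H : continuous ?f |- continuous ?f => exact H
  | |- continuous (fun x => @?f x - @?g x) => apply (@contB _ f g); cont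
  | |- continuous (fun x => @?f x + @?g x) => apply (@contD _ f g); cont
  | |- continuous (fun x => - @?f x) => apply (@contN _ f); cont
  | |- continuous (fun x => @?f x * @?g x) => apply (@contM _ f g); cont
  | |- continuous (fun x => @?f x ^+ ?n) => apply (@contX _ f n); cont
  | H : continuous ?f |- continuous (fun x => ?f x) => exact H
  | |- _ => exact (@cont_cst _ _)
  end.

Section WeightedIntegral.
Context {R : realType}.
Variable ww : R -> R.
Hypothesis cww : continuous ww.
Hypothesis ww_ge0 : forall q, 0 <= q <= 1 -> 0 <= ww q.
Implicit Types f g : R -> R.

(** With [ww] minus the derivative of [uu], as in the application, this is integration with respect
    to u. *)
Definition wint_upto f : R -> R := primitive (fun q => f q * ww q).
Definition wint f : R := wint_upto f 1.
Definition wint_from f (q : R) : R := wint f - wint_upto f q.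

Lemma cont_wint_upto f : continuous f -> continuous (wint_upto f).
Proof. by move=> cf; apply: continuous_primitive; cont. Qed.

Lemma cont_wint_from f : continuous f -> continuous (wint_from f).
Proof. by move=> cf; apply: contB; [exact: cont_cst|exact: cont_wint_upto]. Qed.

Lemma wint_upto0 f : continuous f -> wint_upto f 0 = 0.
Proof. by move=> cf; apply: primitive0; cont. Qed.

Lemma is_derive_wint_upto f (q : R) : continuous f -> 0 < q < 1 ->
  is_derive q 1 (wint_upto f) (f q * ww q).
Proof.
by move=> cf; apply: (is_derive_primitive (f := fun q => f q * ww q)); cont.
Qed.

Lemma is_derive_wint_from f (q : R) : continuous f -> 0 < q < 1 ->
  is_derive q 1 (wint_from f) (- (f q * ww q)).
Proof.
move=> cf q01; rewrite -[- _]add0r; apply: is_deriveB; exact: is_derive_wint_upto.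
Qed.

Lemma wint_upto_ge0 f (q : R) : continuous f -> (forall q, 0 <= q <= 1 -> 0 <= f q) ->
  0 <= q <= 1 -> 0 <= wint_upto f q.
Proof.
move=> cf f0 /andP[q0 q1]; rewrite -(wint_upto0 cf).
apply: (@derive_ge0_le01 R (wint_upto f) (fun q => f q * ww q)) => //.
- exact: cont_wint_upto.
- by move=> x; exact: is_derive_wint_upto.
- by move=> x x01; apply: mulr_ge0; [apply: f0|apply: ww_ge0]; lra.
Qed.

Lemma wint_upto_le f (q : R) : continuous f ->
  (forall q, 0 <= q <= 1 -> 0 <= f q) -> 0 <= q <= 1 -> wint_upto f q <= wint f.
Proof.
move=> cf f0 /andP[q0 q1].
apply: (@derive_ge0_le01 R (wint_upto f) (fun q => f q * ww q)) => //.
- exact: cont_wint_upto.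
- by move=> x; exact: is_derive_wint_upto.
- by move=> x x01; apply: mulr_ge0; [apply: f0|apply: ww_ge0]; lra.
Qed.

Lemma wint_upto_unique f (F : R -> R) : continuous f -> continuous F -> F 0 = 0 ->
  (forall q : R, 0 < q < 1 -> is_derive q 1 F (f q * ww q)) ->
  forall q, 0 <= q <= 1 -> wint_upto f q = F q.
Proof.
move=> cf cF F0 dF q q01.
have := derive_eq01 (cont_wint_upto cf) cF (fun x => @is_derive_wint_upto f x cf) dF q01.
by rewrite wint_upto0// F0 !subr0.
Qed.

Lemma wint_unique f (F : R -> R) : continuous f -> continuous F -> F 0 = 0 ->
  (forall q : R, 0 < q < 1 -> is_derive q 1 F (f q * ww q)) -> wint f = F 1.
Proof. by move=> cf cF F0 dF; rewrite /wint (wint_upto_unique cf cF)// lexx ler01. Qed.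

Lemma wint_from_unique f (F : R -> R) : continuous f -> continuous F -> F 1 = 0 ->
  (forall q : R, 0 < q < 1 -> is_derive q 1 F (- (f q * ww q))) ->
  forall q, 0 <= q <= 1 -> wint_from f q = F q.
Proof.
move=> cf cF F1 dF q q01.
have E x : 0 <= x <= 1 -> wint_upto f x = F 0 - F x.
  apply: (@wint_upto_unique f (fun x => F 0 - F x)) => //; first by cont.
    by rewrite subrr.
  move=> y y01; rewrite -[f y * ww y]opprK -[- - _]add0r.
  by apply: is_deriveB; exact: dF.
rewrite /wint_from /wint !E ?lexx ?ler01//; lra.
Qed.

Lemma wint_uptoD f g (q : R) : continuous f -> continuous g -> 0 <= q <= 1 ->
  wint_upto (fun x => f x + g x) q = wint_upto f q + wint_upto g q.
Proof.
move=> cf cg; apply: (@wint_upto_unique _ (fun q => wint_upto f q + wint_upto g q)).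
- by cont.
- by apply: contD; exact: cont_wint_upto.
- by rewrite !wint_upto0// addr0.
- by move=> x x01; rewrite mulrDl; apply: is_deriveD; exact: is_derive_wint_upto.
Qed.

Lemma wintD f g : continuous f -> continuous g ->
  wint (fun x => f x + g x) = wint f + wint g.
Proof. by move=> cf cg; rewrite /wint wint_uptoD// lexx ler01. Qed.

Lemma wintZ c f : continuous f -> wint (fun x => c * f x) = c * wint f.
Proof.
move=> cf; apply: (@wint_unique _ (fun q => c * wint_upto f q)).
- by cont.
- by apply: contM; [exact: cont_cst|exact: cont_wint_upto].
- by rewrite wint_upto0// mulr0.
- move=> x x01; rewrite -mulrA.
  have dup := is_derive_wint_upto cf x01; exact: is_deriveZ.
Qed.

Lemma wintN f : continuous f -> wint (fun x => - f x) = - wint f.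
Proof.
by move=> cf; rewrite -mulN1r -wintZ//; congr wint; apply/funext => x; rewrite mulN1r.
Qed.

Lemma wintB f g : continuous f -> continuous g ->
  wint (fun x => f x - g x) = wint f - wint g.
Proof. by move=> cf cg; rewrite wintD ?wintN//; exact: contN. Qed.

Lemma wint_ge0 f : continuous f -> (forall q, 0 <= q <= 1 -> 0 <= f q) ->
  0 <= wint f.
Proof. by move=> cf f0; apply: wint_upto_ge0; rewrite ?lexx ?ler01. Qed.

Lemma wint_le f g : continuous f -> continuous g ->
  (forall q, 0 <= q <= 1 -> f q <= g q) -> wint f <= wint g.
Proof.
move=> cf cg fg; rewrite -subr_ge0 -wintB//; apply: wint_ge0; first by cont.
by move=> q q01; rewrite subr_ge0 fg.
Qed.

Lemma eq_wint f g : continuous f -> continuous g ->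
  (forall q, 0 <= q <= 1 -> f q = g q) -> wint f = wint g.
Proof.
move=> cf cg fg; apply/eqP; rewrite eq_le; apply/andP; split;
  by apply: wint_le => // q q01; rewrite fg.
Qed.

Lemma wint_norm_le f g : continuous f -> continuous g ->
  (forall q, 0 <= q <= 1 -> `|f q| <= g q) -> `|wint f| <= wint g.
Proof.
move=> cf cg fg; rewrite ler_norml -wintN//.
apply/andP; split; apply: wint_le => //; try by cont.
  by move=> q /fg; rewrite ler_norml => /andP[].
by move=> q /fg; rewrite ler_norml => /andP[].
Qed.

Lemma wint_sum (I : Type) (s : seq I) (F : I -> R -> R) :
  (forall i, continuous (F i)) ->
  wint (fun x => \sum_(i <- s) F i x) = \sum_(i <- s) wint (F i).
Proof.
move=> cF; elim: s => [|i s IHs].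
  under [X in wint X]eq_fun do rewrite big_nil.
  rewrite big_nil; apply: (@wint_unique _ (fun=> 0)) => //; try exact: cont_cst.
  by move=> q _; rewrite mul0r; exact: is_derive_cst.
rewrite big_cons -IHs -wintD//; last exact: cont_sum.
by congr wint; apply/funext => x; rewrite big_cons.
Qed.

(** Integration by parts: the product of the two partial integrals vanishes at both ends, its first
    factor at 0 and its second at 1. Integration from 0 and integration to 1 are thus adjoint to
    each other. *)
Lemma wint_upto_swap f g : continuous f -> continuous g ->
  wint (fun q => wint_upto f q * g q) = wint (fun q => f q * wint_from g q).
Proof.
move=> cf cg; apply/eqP; rewrite -subr_eq0; apply/eqP.
have cuf := cont_wint_upto cf; have cdg := cont_wint_from cg.
rewrite -wintB; [|by cont|by cont].
have -> : 0 = - (wint_upto f 1 * wint_from g 1) by rewrite /wint_from subrr mulr0 oppr0.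
apply: (@wint_unique _ (fun q => - (wint_upto f q * wint_from g q))).
- by cont.
- by cont.
- by rewrite wint_upto0// mul0r oppr0.
- move=> q q01.
  have d1 := is_derive_wint_upto cf q01; have d2 := is_derive_wint_from cg q01.
  apply: (is_derive_eq (is_deriveN (is_deriveM d1 d2))).
  by rewrite /GRing.scale/=; ring.
Qed.

End WeightedIntegral.

(** * Densities along a path *)

Section Chain.
Context {R : realType}.
Variables (rho bb uu ww : R -> R) (kappa k0 r1 C : R).
Hypotheses (crho : continuous rho) (cbb : continuous bb).
Hypotheses (cuu : continuous uu) (cww : continuous ww).
Hypotheses (k0_gt0 : 0 < k0) (kappa_gt0 : 0 < kappa) (kappa_le1 : kappa <= 1).
Hypothesis C_ge0 : 0 <= C.
Hypothesis rho_bound : forall q, 0 <= q <= 1 -> k0 <= rho q <= r1.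
Hypothesis bbE : forall q, 0 <= q <= 1 -> bb q = 1 - rho q * uu q.
Hypothesis bb_ge0 : forall q, 0 <= q <= 1 -> 0 <= bb q.
Hypothesis uu01 : forall q, 0 <= q <= 1 -> 0 <= uu q <= 1.
Hypothesis ww_ge0 : forall q, 0 <= q <= 1 -> 0 <= ww q.
Hypothesis rho_kappa : forall q, 0 <= q <= 1 -> `|rho q - kappa| <= C * uu q.
Hypotheses (uu0 : uu 0 = 1) (uu1 : uu 1 = 0).
Hypothesis duu : forall q : R, 0 < q < 1 -> is_derive q 1 uu (- ww q).

Local Notation up := (wint_upto ww).
Local Notation dn := (wint_from ww).
Local Notation I01 := (wint ww).

Definition aa (q : R) : R := 1 - kappa * uu q.

Lemma cont_aa : continuous aa. Proof. by rewrite /aa; cont. Qed.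

Lemma aa01 q : 0 <= q <= 1 -> 0 <= aa q <= 1.
Proof.
rewrite /aa => /uu01/andP[u0 u1].
have : 0 <= (1 - kappa) * uu q by rewrite mulr_ge0// subr_ge0.
have : 0 <= kappa * uu q by rewrite mulr_ge0// ltW.
by rewrite mulrBl mul1r; lra.
Qed.

Lemma bb01 q : 0 <= q <= 1 -> 0 <= bb q <= 1.
Proof.
move=> q01; rewrite bb_ge0//= bbE//.
have /andP[u0 u1] := uu01 q01; have /andP[r0 _] := rho_bound q01.
by rewrite gerBl mulr_ge0// (le_trans _ r0)// ltW.
Qed.

Lemma wint_from_pow (n : nat) q : 0 <= q <= 1 ->
  dn (fun q => uu q ^+ n) q = n.+1%:R^-1 * uu q ^+ n.+1.
Proof.
move=> q01.
apply: (wint_from_unique cww (F := fun q => n.+1%:R^-1 * uu q ^+ n.+1)) => //.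
- by cont.
- by cont.
- by rewrite uu1 expr0n mulr0.
- move=> x x01; have du := duu x01.
  apply: (is_derive_eq (is_derive_scale _ (is_derive_exprn n du))).
  have n0 : n.+1%:R != 0 :> R by rewrite pnatr_eq0.
  by field.
Qed.

Lemma wint_from_aa (j : nat) q : 0 <= q <= 1 ->
  dn (fun q => aa q ^+ j) q = (kappa * j.+1%:R)^-1 * (1 - aa q ^+ j.+1).
Proof.
have caa := cont_aa; move=> q01.
apply: (wint_from_unique cww
  (F := fun q => (kappa * j.+1%:R)^-1 * (1 - aa q ^+ j.+1))) => //.
- by cont.
- by cont.
- by rewrite /aa uu1 mulr0 subr0 expr1n subrr mulr0.
- move=> x x01; have du := duu x01.
  have da : is_derive x 1 aa (kappa * ww x).
    by apply: (is_derive_eq (is_derive_cst_sub 1 (is_derive_scale kappa du))); ring.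
  apply: (is_derive_eq (is_derive_scale _ (is_derive_cst_sub 1 (is_derive_exprn j da)))).
  have n0 : j.+1%:R != 0 :> R by rewrite pnatr_eq0.
  by field; rewrite nat1r n0 gt_eqF.
Qed.

(** The adjoint, for the pairing [wint], of the operator [f |-> bb f + rho dn f] in
    [wint_backbone_step]. Substituting the integral equation applies that operator to a function of
    the tree still ahead; transposing it gives a density that depends only on what has been
    passed. *)
Definition backbone_step (v : R -> R) (q : R) : R :=
  bb q * v q + up (fun q => rho q * v q) q.

Definition density (v : R -> R) := continuous v /\ forall q, 0 <= q <= 1 -> 0 <= v q.

Lemma cont_rho_mul v : continuous v -> continuous (fun q => rho q * v q).
Proof. by move=> cv; cont. Qed.

Lemma rho_ge0 q : 0 <= q <= 1 -> 0 <= rho q.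
Proof. by move=> /rho_bound/andP[k0r _]; exact: le_trans (ltW k0_gt0) k0r. Qed.

Lemma density_step v : density v -> density (backbone_step v).
Proof.
move=> [cv v0]; split; first by apply: contD; [cont|apply: cont_wint_upto => //; cont].
move=> q q01; apply: addr_ge0; first by rewrite mulr_ge0 ?bb_ge0 ?v0.
apply: wint_upto_ge0 => //; first by cont.
by move=> x x01; rewrite mulr_ge0 ?rho_ge0 ?v0.
Qed.

Lemma density_gap v g : density v -> density (fun q => bb q ^+ g * v q).
Proof.
move=> [cv v0]; split; first by cont.
by move=> q q01; rewrite mulr_ge0 ?exprn_ge0 ?bb_ge0 ?v0.
Qed.

Lemma wint_backbone_step v f : continuous v -> continuous f ->
  I01 (fun q => backbone_step v q * f q) =
  I01 (fun q => v q * (bb q * f q + rho q * dn f q)).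
Proof.
move=> cv cf.
have crv := cont_rho_mul cv; have cup := cont_wint_upto cww crv.
have cdn := cont_wint_from cww cf.
transitivity (I01 (fun q => bb q * v q * f q)
              + I01 (fun q => up (fun q => rho q * v q) q * f q)).
  rewrite -wintD; [|by []|by cont|by cont].
  by congr wint; apply/funext => q; rewrite /backbone_step mulrDl.
rewrite wint_upto_swap// -wintD; [|by []|by cont|by cont].
by congr wint; apply/funext => q; ring.
Qed.

Definition moment (v : R -> R) (n : nat) : R := I01 (fun q => v q * uu q ^+ n).

(** Integrating u^n gives u^(n+1) / (n+1), which returns only the fraction 1/(n+1) of the loss
    [rho u^(n+1)] suffered through [bb]. So the mass, n = 0, is conserved, and the higher moments
    decrease. *)
Lemma moment_step v n : density v ->
  moment (backbone_step v) n = moment v n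
   - (n%:R / n.+1%:R) * I01 (fun q => rho q * v q * uu q ^+ n.+1).
Proof.
move=> [cv v0]; rewrite /moment wint_backbone_step//; last by cont.
have cdn : continuous (dn (fun q => uu q ^+ n)) by apply: cont_wint_from => //; cont.
rewrite -wintZ//; last by cont.
rewrite -wintB//; [|by cont|by cont].
apply: eq_wint => //; [by cont|by cont|].
move=> q q01; rewrite wint_from_pow// bbE// exprS.
have n0 : n.+1%:R != 0 :> R by rewrite pnatr_eq0.
have -> : n%:R = n.+1%:R - 1 :> R by rewrite -addn1 natrD addrK.
by field; rewrite nat1r.
Qed.

Lemma moment_ge0 v n : density v -> 0 <= moment v n.
Proof.
move=> [cv v0]; apply: wint_ge0 => //; first by cont.
by move=> q q01; rewrite mulr_ge0 ?exprn_ge0 ?v0//; have /andP[] := uu01 q01.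
Qed.

Lemma moment_step_le v n : density v -> moment (backbone_step v) n <= moment v n.
Proof.
move=> dv; rewrite moment_step// lerBlDr lerDl mulr_ge0//.
case: dv => cv v0; apply: wint_ge0 => //; first by cont.
by move=> q q01; rewrite !mulr_ge0 ?exprn_ge0 ?rho_ge0 ?v0//; have /andP[] := uu01 q01.
Qed.

Lemma moment_le v v' n : density v -> density v' ->
  (forall q, 0 <= q <= 1 -> v q <= v' q) -> moment v n <= moment v' n.
Proof.
move=> [cv _] [cv' _] vv'; apply: wint_le => //; [by cont|by cont|].
by move=> q q01; rewrite ler_wpM2r ?vv' ?exprn_ge0//; have /andP[] := uu01 q01.
Qed.

(** The decay factor [aa] is chosen so that a step nearly sends the sequence
    [j |-> A * (m / (m + j))] of damped integrals to [A * (m' / (m' + j))] with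
    [m' = m + 1], and a multiplication by [bb ^+ g] to a multiple of that with
    [m' = m + g]; see [damped_step], [damped_gap] and [damped_path_step]. *)
Definition damped (v : R -> R) (j : nat) : R := I01 (fun q => v q * aa q ^+ j).

Lemma damped0 v : damped v 0 = moment v 0.
Proof. by []. Qed.

(** With [kappa] in place of [rho] the recursion is exact. Each of the two error terms carries
    [rho - kappa], at most C u, and another factor at most u, whence the second moment. *)
Lemma damped_step v j : density v ->
  `|damped (backbone_step v) j - (j%:R * damped v j.+1 + damped v 0) / j.+1%:R|
    <= 2 * C * moment v 2.
Proof.
move=> [cv v0]; have caa := cont_aa.
have cdn : continuous (dn (fun q => aa q ^+ j)) by apply: cont_wint_from => //; cont.
rewrite /damped wint_backbone_step//; last by cont.
rewrite mulrC -wintZ//; last by cont.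
rewrite -wintD//; [|by cont|by cont].
rewrite -wintZ//; last by cont.
rewrite -wintB//; [|by cont|by cont].
rewrite -wintZ//; last by cont.
apply: wint_norm_le => //; [by cont|by cont|].
move=> q q01; rewrite wint_from_aa// bbE// expr0.
have j0 : j.+1%:R != 0 :> R by rewrite pnatr_eq0.
have aq : aa q = 1 - kappa * uu q by [].
have a01 := aa01 q01; have u01 := uu01 q01; have rk := rho_kappa q01.
have vq := v0 q q01.
have -> : v q * ((1 - rho q * uu q) * aa q ^+ j +
    rho q * ((kappa * j.+1%:R)^-1 * (1 - aa q ^+ j.+1))) -
    j.+1%:R^-1 * (j%:R * (v q * aa q ^+ j.+1) + v q * 1) =
  v q * ((kappa - rho q) * (uu q * aa q ^+ j)
    + (rho q - kappa) * ((kappa * j.+1%:R)^-1 * (1 - aa q ^+ j.+1))).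
  have -> : j%:R = j.+1%:R - 1 :> R by rewrite -addn1 natrD addrK.
  by rewrite exprS aq; field; rewrite nat1r j0 gt_eqF.
rewrite normrM ger0_norm// [leRHS]mulrCA ler_wpM2l//.
have apow n : 0 <= aa q ^+ n <= 1.
  by case/andP: a01 => a0 a1; rewrite exprn_ge0//= exprn_ile1.
have X1 : `|uu q * aa q ^+ j| <= uu q.
  case/andP: u01 => ? _; have /andP[p0 p1] := apow j.
  by rewrite ger0_norm ?mulr_ge0// ler_piMr.
have X2 : `|(kappa * j.+1%:R)^-1 * (1 - aa q ^+ j.+1)| <= uu q.
  have /andP[p0 p1] := apow j.+1.
  rewrite ger0_norm ?mulr_ge0 ?invr_ge0 ?mulr_ge0 ?subr_ge0 ?(ltW kappa_gt0)//.
  rewrite ler_pdivrMl ?mulr_gt0//.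
  have -> : 1 - aa q ^+ j.+1 = (1 - aa q) * (\sum_(i < j.+1) aa q ^+ i).
    have := @subrXX _ 1 (aa q) j.+1; rewrite expr1n => ->; congr (_ * _).
    by apply: eq_bigr => i _; rewrite expr1n mul1r.
  have -> : kappa * j.+1%:R * uu q = (1 - aa q) * \sum_(i < j.+1) 1.
    by rewrite sumr_const card_ord aq; ring.
  apply: ler_wpM2l; first by case/andP: a01; lra.
  by apply: ler_sum => i _; have /andP[] := apow i.
apply: le_trans (ler_normD _ _) _; rewrite !normrM.
have n0 := normr_ge0 (rho q - kappa).
rewrite distrC -(normrM (uu q)) -(normrM (_^-1)).
have : `|rho q - kappa| * `|uu q * aa q ^+ j| <= C * uu q * uu q.
  by apply: ler_pM.
have : `|rho q - kappa| * `|(kappa * j.+1%:R)^-1 * (1 - aa q ^+ j.+1)|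
     <= C * uu q * uu q by apply: ler_pM.
lra.
Qed.

(** The difference of [bb] and [aa] is [(rho - kappa) u] up to sign, at most C u^2; powers of
    numbers in [0, 1] with exponent g differ by at most g times as much. *)
Lemma damped_gap v g j : density v ->
  `|damped (fun q => bb q ^+ g * v q) j - damped v (j + g)|
    <= g%:R * C * moment v 2.
Proof.
move=> [cv v0]; have caa := cont_aa.
rewrite /damped -wintB//; [|by cont|by cont].
rewrite -wintZ//; last by cont.
apply: wint_norm_le => //; [by cont|by cont|].
move=> q q01.
have a01 := aa01 q01; have u01 := uu01 q01; have rk := rho_kappa q01.
have vq := v0 q q01; have b01 := bb01 q01.
have -> : bb q ^+ g * v q * aa q ^+ j - v q * aa q ^+ (j + g)
  = v q * ((bb q ^+ g - aa q ^+ g) * aa q ^+ j) by rewrite exprD; ring.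
rewrite normrM ger0_norm// [leRHS]mulrCA ler_wpM2l// normrM.
have pow01 (x : R) n : 0 <= x <= 1 -> 0 <= x ^+ n <= 1.
  by case/andP => x0 x1; rewrite exprn_ge0//= exprn_ile1.
have /andP[p0 p1] := pow01 _ j a01.
rewrite [X in _ * X]ger0_norm//; apply: le_trans (ler_piMr _ p1) _ => //.
rewrite subrXX normrM -mulrA mulrC [leRHS]mulrC.
have -> : C * uu q ^+ 2 * g%:R = \sum_(i < g) (C * uu q ^+ 2).
  by rewrite sumr_const card_ord mulr_natr.
have B : `|bb q - aa q| <= C * uu q ^+ 2.
  rewrite bbE// /aa.
  have -> : 1 - rho q * uu q - (1 - kappa * uu q) = - ((rho q - kappa) * uu q)
    by ring.
  case/andP: u01 => u0 u1.
  by rewrite normrN normrM (ger0_norm u0) expr2 mulrA ler_wpM2r.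
apply: le_trans (_ : (\sum_(i < g) 1) * `|bb q - aa q| <= _).
  apply: ler_wpM2r => //; apply: le_trans (ler_norm_sum _ _ _) _.
  apply: ler_sum => i _; rewrite normrM.
  have /andP[? ?] := pow01 _ (g.-1 - i)%N b01; have /andP[? ?] := pow01 _ i a01.
  by rewrite !ger0_norm ?mulr_ile1// subn1.
rewrite mulr_suml; apply: ler_sum => i _; rewrite mul1r; exact: B.
Qed.

Lemma wint_from0 f : continuous f -> dn f 0 = I01 f.
Proof. by move=> cf; rewrite /wint_from wint_upto0// subr0. Qed.

(** The density along a path without side branches, which dominates the densities with side
    branches. *)
Definition chain (n : nat) : R -> R := iter n backbone_step (fun=> 1).

Lemma density_chain n : density (chain n).
Proof.
elim: n => [|n IHn]; last exact: density_step.
by split; [exact: cont_cst|move=> q _; exact: ler01].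
Qed.

Lemma moment0_chain n : moment (chain n) 0 = 1.
Proof.
elim: n => [|n IHn].
  have u01' : 0 <= (0 : R) <= 1 by rewrite lexx ler01.
  have := wint_from_pow 0 u01'; rewrite wint_from0; last by cont.
  rewrite /moment /chain/= uu0 expr1n invr1 mulr1 => u1; rewrite -[RHS]u1.
  by congr wint; apply/funext => q; rewrite mul1r.
by rewrite /= (moment_step _ (density_chain n)) IHn mul0r mul0r subr0.
Qed.

Lemma moment1_chain_step n :
  moment (chain n.+1) 1 <= moment (chain n) 1 - k0 / 2 * moment (chain n) 2.
Proof.
have [cv v0] := density_chain n.
have H : k0 * moment (chain n) 2 <= I01 (fun q => rho q * chain n q * uu q ^+ 2).
  rewrite /moment -wintZ//; last by cont.
  apply: wint_le => //; [by cont|by cont|].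
  move=> q q01; rewrite mulrA ler_wpM2r ?exprn_ge0//.
    by have /andP[] := uu01 q01.
  by rewrite ler_wpM2r ?v0//; have /andP[] := rho_bound q01.
rewrite /= (moment_step _ (density_chain n)); move: H; lra.
Qed.

(** Nonnegativity of the variance, as [chain n] has mass 1. *)
Lemma sqr_moment1_chain n : moment (chain n) 1 ^+ 2 <= moment (chain n) 2.
Proof.
have [cv v0] := density_chain n; set x := moment _ 1.
have : 0 <= I01 (fun q => chain n q * (uu q - x) ^+ 2).
  apply: wint_ge0 => //; first by cont.
  by move=> q q01; rewrite mulr_ge0 ?sqr_ge0 ?v0.
suff -> : I01 (fun q => chain n q * (uu q - x) ^+ 2) =
    moment (chain n) 2 - 2 * x * moment (chain n) 1 + x ^+ 2 * moment (chain n) 0.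
  by rewrite moment0_chain -/x; lra.
clearbody x; rewrite /moment -!wintZ//; try by cont.
rewrite -wintB//; try by cont.
rewrite -wintD//; try by cont.
by congr wint; apply/funext => q; ring.
Qed.

Lemma moment2_chain_le n m : (n <= m)%N -> moment (chain m) 2 <= moment (chain n) 2.
Proof.
move=> /subnK <-; elim: (m - n)%N => // k IHk.
by apply: le_trans IHk; exact: moment_step_le (density_chain _).
Qed.

Lemma moment1_chain_le n m : (n <= m)%N -> moment (chain m) 1 <= moment (chain n) 1.
Proof.
move=> /subnK <-; elim: (m - n)%N => // k IHk.
by apply: le_trans IHk; exact: moment_step_le (density_chain _).
Qed.

Lemma moment1_chain_le1 n : moment (chain n) 1 <= 1.
Proof.
have [cv v0] := density_chain n.
rewrite -(moment0_chain n); apply: wint_le => //; [by cont|by cont|].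
move=> q q01; rewrite ler_wpM2l ?v0// expr0 expr1.
by have /andP[] := uu01 q01.
Qed.

(** The decrease of the first moment pays for the second moments, which are therefore summable, with
    a tail controlled by the first moment. *)
Lemma sum_moment2_chain n k :
  \sum_(n <= i < n + k) moment (chain i) 2 <= 2 / k0 * moment (chain n) 1.
Proof.
have k0' := k0_gt0.
suff : \sum_(n <= i < n + k) moment (chain i) 2
    <= 2 / k0 * (moment (chain n) 1 - moment (chain (n + k)) 1).
  move/le_trans; apply; rewrite ler_wpM2l ?divr_ge0 ?(ltW k0_gt0)//.
  by rewrite gerBl (moment_ge0 _ (density_chain _)).
elim: k => [|k IHk]; first by rewrite addn0 big_geq// subrr mulr0.
rewrite addnS big_nat_recr ?leq_addr//=.
have := moment1_chain_step (n + k).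
rewrite -(ler_pM2l (_ : 0 < 2 / k0)) ?divr_gt0// mulrBr.
have -> : 2 / k0 * (k0 / 2 * moment (chain (n + k)) 2) = moment (chain (n + k)) 2.
  by field; rewrite gt_eqF.
by move: IHk; rewrite !mulrBr; lra.
Qed.

(** The n terms with index from n to 2n are all at least the one with index m. As the first moment
    tends to 0, the second moment is o(1/n), which is what allows for as many as N edges left
    behind. *)
Lemma moment2_chain_double n m : (n.*2 <= m)%N ->
  n%:R * moment (chain m) 2 <= 2 / k0 * moment (chain n) 1.
Proof.
move=> nm; apply: le_trans (sum_moment2_chain n n).
rewrite mulr_natl addnn -[n in _ *+ n]subn0 -[n in (n - 0)%N](addnK n) addnn subn0.
rewrite -sumr_const_nat big_nat [leRHS]big_nat; apply: ler_sum => i /andP[_ ni].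
by apply: moment2_chain_le; exact: leq_trans (ltnW ni) nm.
Qed.

(** Otherwise the second moments, which are at least the squares of the first ones, would not be
    summable. *)
Lemma moment1_chain_cvg0 (eps : R) : 0 < eps ->
  exists n1, forall n, (n1 <= n)%N -> moment (chain n) 1 <= eps.
Proof.
move=> e0; pose n1 := Num.bound (2 / k0 / eps ^+ 2).
exists n1 => n n1n; apply: le_trans (moment1_chain_le n1n) _.
have n1B : 2 / k0 / eps ^+ 2 < n1%:R.
  by apply: le_lt_trans (archi_boundP _); rewrite ?ler_norm// !divr_ge0 ?sqr_ge0// ltW.
rewrite leNgt; apply/negP => ex.
have := sum_moment2_chain 0 n1; rewrite add0n.
apply/negP; rewrite -ltNge.
apply: le_lt_trans (_ : 2 / k0 * 1 < _).
  by rewrite ler_wpM2l ?moment1_chain_le1// divr_ge0// ltW.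
apply: lt_le_trans (_ : \sum_(0 <= i < n1) eps ^+ 2 <= _).
  rewrite sumr_const_nat subn0 mulr1 -[ltRHS]mulr_natl.
  by move: n1B; rewrite ltr_pdivrMr ?exprn_gt0.
rewrite big_nat [leRHS]big_nat; apply: ler_sum => i /andP[_ ni].
apply: le_trans (sqr_moment1_chain i).
rewrite lerXn2r ?nnegrE ?(ltW e0)//; first exact: moment_ge0 (density_chain _).
by apply: le_trans (ltW ex) _; exact: moment1_chain_le (ltnW ni).
Qed.

Lemma chain_bounded n q : 0 <= q <= 1 -> chain n q <= 1 + n%:R * r1.
Proof.
move=> q01; elim: n => [|n IHn]; first by rewrite mul0r addr0.
have [cv v0] := density_chain n.
rewrite /chain iterS -/(chain n) /backbone_step -nat1r mulrDl mul1r [r1 + _]addrC addrA.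
apply: lerD.
  apply: le_trans IHn; rewrite ler_piMl ?v0//; by have /andP[] := bb01 q01.
have crv := cont_rho_mul cv.
apply: le_trans (wint_upto_le cww ww_ge0 crv _ q01) _.
  by move=> x x01; rewrite mulr_ge0 ?rho_ge0 ?v0.
rewrite -[r1]mulr1 -(moment0_chain n) /moment -wintZ//; last by cont.
apply: wint_le => //; [by cont|] => x x01.
by rewrite expr0 mulr1 ler_wpM2r ?v0//; have /andP[] := rho_bound x01.
Qed.

(** For fixed n the density is bounded, so the damped integral is O(1/j). The bound may grow with n,
    since it serves at a single starting point. *)
Lemma damped_chain_le n j : damped (chain n) j <= (1 + n%:R * r1) / (kappa * j.+1%:R).
Proof.
have caa := cont_aa; have [cv v0] := density_chain n.
have r10 : 0 <= 1 + n%:R * r1.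
  by apply: le_trans (@chain_bounded n 0 _); rewrite ?v0 ?lexx ?ler01.
apply: le_trans (_ : (1 + n%:R * r1) * I01 (fun q => aa q ^+ j) <= _).
  rewrite -wintZ//; last by cont.
  apply: wint_le => //; [by cont|by cont|] => q q01.
  rewrite ler_wpM2r ?chain_bounded ?exprn_ge0//; by have /andP[] := aa01 q01.
rewrite ler_wpM2l//.
have u01' : 0 <= (0 : R) <= 1 by rewrite lexx ler01.
rewrite -wint_from0; last by cont.
rewrite wint_from_aa// ler_piMr ?invr_ge0 ?mulr_ge0 ?(ltW kappa_gt0)//.
by rewrite gerBl exprn_ge0//; have /andP[] := aa01 u01'.
Qed.

Lemma damped_ge0 v j : density v -> 0 <= damped v j.
Proof.
have caa := cont_aa; move=> [cv v0]; apply: wint_ge0 => //; first by cont.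
by move=> q q01; rewrite mulr_ge0 ?v0 ?exprn_ge0//; have /andP[] := aa01 q01.
Qed.

(** The values n/(n + j) satisfy the recursion of [damped_step] exactly. A step at j refers to j +
    1, with the coefficient j/(j + 1), and to the mass, which is exactly 1. The initial error is
    thus shifted to the index j + k without being amplified, and the errors of the steps add up. *)
Lemma damped_chain_iter n k j : (0 < n)%N ->
  `|damped (chain (n + k)) j - (n + k)%:R / (n + k + j)%:R|
  <= `|damped (chain n) (j + k) - n%:R / (n + k + j)%:R|
     + 2 * C * \sum_(n <= i < n + k) moment (chain i) 2.
Proof.
move=> n0; elim: k j => [|k IHk] j.
  by rewrite !addn0 big_geq// mulr0 addr0.
rewrite !addnS big_nat_recr ?leq_addr//= mulrDr.
have H : `|damped (chain (n + k).+1) j -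
    (j%:R * damped (chain (n + k)) j.+1 + damped (chain (n + k)) 0) / j.+1%:R|
    <= 2 * C * moment (chain (n + k)) 2 := damped_step j (density_chain (n + k)).
rewrite damped0 moment0_chain in H.
set L := damped _ j in H *.
have := IHk j.+1; rewrite addSn addnS => {}IHk.
have E : (n + k).+1%:R / (n + k + j).+1%:R =
  (j%:R * ((n + k)%:R / (n + k + j).+1%:R) + 1) / j.+1%:R :> R.
  by rewrite -!nat1r !natrD; field; rewrite -!natrD !nat1r !pnatr_eq0.
rewrite addSn E.
set x := damped (chain (n + k)) j.+1 in H IHk *.
set y := (n + k)%:R / _ in IHk *.
have -> : L - (j%:R * y + 1) / j.+1%:R =
   (L - (j%:R * x + 1) / j.+1%:R) + j%:R / j.+1%:R * (x - y).
  by field; rewrite nat1r pnatr_eq0.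
apply: le_trans (ler_normD _ _) _; rewrite addrC addrA; apply: lerD => //.
apply: le_trans IHk; rewrite normrM ler_piMl//.
by rewrite ger0_norm ?divr_ge0// ler_pdivrMr ?mul1r ?ler_nat.
Qed.

(** The starting point [n2] is so late that the tail of the second moments is small; then enough
    steps are made for the initial error, taken at an index that grows with their number, to be
    small too. Nothing in this depends on j. *)
Lemma damped_chain_cvg (eps : R) : 0 < eps -> exists n1, forall n j, (n1 <= n)%N ->
  `|damped (chain n) j - n%:R / (n + j)%:R| <= eps.
Proof.
move=> e0; have k0' := k0_gt0.
have den : 0 < 1 + 2 * C * (2 / k0).
  by rewrite ltr_wpDr// !mulr_ge0 ?invr_ge0 ?(ltW k0').
have [|n0 n0P] := @moment1_chain_cvg0 (eps / 2 / (1 + 2 * C * (2 / k0))).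
  by rewrite divr_gt0 ?divr_gt0.
pose n2 := n0.+1.
pose B : R := (1 + n2%:R * r1) / kappa + n2%:R.
have B0 : 0 <= B.
  rewrite addr_ge0// divr_ge0 ?(ltW kappa_gt0)//.
  have u01' : 0 <= (0 : R) <= 1 by rewrite lexx ler01.
  by apply: le_trans (@chain_bounded n2 0 u01'); have [_] := density_chain n2; apply.
pose k1 := Num.bound (B / (eps / 2)).
have k1B : B / (eps / 2) < k1%:R.
  by apply: le_lt_trans (archi_boundP _); rewrite ?ler_norm// !divr_ge0// ltW.
exists (n2 + k1)%N => n j nn.
have -> : n = (n2 + (n - n2))%N by rewrite subnKC// (leq_trans _ nn)// leq_addr.
set k := (n - n2)%N.
have k1k : (k1 <= k)%N by rewrite /k leq_subRL// (leq_trans _ nn)// leq_addr.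
apply: le_trans (damped_chain_iter k j (ltn0Sn n0)) _.
have -> : eps = eps / 2 + eps / 2 by lra.
apply: lerD.
  have k0j : 0 < (j + k).+1%:R :> R by rewrite ltr0n.
  apply: le_trans (_ : B / (j + k).+1%:R <= _).
    rewrite /B mulrDl; apply: le_trans (ler_normB _ _) _; apply: lerD.
      rewrite ger0_norm; last exact: damped_ge0 (density_chain _).
      by apply: le_trans (damped_chain_le _ _) _; rewrite invfM mulrA.
    rewrite ger0_norm ?divr_ge0// ler_wpM2l// lef_pV2 ?posrE ?ltr0n//.
    by rewrite ler_nat /n2; lia.
  rewrite ler_pdivrMr// mulrC -ler_pdivrMr ?divr_gt0//.
  by apply: le_trans (ltW k1B) _; rewrite ler_nat ltnW// ltnS (leq_trans k1k)// leq_addl.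
apply: le_trans (_ : 2 * C * (2 / k0 * moment (chain n2) 1) <= _).
  by rewrite ler_wpM2l ?mulr_ge0// sum_moment2_chain.
have := n0P n2 (leqnSn _); set x := moment _ _.
have x0 : 0 <= x by apply: moment_ge0 (density_chain _).
by rewrite ler_pdivlMr// => xe; lra.
Qed.

(** [g k] is the number of edges in the side branches left behind at the [k]-th
    vertex of the path. *)
Fixpoint path_density (g : nat -> nat) (k : nat) : R -> R :=
  if k is k'.+1 then fun q => bb q ^+ g k * backbone_step (path_density g k') q
  else fun=> 1.

(** The index [k] belongs to the edge from depth [k] to depth [k + 1]; the edge at the root has mass
    0. *)
Fixpoint path_mass (g : nat -> nat) (k : nat) : nat :=
  if k is k'.+1 then ((path_mass g k').+1 + g k)%N else 0%N.

Fixpoint path_weight (g : nat -> nat) (k : nat) : R :=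
  if k is k'.+1 then
    path_weight g k' * (path_mass g k').+1%:R / (path_mass g k)%:R
  else 1.

Lemma density_path g k : density (path_density g k).
Proof.
elim: k => [|k IHk]; last exact/density_gap/density_step.
by split; [exact: cont_cst|move=> q _; exact: ler01].
Qed.

Lemma step_le v v' : density v -> density v' ->
  (forall q, 0 <= q <= 1 -> v q <= v' q) ->
  forall q, 0 <= q <= 1 -> backbone_step v q <= backbone_step v' q.
Proof.
move=> [cv v0] [cv' v0'] vv' q q01; rewrite /backbone_step; apply: lerD.
  by rewrite ler_wpM2l ?bb_ge0 ?vv'.
rewrite -subr_ge0.
have : 0 <= up (fun q => rho q * (v' q - v q)) q.
  apply: wint_upto_ge0 => //; first by cont.
  by move=> x x01; rewrite mulr_ge0 ?rho_ge0 ?subr_ge0 ?vv'.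
suff -> : up (fun q => rho q * v' q) q =
    up (fun q => rho q * v q) q + up (fun q => rho q * (v' q - v q)) q by lra.
rewrite -wint_uptoD//; try by cont.
by congr (wint_upto _ _ q); apply/funext => x; ring.
Qed.

Lemma path_le_chain g k q : 0 <= q <= 1 -> path_density g k q <= chain k q.
Proof.
elim: k q => [//|k IHk] q q01 /=.
apply: le_trans (step_le (density_path g k) (density_chain k) IHk q01).
have [_ s0] := density_step (density_path g k).
rewrite ler_piMl ?s0//; have /andP[b0 b1] := bb01 q01.
by rewrite exprn_ile1.
Qed.

Lemma path_mass_ge g k : (k <= path_mass g k)%N.
Proof. by elim: k => //= k IHk; rewrite ltn_addr. Qed.

Lemma path_stem g l : (forall k, (k < l)%N -> g k = 0%N) ->
  forall k, (k < l)%N -> [/\ path_density g k = chain k, path_mass g k = k &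
    path_weight g k = 1].
Proof.
move=> g0; elim=> [//|k IHk kl]; have [dk mk wk] := IHk (ltnW kl).
rewrite /= g0// dk mk wk addn0 mul1r divff ?pnatr_eq0//; split=> //.
by apply/funext => q; rewrite expr0 mul1r.
Qed.

Lemma path_weight01 g k : 0 <= path_weight g k <= 1.
Proof.
elim: k => [|k /andP[w0 w1]]; first by rewrite /= ler01 lexx.
rewrite /= !mulr_ge0 ?invr_ge0//= -mulrA mulr_ile1 ?divr_ge0//.
by rewrite ler_pdivrMr ?mul1r ?ler_nat ?leq_addr// ltr0n.
Qed.

Lemma path_rho_le g k : I01 (fun q => rho q * path_density g k q) <= r1.
Proof.
have [cv v0] := density_path g k; have [cc c0] := density_chain k.
rewrite -[r1]mulr1 -(moment0_chain k) /moment -wintZ//; last by cont.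
apply: wint_le => //; [by cont|by cont|] => x x01.
rewrite expr0 mulr1 ler_pM ?rho_ge0 ?v0 ?path_le_chain//.
by have /andP[] := rho_bound x01.
Qed.

Lemma path_rho_ge0 g k : 0 <= I01 (fun q => rho q * path_density g k q).
Proof.
have [cv v0] := density_path g k; apply: wint_ge0 => //; first by cont.
by move=> q q01; rewrite mulr_ge0 ?rho_ge0 ?v0.
Qed.

(** Since [rho - kappa] is at most C u, the error is a first moment, and the density is dominated by
    [chain k]. *)
Lemma path_rho_moment g k :
  `|I01 (fun q => rho q * path_density g k q) - kappa * damped (path_density g k) 0|
   <= C * moment (chain k) 1.
Proof.
have [cv v0] := density_path g k; have [cc c0] := density_chain k.
rewrite /damped -wintZ//; last by cont.
rewrite -wintB//; [|by cont|by cont].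
rewrite /moment -wintZ//; last by cont.
apply: wint_norm_le => //; [by cont|by cont|] => q q01.
rewrite expr0 mulr1 -mulrBl normrM (ger0_norm (v0 q q01)).
apply: le_trans (_ : C * uu q * path_density g k q <= _).
  by rewrite ler_wpM2r ?v0 ?rho_kappa.
have /andP[u0 u1] := uu01 q01.
by rewrite expr1 mulrAC -mulrA ler_wpM2l// ler_wpM2r// path_le_chain.
Qed.

(** The error grows by a second moment for the step and by C s0 for every edge left behind; the term
    with [path_mass] absorbs the latter, because the mass counts these edges. The recursion averages
    the old errors with weights i/(i + 1) and 1/(i + 1), hence does not amplify them. *)
Lemma damped_path_step g k (eps s0 : R) n :
  (0 < path_mass g k)%N ->
  ((0 < g k.+1)%N -> moment (chain k) 2 <= s0) ->
  (forall j, `|damped (path_density g k) j -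
     path_weight g k * ((path_mass g k)%:R / (path_mass g k + j)%:R)| <=
     eps + 2 * C * \sum_(n <= i < k) moment (chain i) 2
     + (path_mass g k)%:R * C * s0) ->
  0 <= s0 -> (n <= k)%N ->
  forall j, `|damped (path_density g k.+1) j -
     path_weight g k.+1 * ((path_mass g k.+1)%:R / (path_mass g k.+1 + j)%:R)| <=
     eps + 2 * C * \sum_(n <= i < k.+1) moment (chain i) 2
     + (path_mass g k.+1)%:R * C * s0.
Proof.
move=> m0 gs0 IH s00 nk j.
set m := path_mass g k in m0 IH *; set A := path_weight g k in IH *.
pose E := eps + 2 * C * \sum_(n <= i < k) moment (chain i) 2 + m%:R * C * s0.
have {}IH : forall j, `|damped (path_density g k) j - A * (m%:R / (m + j)%:R)| <= E.
  exact: IH.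
have dk := density_path g k; have dsk := density_step dk.
have Hg := damped_gap (g k.+1) j dsk.
have Hs := damped_step (j + g k.+1) dk.
set i := (j + g k.+1)%N in Hg Hs.
have mR : 0 < m%:R :> R by rewrite ltr0n.
have -> : path_weight g k.+1 * ((path_mass g k.+1)%:R / (path_mass g k.+1 + j)%:R)
   = (i%:R * (A * (m%:R / (m + i.+1)%:R)) + A) / i.+1%:R.
  rewrite /= -/m -/A.
  have -> : (m.+1 + g k.+1 + j)%N = (m + i.+1)%N by rewrite /i; lia.
  have e : (m + i.+1)%:R = m%:R + 1 + i%:R :> R.
    by rewrite -addn1 !natrD; ring.
  rewrite e ?addSn -!nat1r natrD; field.
  have h0 : 0 < 1 + (m%:R + (g k.+1)%:R) :> R by rewrite ltr_pwDl.
  have h1 : 0 < m%:R + 1 + i%:R :> R by rewrite -addrA ltr_wpDr.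
  have h2 : 0 < 1 + i%:R :> R by rewrite ltr_pwDl.
  by rewrite !gt_eqF.
have Hm : (path_mass g k.+1)%:R = 1 + m%:R + (g k.+1)%:R :> R.
  by rewrite /= -/m natrD nat1r.
rewrite Hm big_nat_recr//=.
set L0 := damped (path_density g k) 0 in Hs.
have IH0 := IH 0%N; rewrite addn0 divff ?gt_eqF// mulr1 -/L0 in IH0.
set L1 := damped (path_density g k) i.+1 in Hs.
have IH1 : `|L1 - A * (m%:R / (m + i.+1)%:R)| <= E := IH i.+1.
set B := A * (m%:R / (m + i.+1)%:R) in IH1 *.
set Ls := damped (backbone_step _) i in Hg Hs.
have M2 : moment (backbone_step (path_density g k)) 2 <= moment (chain k) 2.
  apply: le_trans (moment_step_le 2 dk) _.
  by apply: moment_le (density_chain k) _ => // q; exact: path_le_chain.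
have M2' : moment (path_density g k) 2 <= moment (chain k) 2.
  by apply: moment_le (density_chain k) _ => // q; exact: path_le_chain.
set L := damped (fun q => _) j in Hg *.
have -> : L - (i%:R * B + A) / i.+1%:R = (L - Ls) +
    ((Ls - (i%:R * L1 + L0) / i.+1%:R) +
     (i%:R / i.+1%:R * (L1 - B) + i.+1%:R^-1 * (L0 - A))).
  by field; rewrite nat1r pnatr_eq0.
have Hg' : `|L - Ls| <= (g k.+1)%:R * C * s0.
  case: (posnP (g k.+1)) => [g0|gpos].
    by move: Hg; rewrite g0 !mul0r.
  apply: le_trans Hg _; rewrite ler_wpM2l ?mulr_ge0//.
  by apply: le_trans M2 _; exact: gs0.
have Hs' : `|Ls - (i%:R * L1 + L0) / i.+1%:R| <= 2 * C * moment (chain k) 2.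
  by apply: le_trans Hs _; rewrite ler_wpM2l ?mulr_ge0.
have HE : `|i%:R / i.+1%:R * (L1 - B) + i.+1%:R^-1 * (L0 - A)| <= E.
  apply: le_trans (ler_normD _ _) _; rewrite !normrM.
  rewrite (ger0_norm (_ : 0 <= i.+1%:R^-1)) ?invr_ge0//.
  rewrite (ger0_norm (_ : 0 <= i%:R))//.
  have -> : E = i%:R / i.+1%:R * E + i.+1%:R^-1 * E.
    by field; rewrite nat1r pnatr_eq0.
  apply: lerD; first by rewrite ler_wpM2l// divr_ge0.
  by rewrite ler_wpM2l// invr_ge0.
apply: le_trans (ler_normD _ _) _.
have Cs : 0 <= C * s0 by rewrite mulr_ge0.
set X1 := _ + _ * _ in HE *; set X2 := _ - _ / _ in Hs' *.
move: (ler_normD X2 X1) HE Hs' Hg'; rewrite /E; lra.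
Qed.

(** [n1] and [N0] do not depend on the tree. Nothing is left behind before depth l, which is at
    least [delta N], so that the second moment is then o(1/N), and the bound on the mass limits the
    edges left behind later to N. *)
Lemma path_rho_cvg (eps delta : R) : 0 < eps -> 0 < delta ->
  exists n1 N0 : nat, forall (N l : nat) (g : nat -> nat),
    (N0 <= N)%N -> delta * N%:R <= l%:R -> (forall k, (k < l)%N -> g k = 0%N) ->
    forall k, (n1 <= k)%N -> (path_mass g k <= N)%N ->
    `|I01 (fun q => rho q * path_density g k q) - kappa * path_weight g k| <= eps.
Proof.
move=> e0 d0; have k0' := k0_gt0.
have e4 : 0 < eps / 4 by rewrite divr_gt0.
have [na naP] := damped_chain_cvg e4.
(* [D] collects the coefficients of the first moment at [n1]: C from replacing [rho] by [kappa], the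
   next term from the steps, the last from the edges left behind, where 8 is the product of 4 in
   [h2] and 2 in [h1]. *)
pose D : R := 1 + C + 2 * C * (2 / k0) + C * (8 / (delta * k0)).
have D0 : 0 < D.
  rewrite /D -!addrA ltr_pwDl// !addr_ge0 ?mulr_ge0 ?invr_ge0 ?mulr_ge0 ?(ltW k0')//.
  exact: ltW.
have e4D : 0 < eps / 4 / D by rewrite divr_gt0.
have [nb nbP] := moment1_chain_cvg0 e4D.
have [n1 [nan1 nbn1 n1_gt0]] : exists n1, [/\ (na <= n1)%N, (nb <= n1)%N & (0 < n1)%N].
  exists (maxn na nb).+1; split=> //; by rewrite leqW ?leq_maxl ?leq_maxr.
have [N0 N0P] : exists N0 : nat, (n1.*2.+2)%:R / delta <= N0%:R.
  exists (Num.bound ((n1.*2.+2)%:R / delta)).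
  by apply/ltW/archi_boundP; rewrite divr_ge0// ltW.
exists n1, N0 => N l g NN0 dNl gl k n1k mN.
set x1 := moment (chain n1) 1.
have x1e : x1 <= eps / 4 / D.
  exact: nbP.
have x10 : 0 <= x1 by apply: moment_ge0 (density_chain _).
have n1l : (n1.*2.+2 <= l)%N.
  rewrite -(ler_nat R); apply: le_trans dNl.
  by rewrite mulrC -ler_pdivrMr//; apply: le_trans N0P _; rewrite ler_nat.
have [n2 [n12 n2l n2l']] : exists n2, [/\ (n1 <= n2)%N, (n2.*2 <= l.-1)%N & (l <= n2.*2.+2)%N].
  by exists (l.-1)./2; split; clear -n1l; lia.
(* A nonzero [g k.+1] forces k >= l - 1, so [s0] bounds the second moment at every branch point. The
   index [n2], about l/2, is the one to which [moment2_chain_double] applies. *)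
set s0 := moment (chain l.-1) 2.
have s00 : 0 <= s0 by apply: moment_ge0 (density_chain _).
have Ns0 : N%:R * s0 <= 8 / (delta * k0) * x1.
  have h1 : n2%:R * s0 <= 2 / k0 * x1.
    apply: le_trans (moment2_chain_double n2l) _.
    by rewrite ler_wpM2l ?divr_ge0 ?(ltW k0')// moment1_chain_le.
  have h2 : N%:R <= 4 / delta * n2%:R.
    rewrite mulrAC ler_pdivlMr// mulrC; apply: le_trans dNl _.
    by rewrite -natrM ler_nat; clear -n12 n2l' n1_gt0; lia.
  apply: le_trans (_ : 4 / delta * n2%:R * s0 <= _); first by rewrite ler_wpM2r.
  rewrite -mulrA; have -> : 8 / (delta * k0) * x1 = 4 / delta * (2 / k0 * x1).
    by field; rewrite !gt_eqF.
  by rewrite ler_wpM2l// divr_ge0// ltW.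
have claim : forall j, `|damped (path_density g k) j -
     path_weight g k * ((path_mass g k)%:R / (path_mass g k + j)%:R)| <=
     eps / 4 + 2 * C * \sum_(n1 <= i < k) moment (chain i) 2
     + (path_mass g k)%:R * C * s0.
  have n1l' : (n1 < l)%N by clear -n1l; lia.
  rewrite -(subnKC n1k); elim: (k - n1)%N => [|p IHp] j.
    rewrite addn0; have [-> -> ->] := path_stem gl n1l'.
    rewrite big_geq// mulr0 addr0 mul1r.
    apply: le_trans (naP n1 j nan1) _.
    by rewrite lerDl !mulr_ge0.
  rewrite addnS; apply: damped_path_step => //.
  - by apply: leq_trans (path_mass_ge g _); rewrite ltn_addr.
  - move=> gp; apply: moment2_chain_le.
    have : ~~ ((n1 + p).+1 < l)%N by apply/negP => /gl g0; rewrite g0 in gp.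
    by clear; lia.
  - by rewrite leq_addr.
have := claim 0%N; rewrite addn0 divff; last first.
  by rewrite pnatr_eq0 -lt0n (leq_trans _ (path_mass_ge g k))// (leq_trans _ n1k).
rewrite mulr1.
have H1 := path_rho_moment g k.
set L := damped _ 0 in H1 *; set J := I01 _ in H1 *; set A := path_weight g k.
have xk : moment (chain k) 1 <= x1 by apply: moment1_chain_le.
have S1 : \sum_(n1 <= i < k) moment (chain i) 2 <= 2 / k0 * x1.
  by rewrite -(subnKC n1k) sum_moment2_chain.
have mNs : (path_mass g k)%:R * C * s0 <= C * (8 / (delta * k0) * x1).
  rewrite mulrAC mulrC ler_wpM2l//; apply: le_trans Ns0.
  by rewrite ler_wpM2r// ler_nat.
have Dx : D * x1 <= eps / 4 by move: x1e; rewrite ler_pdivlMr// mulrC.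
move=> H2.
have H3 : `|L - A| <= eps / 4 + D * x1.
  apply: le_trans H2 _; rewrite -addrA lerD2l.
  apply: le_trans (_ : 2 * C * (2 / k0 * x1) + C * (8 / (delta * k0) * x1) <= _).
    by apply: lerD => //; rewrite ler_wpM2l ?mulr_ge0.
  by rewrite /D; have := mulr_ge0 C_ge0 x10; lra.
have H4 : `|J - kappa * L| <= D * x1.
  apply: le_trans H1 _; apply: le_trans (_ : C * x1 <= _).
    by rewrite ler_wpM2l.
  rewrite ler_wpM2r// /D.
  have : 0 <= 2 * C * (2 / k0) by rewrite !mulr_ge0 ?invr_ge0 ?(ltW k0').
  have : 0 <= C * (8 / (delta * k0)).
    by rewrite !mulr_ge0 ?invr_ge0 ?mulr_ge0 ?(ltW k0') ?(ltW d0).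
  by lra.
have -> : J - kappa * A = (J - kappa * L) + kappa * (L - A) by ring.
apply: le_trans (ler_normD _ _) _; rewrite normrM (ger0_norm (ltW kappa_gt0)).
have : kappa * `|L - A| <= 1 * (eps / 4 + D * x1).
  by apply: ler_pM => //; exact: ltW.
lra.
Qed.

End Chain.

(** * Extinction probabilities as a parameter *)

Section Extinction.
Context {R : realType}.
Variable sigma : nat.
Hypothesis hsigma : (2 <= sigma)%N.

(** The level [pq q] is the [p] for which [q = 1 - p + p * q ^+ sigma], so that
    [q] is the probability that an edge does not start an infinite path of
    weights at most [p]; [rhoq] is minus its derivative.  Only [0 <= q <= 1]
    matters: [clamp] makes the functions continuous and positive everywhere. *)
Definition Dq (q : R) : R := \sum_(j < sigma) clamp q ^+ j.
Definition Nq (q : R) : R := \sum_(j < sigma) j%:R * clamp q ^+ j.-1.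
Definition pq (q : R) : R := (Dq q)^-1.
Definition rhoq (q : R) : R := Nq q * pq q ^+ 2.
Definition bq (q : R) : R := sigma%:R * clamp q ^+ sigma.-1 * pq q.
(** The probability that a vertex starts an infinite path of weights at most [pq q]; [wq] is minus
    its derivative. *)
Definition uq (q : R) : R := 1 - q ^+ sigma.
Definition wq (q : R) : R := sigma%:R * q ^+ sigma.-1.
(** The value of [rhoq] at q = 1, where the densities concentrate. *)
Definition kappaq : R := (sigma%:R - 1) / (2 * sigma%:R).

Lemma Dq_ge1 q : 1 <= Dq q.
Proof.
rewrite /Dq -(prednK (ltnW hsigma)) big_ord_recl/= expr0 lerDl sumr_ge0// => i _.
by rewrite exprn_ge0// clamp_ge0.
Qed.

Lemma Dq_le q : Dq q <= sigma%:R.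
Proof.
rewrite -[leRHS]mulr1 -[X in X%:R * _]card_ord mulr_natl -sumr_const.
by apply: ler_sum => i _; rewrite exprn_ile1 ?clamp_ge0 ?clamp_le1.
Qed.

Lemma pq_gt0 q : 0 < pq q.
Proof. by rewrite invr_gt0 (lt_le_trans ltr01)// Dq_ge1. Qed.

Lemma pq_le1 q : pq q <= 1.
Proof. by rewrite invf_le1 ?Dq_ge1// (lt_le_trans ltr01)// Dq_ge1. Qed.

Lemma pq_ge q : sigma%:R^-1 <= pq q.
Proof.
rewrite lef_pV2 ?posrE ?Dq_le ?ltr0n ?(ltnW hsigma)//.
by rewrite (lt_le_trans ltr01)// Dq_ge1.
Qed.

Lemma Nq_ge1 q : 1 <= Nq q.
Proof.
rewrite /Nq -(subnK hsigma) addn2 2!big_ord_recl/= mul0r add0r /bump/= mul1r expr0.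
by rewrite lerDl sumr_ge0// => i _; rewrite mulr_ge0 ?exprn_ge0 ?clamp_ge0.
Qed.

Lemma Nq_le q : Nq q <= sigma%:R ^+ 2.
Proof.
rewrite expr2 -[X in _ <= X%:R * _]card_ord mulr_natl -sumr_const.
apply: ler_sum => i _; rewrite -[leRHS]mulr1 ler_pM ?exprn_ge0 ?clamp_ge0//.
  by rewrite ler_nat ltnW.
by rewrite exprn_ile1 ?clamp_ge0 ?clamp_le1.
Qed.

Lemma rhoq_bound q : (sigma%:R ^+ 2)^-1 <= rhoq q <= sigma%:R ^+ 2.
Proof.
have s0 : 0 < sigma%:R :> R by rewrite ltr0n ltnW.
apply/andP; split; rewrite /rhoq.
  rewrite -[leLHS]mul1r ler_pM ?Nq_ge1 ?invr_ge0 ?sqr_ge0// -exprVn.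
  apply: lerXn2r; rewrite ?nnegrE ?invr_ge0 ?pq_ge//.
  by rewrite (le_trans ler01)// Dq_ge1.
rewrite -[leRHS]mulr1 ler_pM ?Nq_le ?sqr_ge0//.
  by rewrite (le_trans ler01)// Nq_ge1.
by rewrite exprn_ile1 ?pq_le1 ?(ltW (pq_gt0 _)).
Qed.

Lemma subr_mul_Dq (q : R) : 0 <= q <= 1 -> (1 - q) * Dq q = 1 - q ^+ sigma.
Proof.
move=> q01; rewrite /Dq clamp_id//.
have := @subrXX _ 1 q sigma; rewrite expr1n => ->; congr (_ * _).
by apply: eq_bigr => i _; rewrite expr1n mul1r.
Qed.

(** The derivative of [(1 - q) D = 1 - q^sigma], with the sign changed. Divided by D it becomes the
    relation [bqE]. *)
Lemma Dq_sub_Nq (q : R) : 0 <= q <= 1 ->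
  Dq q - (1 - q) * Nq q = sigma%:R * q ^+ sigma.-1.
Proof.
move=> q01; rewrite /Dq /Nq clamp_id//.
elim: sigma => [|n IHn]; first by rewrite !big_ord0 mulr0 mul0r subr0.
rewrite !big_ord_recr/= mulrDr opprD addrACA IHn -nat1r.
case: n {IHn} => [|n] /=; first by ring.
by rewrite exprS; ring.
Qed.

Lemma bqE (q : R) : 0 <= q <= 1 -> bq q = 1 - rhoq q * uq q.
Proof.
move=> q01; have := Dq_sub_Nq q01; rewrite /bq /rhoq /uq clamp_id// => <-.
rewrite -subr_mul_Dq// /pq; field.
by rewrite gt_eqF// (lt_le_trans ltr01)// Dq_ge1.
Qed.

Lemma bq_ge0 q : 0 <= bq q.
Proof. by rewrite /bq !mulr_ge0 ?exprn_ge0 ?clamp_ge0 ?(ltW (pq_gt0 q)). Qed.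

Lemma uq01 (q : R) : 0 <= q <= 1 -> 0 <= uq q <= 1.
Proof.
move=> /andP[q0 q1]; rewrite /uq subr_ge0 exprn_ile1//= gerBl exprn_ge0//.
Qed.

Lemma wq_ge0 (q : R) : 0 <= q <= 1 -> 0 <= wq q.
Proof. by move=> /andP[q0 q1]; rewrite /wq mulr_ge0// exprn_ge0. Qed.

Lemma uq0 : uq 0 = 1.
Proof. by rewrite /uq expr0n gtn_eqF ?subr0// ltnW. Qed.

Lemma uq1 : uq 1 = 0.
Proof. by rewrite /uq expr1n subrr. Qed.

Lemma is_derive_uq (q : R) : is_derive q 1 uq (- wq q).
Proof.
rewrite /uq /wq -(prednK (ltnW hsigma)).
apply: (is_derive_eq (is_derive_cst_sub 1 (is_derive_exprn sigma.-1 (is_derive_id q 1)))).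
by rewrite mulr1.
Qed.

Lemma cont_Dq : continuous Dq.
Proof. by apply: cont_sum => i; apply: contX; exact: continuous_clamp. Qed.

Lemma cont_Nq : continuous Nq.
Proof.
apply: cont_sum => i; apply: contM; first exact: cont_cst.
by apply: contX; exact: continuous_clamp.
Qed.

Lemma cont_pq : continuous pq.
Proof.
move=> x; apply: cvgV; last exact: cont_Dq.
by rewrite gt_eqF// (lt_le_trans ltr01)// Dq_ge1.
Qed.

Lemma cont_rhoq : continuous rhoq.
Proof. by have cN := cont_Nq; have cp := cont_pq; rewrite /rhoq; cont. Qed.

Lemma cont_bq : continuous bq.
Proof. by have cc := @continuous_clamp R; have cp := cont_pq; rewrite /bq; cont. Qed.

Lemma cont_id : continuous (fun x : R => x). Proof. by move=> x; exact: cvg_id. Qed.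

Lemma cont_uq : continuous uq.
Proof. by have ci := cont_id; rewrite /uq; cont. Qed.

Lemma cont_wq : continuous wq.
Proof. by have ci := cont_id; rewrite /wq; cont. Qed.

Lemma is_derive_Dq (q : R) : 0 < q < 1 -> is_derive q 1 Dq (Nq q).
Proof.
move=> q01; have q01' : 0 <= q <= 1 by case/andP: q01 => /ltW-> /ltW->.
apply: (@is_derive_near1 _ (fun q => \sum_(j < sigma) q ^+ j)).
  by near=> x; rewrite /Dq -(near (clamp_near q01) x).
rewrite /Nq clamp_id//; elim: sigma => [|n IHn].
  under eq_fun do rewrite big_ord0; rewrite big_ord0; exact: is_derive_cst.
under eq_fun do rewrite big_ord_recr; rewrite big_ord_recr/=.
apply: is_deriveD; case: n {IHn} => [|n].
  rewrite mul0r; under eq_fun do rewrite expr0; exact: is_derive_cst.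
by apply: (is_derive_eq (is_derive_exprn n (is_derive_id q 1))); rewrite mulr1.
Unshelve. all: by end_near. Qed.

Lemma is_derive_pq (q : R) : 0 < q < 1 -> is_derive q 1 pq (- rhoq q).
Proof.
move=> q01; have dD := is_derive_Dq q01.
have D0 : Dq q != 0 by rewrite gt_eqF// (lt_le_trans ltr01)// Dq_ge1.
apply: (is_derive_eq (is_deriveV D0 dD)).
by rewrite /rhoq /pq /GRing.scale/= exprVn; ring.
Qed.

Lemma pq0 : pq 0 = 1.
Proof.
rewrite /pq /Dq -(prednK (ltnW hsigma)) big_ord_recl/= expr0.
rewrite clamp_id ?lexx ?ler01// big1 ?addr0 ?invr1// => i _.
by rewrite /bump/= expr0n.
Qed.

Lemma pq1 : pq 1 = sigma%:R^-1.
Proof.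
rewrite /pq /Dq clamp_id ?lexx ?ler01//; congr _^-1.
by under eq_bigr do rewrite expr1n; rewrite sumr_const card_ord.
Qed.

Lemma pq_fix (q : R) : 0 <= q <= 1 -> q = 1 - pq q + pq q * q ^+ sigma.
Proof.
move=> q01; have : pq q * ((1 - q) * Dq q) = 1 - q.
  rewrite mulrCA /pq mulVf ?mulr1// gt_eqF// (lt_le_trans ltr01)// Dq_ge1//.
by rewrite subr_mul_Dq//; lra.
Qed.

(** A solution s < 1 satisfies [p D(s) = 1], and D is strictly increasing on the unit interval. So q
    is the smallest solution, the one found by iterating from below. *)
Lemma pq_unique (q s : R) : 0 <= q <= 1 -> 0 <= s -> s <= q ->
  s = 1 - pq q + pq q * s ^+ sigma -> s = q.
Proof.
move=> q01 s0 sq sfix; move: (sq); rewrite le_eqVlt => /predU1P[//|slt].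
have s01 : 0 <= s <= 1 by rewrite s0 (le_trans sq)//; case/andP: q01.
have s1 : 1 - s != 0 by rewrite subr_eq0 gt_eqF// (lt_le_trans slt)//; case/andP: q01.
have : (1 - s) * (1 - pq q * Dq s) = 0.
  have := subr_mul_Dq s01; move: sfix; set d := Dq s; set p := pq q.
  move=> e1 e2; have -> : (1 - s) * (1 - p * d) = (1 - s) - p * ((1 - s) * d) by ring.
  by rewrite e2 {1}e1; ring.
move/eqP; rewrite mulf_eq0 (negbTE s1)/= subr_eq0 => /eqP h.
have : Dq s < Dq q.
  rewrite /Dq -(subnK hsigma) addn2 2!big_ord_recl 2!big_ord_recl/=.
  rewrite !clamp_id// !expr0 ltrD2l !expr1 ltr_leD// ler_sum// => i _.
  by rewrite lerXn2r ?nnegrE//; case/andP: q01.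
rewrite -(ltr_pM2l (pq_gt0 q)) -h /pq mulVf ?ltxx//.
by rewrite gt_eqF// (lt_le_trans ltr01)// Dq_ge1.
Qed.

Lemma kappaq_gt0 : 0 < kappaq.
Proof.
by rewrite divr_gt0 ?mulr_gt0 ?ltr0n ?(ltnW hsigma)// subr_gt0 ltr1n.
Qed.

Lemma kappaq_le1 : kappaq <= 1.
Proof.
have s2 : 2 <= sigma%:R :> R by rewrite ler_nat.
by rewrite ler_pdivrMr; lra.
Qed.

Lemma Nq1 : Nq 1 = sigma%:R * (sigma%:R - 1) / 2.
Proof.
rewrite /Nq clamp_id ?lexx ?ler01//; under eq_bigr do rewrite expr1n mulr1.
elim: sigma => [|n IHn]; first by rewrite big_ord0 mul0r mul0r.
by rewrite big_ord_recr/= IHn -nat1r; field.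
Qed.

(** [rhoq] is Lipschitz at 1, and 1 - q <= u because D >= 1. The two terms of [key] contribute
    sigma^3 and 2 sigma^3, rounded up to a common power. *)
Lemma rhoq_kappaq (q : R) : 0 <= q <= 1 ->
  `|rhoq q - kappaq| <= 3 * sigma%:R ^+ 5 * uq q.
Proof.
move=> q01; have /andP[q0 q1] := q01.
set s : R := sigma%:R; have s2 : 2 <= s by rewrite ler_nat.
have D1 := Dq_ge1 q; have Ds := Dq_le q; have N1 := Nq_ge1 q; have Ns := Nq_le q.
rewrite -/s in Ds Ns.
have pow j : `|q ^+ j - 1| <= j%:R * (1 - q).
  rewrite -normrN opprB ger0_norm ?subr_ge0 ?exprn_ile1//.
  have := @subrXX _ 1 q j; rewrite expr1n => ->; rewrite mulrC ler_wpM2r ?subr_ge0//.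
  rewrite -[X in _ <= X%:R]card_ord -sumr_const; apply: ler_sum => i _.
  by rewrite expr1n mul1r exprn_ile1.
have dD : `|Dq q - s| <= s ^+ 2 * (1 - q).
  have -> : Dq q - s = \sum_(j < sigma) (q ^+ j - 1).
    by rewrite sumrB sumr_const card_ord /Dq clamp_id.
  apply: le_trans (ler_norm_sum _ _ _) _.
  rewrite expr2 -mulrA -[X in _ <= X%:R * _]card_ord mulr_natl -sumr_const.
  apply: ler_sum => i _; apply: le_trans (pow i) _.
  by rewrite ler_wpM2r ?subr_ge0// ler_nat ltnW.
have dN : `|Nq q - Nq 1| <= s ^+ 3 * (1 - q).
  have -> : Nq q - Nq 1 = \sum_(j < sigma) j%:R * (q ^+ j.-1 - 1).
    rewrite /Nq -sumrB; apply: eq_bigr => j _.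
    by rewrite !clamp_id ?lexx ?ler01// expr1n; ring.
  apply: le_trans (ler_norm_sum _ _ _) _.
  rewrite exprS -mulrA -[X in _ <= X%:R * _]card_ord mulr_natl -sumr_const.
  apply: ler_sum => i _; rewrite normrM expr2 -mulrA ler_pM ?normr_ge0//.
    by rewrite ger0_norm ?ler_nat// ltnW.
  apply: le_trans (pow _) _; rewrite ler_wpM2r ?subr_ge0// ler_nat.
  by rewrite (leq_trans (leq_pred _))// ltnW.
have Dn0 : Dq q != 0 by rewrite gt_eqF// (lt_le_trans ltr01).
have sn0 : s != 0 by rewrite gt_eqF//; lra.
have key : rhoq q - kappaq =
  (Nq q - Nq 1) / Dq q ^+ 2
  + Nq 1 * (s - Dq q) * (s + Dq q) / (Dq q ^+ 2 * s ^+ 2).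
  rewrite Nq1 -/s /rhoq /kappaq /pq -/s; field.
  by rewrite Dn0 sn0.
have oneq : 1 - q <= uq q.
  by rewrite /uq -subr_mul_Dq// ler_peMr// subr_ge0.
have s5 : 0 <= s ^+ 5 by rewrite exprn_ge0//; lra.
suff : `|rhoq q - kappaq| <= 3 * s ^+ 5 * (1 - q).
  move/le_trans; apply; rewrite ler_wpM2l// mulr_ge0//.
have D2 : 1 <= Dq q ^+ 2 by rewrite exprn_ege1.
have D2' : 0 < Dq q ^+ 2 by rewrite (lt_le_trans ltr01).
rewrite key; apply: le_trans (ler_normD _ _) _.
have t1 : `|(Nq q - Nq 1) / Dq q ^+ 2| <= s ^+ 3 * (1 - q).
  rewrite normrM normfV (ger0_norm (ltW D2')) ler_pdivrMr//.
  by apply: le_trans dN _; rewrite ler_peMr// mulr_ge0 ?subr_ge0// exprn_ge0//; lra.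
have t2 : `|Nq 1 * (s - Dq q) * (s + Dq q) / (Dq q ^+ 2 * s ^+ 2)|
    <= s ^+ 2 * (1 - q) * (2 * s).
  have s20 : 0 < s ^+ 2 by rewrite exprn_gt0//; lra.
  rewrite normrM normfV (ger0_norm (_ : 0 <= _ * s ^+ 2)); last first.
    by rewrite mulr_ge0// ltW.
  rewrite ler_pdivrMr; last by rewrite mulr_gt0.
  rewrite !normrM.
  have n1 : `|Nq 1| <= s ^+ 2.
    rewrite ger0_norm; last by rewrite (le_trans ler01)// Nq_ge1.
    exact: Nq_le.
  have n2 : `|s - Dq q| <= s ^+ 2 * (1 - q) by rewrite distrC.
  have n3 : `|s + Dq q| <= 2 * s by rewrite ger0_norm; lra.
  apply: le_trans (_ : s ^+ 2 * (s ^+ 2 * (1 - q)) * (2 * s) <= _).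
    by rewrite ler_pM ?mulr_ge0// ler_pM.
  rewrite [leRHS](_ : _ = Dq q ^+ 2 * (s ^+ 2 * (s ^+ 2 * (1 - q)) * (2 * s))).
    rewrite ler_peMl// !mulr_ge0 ?sqr_ge0 ?subr_ge0//; lra.
  by ring.
have s35 : s ^+ 3 <= s ^+ 5 by rewrite ler_eXn2l//; lra.
apply: le_trans (lerD t1 t2) _.
have : s ^+ 3 * (1 - q) <= s ^+ 5 * (1 - q) by rewrite ler_wpM2r ?subr_ge0.
have -> : s ^+ 2 * (1 - q) * (2 * s) = 2 * (s ^+ 3 * (1 - q)) by ring.
by lra.
Qed.

End Extinction.

(** * Independence of events determined by disjoint sets of edges *)

Section RealProbability.
Context {R : realType} {d : measure_display} {T : measurableType d}.
Variable P : probability T R.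
Implicit Types A B : set T.

Definition pr A : R := fine (P A).

Lemma prE A : measurable A -> P A = (pr A)%:E.
Proof. by move=> mA; rewrite /pr fineK// fin_num_measure. Qed.

Lemma pr_ge0 A : 0 <= pr A.
Proof. by rewrite /pr fine_ge0. Qed.

Lemma pr_le A B : measurable A -> measurable B -> A `<=` B -> pr A <= pr B.
Proof.
by move=> mA mB AB; rewrite -lee_fin -!prE//; apply: le_measure => //; rewrite inE.
Qed.

Lemma prU A B : measurable A -> measurable B -> A `&` B = set0 ->
  pr (A `|` B) = pr A + pr B.
Proof.
move=> mA mB AB0; apply: EFin_inj.
by rewrite EFinD -!prE//; [rewrite measureU|exact: measurableU].
Qed.

Lemma prD A B : measurable A -> measurable B -> A `<=` B ->
  pr (B `\` A) = pr B - pr A.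
Proof.
move=> mA mB AB.
have -> : pr B = pr ((B `\` A) `|` A) by rewrite setUC setDUK.
rewrite prU ?addrK//; [exact: measurableD|exact: setDKI].
Qed.

Lemma prT : pr setT = 1.
Proof. by rewrite /pr probability_setT. Qed.

Lemma pr0 : pr set0 = 0.
Proof. by rewrite /pr measure0. Qed.

Lemma prC A : measurable A -> pr (~` A) = 1 - pr A.
Proof. by move=> mA; rewrite -setTD prD// prT. Qed.

Lemma prU_le A B : measurable A -> measurable B -> pr (A `|` B) <= pr A + pr B.
Proof.
move=> mA mB; rewrite -lee_fin EFinD -!prE//; last exact: measurableU.
exact: measureU2.
Qed.

Lemma measurable_bigsetU (I : Type) (s : seq I) (F : I -> set T) :
  (forall i, measurable (F i)) -> measurable (\big[setU/set0]_(i <- s) F i).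
Proof. by move=> mF; elim/big_ind : _ => // X Y; exact: measurableU. Qed.

Lemma bigsetUP (I : eqType) (s : seq I) (F : I -> set T) t :
  (\big[setU/set0]_(i <- s) F i) t <-> exists2 i, i \in s & F i t.
Proof.
elim: s => [|i s IHs]; first by rewrite big_nil; split => // -[].
rewrite big_cons; split=> [[Fi|/IHs[j js Fj]]|[j]].
- by exists i; rewrite ?mem_head.
- by exists j; rewrite // inE js orbT.
- by rewrite inE => /predU1P[->|js] Fj; [left|right; apply/IHs; exists j].
Qed.

Lemma pr_bigsetU_le (I : Type) (s : seq I) (F : I -> set T) :
  (forall i, measurable (F i)) ->
  pr (\big[setU/set0]_(i <- s) F i) <= \sum_(i <- s) pr (F i).
Proof.
move=> mF; elim: s => [|i s IHs]; first by rewrite !big_nil pr0.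
rewrite !big_cons; apply: le_trans (prU_le (mF i) (measurable_bigsetU s mF)) _.
by rewrite lerD2l.
Qed.

Lemma pr_bigsetU (I : eqType) (s : seq I) (F : I -> set T) : uniq s ->
  (forall i, measurable (F i)) ->
  (forall i j, i \in s -> j \in s -> i != j -> F i `&` F j = set0) ->
  pr (\big[setU/set0]_(i <- s) F i) = \sum_(i <- s) pr (F i).
Proof.
move=> + mF; elim: s => [|i s IHs] /=; first by rewrite !big_nil pr0.
move=> /andP[iS us] dF; rewrite !big_cons prU//.
- rewrite IHs// => j k js ks; apply: dF; by rewrite inE ?js ?ks orbT.
- exact: measurable_bigsetU.
- apply/seteqP; split=> // t [Fi /bigsetUP[j js Fj]].
  rewrite -(dF i j) ?mem_head ?inE ?js ?orbT//.
  by apply: contraNneq iS => ->.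
Qed.

End RealProbability.

Section BlockIndependence.
Context {R : realType} {d : measure_display} {T : measurableType d}.
Context {P : probability T R} {I : choiceType}.
Variable X : I -> {RV P >-> R}.
Hypothesis indX : mutually_independent X.
Implicit Types D : set I.

Definition cylinder D : set_system T := [set B | exists (s : seq I) (A : I -> set R),
  [/\ uniq s, [set` s] `<=` D, forall i, measurable (A i) &
      B = \bigcap_(i in [set` s]) (X i @^-1` A i)]].

(** The events determined by the variables with index in [D]. Membership records at once that an
    event is measurable and which edges it depends on. *)
Definition sig D : set_system T := <<s cylinder D >>.

Lemma measurable_preim i (A : set R) : measurable A -> measurable (X i @^-1` A).
Proof.
by move=> mA; rewrite -[X in measurable X]setTI; exact: measurable_funP.
Qed.

Lemma cylinder_measurable D : cylinder D `<=` measurable.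
Proof.
move=> _ [s [A [_ _ mA ->]]].
by apply: fin_bigcap_measurable => // i _; exact: measurable_preim.
Qed.

Lemma sig_measurable D : sig D `<=` measurable.
Proof. by apply: smallest_sub; [exact: sigma_algebra_measurable|exact: cylinder_measurable]. Qed.

Lemma sub_sig D D' : D `<=` D' -> sig D `<=` sig D'.
Proof.
move=> DD'; apply: sub_sigma_algebra2 => _ [s [A [us sD mA ->]]].
by exists s, A; split=> //; exact: subset_trans DD'.
Qed.

Lemma cylinder_setI D : setI_closed (cylinder D).
Proof.
move=> _ _ [s [A [us sD mA ->]]] [s' [A' [us' sD' mA' ->]]].
exists (undup (s ++ s')), (fun i => (if i \in s then A i else setT) `&`
                                    (if i \in s' then A' i else setT)).
split; first exact: undup_uniq.
- by move=> i /=; rewrite mem_undup mem_cat => /orP[/sD|/sD'].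
- by move=> i; apply: measurableI; case: ifP.
- apply/seteqP; split=> t.
    move=> [h h'] i /=; rewrite mem_undup mem_cat => _.
    by split; case: ifPn => // ?; [exact: h|exact: h'].
  move=> h; split=> i /= iS; have /= := h i; rewrite mem_undup mem_cat iS ?orbT.
    by case/(_ isT).
  by case/(_ isT).
Qed.

Lemma cylinder_indep D D' A B : D `&` D' = set0 -> cylinder D A -> cylinder D' B ->
  (P (A `&` B) = P A * P B)%E.
Proof.
move=> DD' [s [E [us sD mE ->]]] [s' [E' [us' sD' mE' ->]]].
have dis i : i \in s -> i \in s' -> False.
  by move=> /sD iD /sD' iD'; have : (D `&` D') i by []; rewrite DD'.
pose F i := if i \in s then E i else E' i.
have mF i : measurable (F i) by rewrite /F; case: ifP.
have e1 : \bigcap_(i in [set` s]) (X i @^-1` E i) = \bigcap_(i in [set` s]) (X i @^-1` F i).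
  by apply: eq_bigcapr => i /= iS; rewrite /F iS.
have e2 : \bigcap_(i in [set` s']) (X i @^-1` E' i) = \bigcap_(i in [set` s']) (X i @^-1` F i).
  apply: eq_bigcapr => i /= iS; rewrite /F; case: ifP => // iS'.
  by case: (dis i).
have e3 : \bigcap_(i in [set` s]) (X i @^-1` F i) `&` \bigcap_(i in [set` s']) (X i @^-1` F i)
   = \bigcap_(i in [set` s ++ s']) (X i @^-1` F i).
  apply/seteqP; split=> t.
    by move=> [h h'] i /=; rewrite mem_cat => /orP[/h|/h'].
  by move=> h; split=> i /= iS; apply: h; rewrite /= mem_cat iS ?orbT.
rewrite e1 e2 e3 indX//; last first.
  rewrite cat_uniq us us' andbT/=; apply/hasPn => i iS'; apply/negP => iS.
  exact: (dis i).
by rewrite big_cat/= !indX.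
Qed.

(** Uniqueness of measures on a pi-system, used twice: first a cylinder over [D] is fixed and the
    event over [D'] varies, then that event is fixed and the cylinder is extended to [sig D]. In
    [mono] the two finite measures are the restriction of P to B' and the multiple of P by P(B'). *)
Lemma sig_indep D D' A B : D `&` D' = set0 -> sig D A -> sig D' B ->
  pr P (A `&` B) = pr P A * pr P B.
Proof.
move=> DD' sA sB.
have mono (m : {measure set T -> \bar R}) (c : {nonneg R}) (G : set_system T)
    (mG : G `<=` measurable) (IG : setI_closed G) B' (mB' : measurable B') :
    P B' = c%:num%:E -> (forall A, G A -> P (A `&` B') = P A * c%:num%:E)%E ->
    forall A, <<s G >> A -> (P (A `&` B') = P A * c%:num%:E)%E.
  move=> Bc GAB A' sA'.
  transitivity (mrestr P mB' A'); first by [].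
  transitivity (mscale c P A'); last by rewrite /mscale/= muleC.
  have e : [set X | G X /\ X `<=` setT] = G by apply/seteqP; split=> // Y [].
  apply: (@g_sigma_algebra_measure_unique_trace _ _ _ G setT).
  - exact: measurableT.
  - by rewrite e.
  - by rewrite e.
  - by change (P (setT `&` B') = c%:num%:E * P setT)%E; rewrite setTI Bc probability_setT mule1.
  - move=> A0; rewrite e => /GAB h.
    by change (P (A0 `&` B') = c%:num%:E * P A0)%E; rewrite h muleC.
  - change (P (setT `&` B') < +oo)%E.
    by rewrite setTI (le_lt_trans (probability_le1 P mB'))// ltry.
  - by [].
  - by rewrite e.
have cyl_c B' : measurable B' -> exists c : {nonneg R}, P B' = c%:num%:E.
  by move=> mB'; exists (NngNum (pr_ge0 P B')); rewrite /= prE.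
have step1 A' B' : cylinder D A' -> sig D' B' -> (P (B' `&` A') = P B' * P A')%E.
  move=> cA sB'; have mA' := cylinder_measurable cA.
  have [c Ac] := cyl_c _ mA'; rewrite Ac.
  apply: (mono P c (cylinder D')) => //.
  - exact: cylinder_measurable.
  - exact: cylinder_setI.
  - by move=> A0 cA0; rewrite setIC (cylinder_indep DD' cA cA0) muleC Ac.
have mB := sig_measurable sB; have mA := sig_measurable sA.
have [c Bc] := cyl_c _ mB.
apply: EFin_inj; rewrite EFinM -!prE//; last exact: measurableI.
rewrite Bc; apply: (mono P c (cylinder D)) => //.
- exact: cylinder_measurable.
- exact: cylinder_setI.
- by move=> A0 cA0; rewrite setIC step1// muleC Bc.
Qed.

Lemma sigT D : sig D setT.
Proof. exact: (@measurableT _ (g_sigma_algebraType (cylinder D))). Qed.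

Lemma sigI D A B : sig D A -> sig D B -> sig D (A `&` B).
Proof. exact: (@measurableI _ (g_sigma_algebraType (cylinder D))). Qed.

Lemma sigU D A B : sig D A -> sig D B -> sig D (A `|` B).
Proof. exact: (@measurableU _ (g_sigma_algebraType (cylinder D))). Qed.

Lemma sigC D A : sig D A -> sig D (~` A).
Proof. exact: (@measurableC _ (g_sigma_algebraType (cylinder D))). Qed.

Lemma sigD D A B : sig D A -> sig D B -> sig D (A `\` B).
Proof. exact: (@measurableD _ (g_sigma_algebraType (cylinder D))). Qed.

Lemma sig_bigcap D (J : countType) (F : J -> set T) :
  (forall j, sig D (F j)) -> sig D (\bigcap_j F j).
Proof.
move=> sF; pose G n := if @unpickle J n is Some j then F j else setT.
have -> : \bigcap_j F j = \bigcap_n G n.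
  apply/seteqP; split=> t h.
    by move=> n _; rewrite /G; case: unpickle => // j; exact: h.
  by move=> j _; have := h (pickle j) Logic.I; rewrite /G pickleK.
apply: (@bigcapT_measurable _ (g_sigma_algebraType (cylinder D))) => n.
by rewrite /G; case: unpickle => [j|]; [exact: sF|exact: sigT].
Qed.

Lemma sig_bigcup D (J : countType) (F : J -> set T) :
  (forall j, sig D (F j)) -> sig D (\bigcup_j F j).
Proof.
move=> sF; rewrite -[X in sig D X]setCK setC_bigcup; apply: sigC.
by apply: sig_bigcap => j; exact: sigC.
Qed.

Lemma sig_preim D i (A : set R) : D i -> measurable A -> sig D (X i @^-1` A).
Proof.
move=> Di mA; apply: sub_sigma_algebra; exists [:: i], (fun=> A).
split=> //; first by move=> j /=; rewrite inE => /eqP->.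
apply/seteqP; split=> t h.
  by move=> j /=; rewrite inE => /eqP->.
by apply: h; rewrite /= inE.
Qed.

Lemma sig_le_cst D i (p : R) : D i -> sig D [set t | X i t <= p].
Proof.
move=> Di; have -> : [set t | X i t <= p] = X i @^-1` `]-oo, p].
  by apply/seteqP; split=> t /=; rewrite in_itv.
exact: sig_preim.
Qed.

Lemma sig_le D i j : D i -> D j -> sig D [set t | X i t <= X j t].
Proof.
move=> Di Dj; rewrite -[X in sig D X]setCK; apply: sigC.
have -> : ~` [set t | X i t <= X j t] =
    \bigcup_(r : rat) ([set t | X j t <= ratr r] `&` ~` [set t | X i t <= ratr r]).
  apply/seteqP; split=> t /=.
    move/negP; rewrite -ltNge => /rat_in_itvoo[r]; rewrite in_itv/= => /andP[jr ri].
    by exists r => //; split=> /=; [exact: ltW|apply/negP; rewrite -ltNge].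
  move=> [r _ [/= jr /negP]]; rewrite -ltNge => ri.
  by apply/negP; rewrite -ltNge; exact: le_lt_trans ri.
apply: sig_bigcup => r; apply: sigI; first exact: sig_le_cst.
by apply: sigC; exact: sig_le_cst.
Qed.

Lemma sig_indep_seq (J : eqType) (s : seq J) (A : J -> set T) (D : J -> set I) :
  uniq s -> (forall j, j \in s -> sig (D j) (A j)) ->
  (forall j k, j \in s -> k \in s -> j != k -> D j `&` D k = set0) ->
  pr P (\bigcap_(j in [set` s]) A j) = \prod_(j <- s) pr P (A j).
Proof.
move=> us sA dD.
suff : sig (\bigcup_(j in [set` s]) D j) (\bigcap_(j in [set` s]) A j) /\
  pr P (\bigcap_(j in [set` s]) A j) = \prod_(j <- s) pr P (A j) by case.
elim: s us sA dD => [_ _ _|j s IHs /= /andP[js us] sA dD].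
  by rewrite set_nil bigcap_set0 big_nil prT; split=> //; exact: sigT.
have [||s1 s2] := IHs us.
- by move=> k ks; apply: sA; rewrite inE ks orbT.
- by move=> k l ks ls; apply: dD; rewrite inE ?ks ?ls orbT.
have -> : [set` j :: s] = j |` [set` s].
  apply/seteqP; split=> k /=; rewrite inE.
    by case/predU1P => [->|]; [left|right].
  by case=> [->|->]; rewrite ?eqxx ?orbT.
rewrite bigcap_setU1 bigcup_setU1 big_cons; split.
  apply: sigI.
    by apply: sub_sig (sA j (mem_head _ _)); exact: subsetUl.
  by apply: sub_sig s1; exact: subsetUr.
rewrite -s2; apply: (@sig_indep (D j) (\bigcup_(k in [set` s]) D k)) => //.
  apply/seteqP; split=> // i [Dji [k /= ks Dki]].
  have jk : j != k by apply: contraNneq js => ->.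
  have : (D j `&` D k) i by [].
  by rewrite dD ?mem_head ?inE ?ks ?orbT.
exact: sA (mem_head _ _).
Qed.

End BlockIndependence.

(** * Uniform weights: thresholds and ties *)

Section UniformThreshold.
Context {R : realType} {d : measure_display} {T : measurableType d}.
Context {P : probability T R} {I : choiceType}.
Variable X : I -> {RV P >-> R}.
Hypothesis iidX : iid_uniform X.

Lemma uniform_prob_le (p : R) : 0 <= p <= 1 ->
  uniform_prob (@ltr01 R) `]-oo, p] = p%:E.
Proof.
move=> /andP[p0 p1]; rewrite /uniform_prob integral_uniform_pdf.
have -> : `]-oo, p]%classic `&` `[0, 1]%classic = `[0, p]%classic :> set R.
  apply/seteqP; split=> x /=; rewrite !in_itv/=.
    by case=> xp /andP[-> _].
  by move=> /andP[-> xp]; split=> //; exact: le_trans p1.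
rewrite (eq_integral (fun=> 1%:E)); last first.
  move=> x; rewrite inE/= in_itv/= /uniform_pdf => /andP[x0 xp].
  by rewrite x0 (le_trans xp p1) subr0 invr1.
rewrite integral_cst//= lebesgue_measure_itv/= lte_fin mul1e.
by case: ltgtP p0 => // [_|<-]; rewrite ?oppr0 ?adde0 // sube0.
Qed.

Lemma measurable_le_cst i (p : R) : measurable [set t | X i t <= p].
Proof. by apply: (@sig_measurable _ _ _ _ _ X setT); exact: sig_le_cst. Qed.

Lemma pr_le_cst i (p : R) : 0 <= p <= 1 -> pr P [set t | X i t <= p] = p.
Proof.
move=> p01; have [_ /(_ i `]-oo, p]%classic)] := iidX.
rewrite uniform_prob_le// => /(_ (measurable_itv _)).
rewrite /distribution/= /pushforward => h; rewrite /pr.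
have -> : [set t | X i t <= p] = X i @^-1` `]-oo, p].
  by apply/seteqP; split=> t /=; rewrite in_itv.
by rewrite h.
Qed.

Lemma pr_itv i (a b : R) : 0 <= a -> a <= b -> b <= 1 ->
  pr P [set t | a < X i t <= b] = b - a.
Proof.
move=> a0 ab b1.
have -> : [set t | a < X i t <= b] = [set t | X i t <= b] `\` [set t | X i t <= a].
  apply/seteqP; split=> t /=.
    by move=> /andP[at_ tb]; split=> //; apply/negP; rewrite -ltNge.
  by case=> tb /negP; rewrite -ltNge => at_; rewrite at_ tb.
rewrite prD; try exact: measurable_le_cst.
  rewrite !pr_le_cst//; first by rewrite a0 (le_trans ab).
  by rewrite b1 (le_trans a0).
by move=> t /= /le_trans; apply.
Qed.

Lemma sig_itv (D : set I) i (a b : R) : D i -> sig X D [set t | a < X i t <= b].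
Proof.
move=> Di.
have -> : [set t | a < X i t <= b] = [set t | X i t <= b] `\` [set t | X i t <= a].
  apply/seteqP; split=> t /=.
    by move=> /andP[at_ tb]; split=> //; apply/negP; rewrite -ltNge.
  by case=> tb /negP; rewrite -ltNge => at_; rewrite at_ tb.
by apply: sigD; exact: sig_le_cst.
Qed.

Lemma pr_outside i : pr P (~` [set t | 0 < X i t <= 1]) = 0.
Proof.
rewrite prC ?pr_itv ?subr0 ?subrr ?ler01//.
by apply: (@sig_measurable _ _ _ _ _ X setT); exact: sig_itv.
Qed.

Lemma measurable_tie i j : measurable [set t | X i t = X j t].
Proof.
apply: (@sig_measurable _ _ _ _ _ X setT).
have -> : [set t | X i t = X j t] = [set t | X i t <= X j t] `&` [set t | X j t <= X i t].
  apply/seteqP; split=> t /=; first by move=> ->.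
  by move=> [ij ji]; apply/eqP; rewrite eq_le ij ji.
by apply: sigI; exact: sig_le.
Qed.

(** The unit interval is cut into K cells; by independence both variables lie in a common cell with
    probability K / K^2, which is arbitrarily small. *)
Lemma pr_tie i j : i != j -> pr P [set t | X i t = X j t] = 0.
Proof.
move=> ij; apply/eqP; rewrite eq_le pr_ge0 andbT; apply/ler_addgt0Pr => e e0.
rewrite add0r; pose K := (Num.bound e^-1).+1.
have K0 : 0 < K%:R :> R by rewrite ltr0n.
have Ke : K%:R^-1 <= e.
  rewrite invf_ple ?posrE//; apply: le_trans (ltW (archi_boundP _)) _.
    by rewrite invr_ge0 ltW.
  by rewrite ler_nat.
pose cell k (l : 'I_K) : set T := [set t | l%:R / K%:R < X k t <= l.+1%:R / K%:R].
have mcell k l : measurable (cell k l).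
  by apply: (@sig_measurable _ _ _ _ _ X setT); exact: sig_itv.
have pcell k l : pr P (cell k l) = K%:R^-1.
  rewrite pr_itv ?divr_ge0//.
  - by rewrite -mulrBl -natrB// subSnn mul1r.
  - by rewrite ler_wpM2r ?invr_ge0// ler_nat.
  - by rewrite ler_pdivrMr// mul1r ler_nat.
have mO : measurable (~` [set t | 0 < X i t <= 1]).
  apply: measurableC; apply: (@sig_measurable _ _ _ _ _ X setT); exact: sig_itv.
have mC (l : 'I_K) : measurable (cell i l `&` cell j l) by apply: measurableI.
apply: le_trans (_ : pr P (~` [set t | 0 < X i t <= 1] `|`
   \big[setU/set0]_(l <- enum 'I_K) (cell i l `&` cell j l)) <= _).
  apply: pr_le; first exact: measurable_tie.
    by apply: measurableU => //; exact: measurable_bigsetU.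
  move=> t /= tij; have [/andP[X0 X1]|] := boolP (0 < X i t <= 1); last first.
    by move=> h; left; apply/negP.
  right; apply/bigsetUP.
  have [l lX] : exists l : 'I_K, l%:R / K%:R < X i t <= l.+1%:R / K%:R.
    have ex : exists n, X i t <= n.+1%:R / K%:R.
      by exists K.-1; rewrite prednK// divff// gt_eqF.
    case: (ex_minnP ex) => n nX nmin.
    have nK : (n < K)%N.
      by rewrite ltnS -[X in (_ <= X)%N]/K.-1 nmin//= divff// gt_eqF.
    exists (Ordinal nK) => /=; rewrite nX andbT.
    case: n nX nmin nK => [|n] nX nmin nK; first by rewrite mul0r.
    rewrite ltNge; apply/negP => /nmin; by rewrite ltnn.
  exists l; first by rewrite mem_enum.
  by split; rewrite /cell/= -?tij.
apply: le_trans (prU_le P mO (measurable_bigsetU _ mC)) _.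
rewrite pr_outside add0r; apply: le_trans (pr_bigsetU_le P _ mC) _.
have [ind _] := iidX.
have dis : [set i] `&` [set j] = set0.
  by apply/seteqP; split=> // k [/= -> /eqP]; rewrite (negbTE ij).
under eq_bigr => l _.
  rewrite (sig_indep ind dis (sig_itv _ _ (erefl i)) (sig_itv _ _ (erefl j))).
  rewrite !pcell; over.
rewrite big_enum/= sumr_const card_ord -[leLHS]mulr_natl mulrA divff ?mul1r//.
by rewrite gt_eqF.
Qed.

End UniformThreshold.

(** * Infinite paths of small weights *)

Section Rays.
Context {R : realType} {sigma : nat}.
Implicit Types (w : edge sigma -> R) (p : R) (z : vertex sigma) (f : edge sigma).

Fixpoint surv w p (n : nat) z : bool :=
  if n is n'.+1 then [exists i, (w (z, i) <= p) && surv w p n' (rcons z i)]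
  else true.

(** By König's lemma, this says that some infinite path going up from [f.1]
    through [f] has all its weights at most [p]. *)
Definition ray w p f : Prop :=
  w f <= p /\ forall n, surv w p n (upper_end f).

Lemma surv_le w p p' n z : p <= p' -> surv w p n z -> surv w p' n z.
Proof.
move=> pp'; elim: n z => //= n IHn z /existsP[i /andP[wi si]].
by apply/existsP; exists i; rewrite (le_trans wi)//= IHn.
Qed.

Lemma ray_le w p p' f : p <= p' -> ray w p f -> ray w p' f.
Proof.
by move=> pp' [wf sf]; split=> [|n]; [exact: le_trans pp'|exact: surv_le (sf n)].
Qed.

Lemma survS w p n z : surv w p n.+1 z -> surv w p n z.
Proof.
elim: n z => // n IHn z /existsP[i /andP[wi si]].
by apply/existsP; exists i; rewrite wi; exact: IHn.
Qed.

End Rays.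

Section RayProbability.
Context {R : realType} {sigma : nat} {d : measure_display} {T : measurableType d}.
Context {P : probability T R}.
Variable W : edge sigma -> {RV P >-> R}.
Hypothesis iidW : iid_uniform W.
Hypothesis hsigma : (2 <= sigma)%N.
Local Notation w t := (fun e => W e t).

Lemma sig_surv (D : set (edge sigma)) (tau : T -> R) n z :
  (forall f, D f -> sig W D [set t | W f t <= tau t]) ->
  (forall f : edge sigma, prefix z f.1 -> D f) ->
  sig W D [set t | surv (w t) (tau t) n z].
Proof.
move=> sD; elim: n z => [|n IHn] z zD.
  have -> : [set t | surv (w t) (tau t) 0 z] = setT by apply/seteqP.
  exact: sigT.
have -> : [set t | surv (w t) (tau t) n.+1 z] = \bigcup_i
  ([set t | W (z, i) t <= tau t] `&` [set t | surv (w t) (tau t) n (rcons z i)]).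
  apply/seteqP; split=> t /=.
    by move=> /existsP[i /andP[wi si]]; exists i.
  by move=> [i _ [wi si]]; apply/existsP; exists i; rewrite wi.
apply: sig_bigcup => i; apply: sigI; first by apply: sD; apply: zD; exact: prefix_refl.
by apply: IHn => f; move/(prefix_trans (prefix_rcons z i)); exact: zD.
Qed.

Lemma sig_ray (D : set (edge sigma)) (tau : T -> R) f :
  (forall f, D f -> sig W D [set t | W f t <= tau t]) -> D f ->
  (forall g : edge sigma, prefix (upper_end f) g.1 -> D g) ->
  sig W D [set t | ray (w t) (tau t) f].
Proof.
move=> sD Df fD.
have -> : [set t | ray (w t) (tau t) f] = [set t | W f t <= tau t] `&`
    \bigcap_n [set t | surv (w t) (tau t) n (upper_end f)].
  apply/seteqP; split=> t /=; first by move=> [wf sf]; split=> // n _; exact: sf.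
  by move=> [wf sf]; split=> // n; exact: sf.
by apply: sigI; [exact: sD|apply: sig_bigcap => n; exact: sig_surv].
Qed.

(** The probability that [surv] fails at depth n: the iterates at 0 of the generating function of a
    branching process with binomial offspring. *)
Fixpoint extinction (p : R) (n : nat) : R :=
  if n is n'.+1 then (1 - p + p * extinction p n') ^+ sigma else 0.

Definition above z : set (edge sigma) := [set f | prefix z f.1].
Definition from f : set (edge sigma) := [set g | prefix (upper_end f) (upper_end g)].

Lemma fromP f g : from f g <-> g = f \/ above (upper_end f) g.
Proof.
rewrite /from /above /=; split; last first.
  case=> [e|fg]; first by rewrite e prefix_refl.
  exact: prefix_trans fg (prefix_rcons _ _).
rewrite [upper_end g]/upper_end prefix_rconsE => /orP[/eqP e|]; last by right.
left; case: f g e => [z i] [z' i']; rewrite /upper_end/= => /rcons_inj[-> ->].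
by [].
Qed.

Lemma from_disj (f g : edge sigma) : ~~ prefix (upper_end f) (upper_end g) ->
  ~~ prefix (upper_end g) (upper_end f) -> from f `&` from g = set0.
Proof.
move=> fg gf; apply/seteqP; split=> // h [fh gh].
have [le|/ltnW le] := leqP (size (upper_end f)) (size (upper_end g)).
  by rewrite (prefix_size_le fh gh) in fg.
by rewrite (prefix_size_le gh fh) in gf.
Qed.

Lemma edge_above_disj f : [set f] `&` above (upper_end f) = set0.
Proof.
apply/seteqP; split=> // g [-> ]; rewrite /above /=.
by case: f => z i; rewrite /upper_end/= rcons_prefixF.
Qed.

Let ind : mutually_independent W. Proof. by case: iidW. Qed.

Lemma sig_surv_cst p n z : sig W (above z) [set t | surv (w t) p n z].
Proof.
by apply: (@sig_surv _ (fun=> p)) => // f Df; exact: sig_le_cst.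
Qed.

Lemma measurable_surv p n z : measurable [set t | surv (w t) p n z].
Proof. by apply: sig_measurable; exact: sig_surv_cst. Qed.

Lemma sig_ray_cst p f : sig W (from f) [set t | ray (w t) p f].
Proof.
apply: (@sig_ray _ (fun=> p)).
- by move=> g fg; exact: sig_le_cst.
- exact: prefix_refl.
- by move=> g fg; apply/fromP; right.
Qed.

Lemma measurable_ray p f : measurable [set t | ray (w t) p f].
Proof. by apply: sig_measurable; exact: sig_ray_cst. Qed.

Lemma pr_edge_surv p n z i : 0 <= p <= 1 ->
  pr P (~` [set t | surv (w t) p n (rcons z i)]) = extinction p n ->
  pr P (~` ([set t | W (z, i) t <= p] `&` [set t | surv (w t) p n (rcons z i)]))
  = 1 - p + p * extinction p n.
Proof.
move=> p01 e; have ms := measurable_surv p n (rcons z i).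
have ml := measurable_le_cst W (z, i) p.
rewrite prC; last exact: measurableI.
have s1 : sig W [set (z, i)] [set t | W (z, i) t <= p] by exact: sig_le_cst.
have s2 : sig W (above (upper_end (z, i))) [set t | surv (w t) p n (rcons z i)].
  exact: sig_surv_cst.
rewrite (sig_indep ind (edge_above_disj (z, i)) s1 s2).
rewrite (pr_le_cst iidW)//; move: e; rewrite prC// => <-; ring.
Qed.

Lemma pr_surv p n z : 0 <= p <= 1 ->
  pr P (~` [set t | surv (w t) p n z]) = extinction p n.
Proof.
move=> p01; elim: n z => [|n IHn] z /=.
  by rewrite (_ : ~` _ = set0) ?pr0//; apply/seteqP; split=> t /=.
pose A i := ~` ([set t | W (z, i) t <= p] `&` [set t | surv (w t) p n (rcons z i)]).
have -> : ~` [set t | surv (w t) p n.+1 z] = \bigcap_(i in [set` enum 'I_sigma]) A i.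
  apply/seteqP; split=> t /=.
    by move=> h i _ [wi si]; apply: h; apply/existsP; exists i; rewrite wi.
  move=> h /existsP[i /andP[wi si]]; apply: (h i) => //=; exact: mem_enum.
rewrite (sig_indep_seq ind (D := fun i => from (z, i))) ?enum_uniq//.
- under eq_bigr => i _ do rewrite pr_edge_surv//.
  by rewrite big_enum/= prodr_const card_ord.
- move=> i _; apply: sigC; apply: sigI.
    by apply: sig_le_cst; apply/fromP; left.
  have sub : above (rcons z i) `<=` from (z, i) by move=> f ?; apply/fromP; right.
  by apply: (sub_sig sub); exact: sig_surv_cst.
- move=> i j _ _ ij; apply: from_disj; rewrite /upper_end/= prefix_rconsE rcons_prefixF orbF;
  by rewrite eqseq_rcons eqxx//= eq_sym.
Qed.

(** The sequence increases and stays below q because q is a fixed point; its limit is again a fixed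
    point, hence q by [pq_unique]. *)
Lemma extinction_cvg (q : R) : 0 <= q <= 1 ->
  (fun n => 1 - pq sigma q + pq sigma q * extinction (pq sigma q) n) @ \oo --> q.
Proof.
move=> q01; set p := pq sigma q; have p0 : 0 < p by exact: pq_gt0.
have p1 : p <= 1 by exact: pq_le1.
pose s n := 1 - p + p * extinction p n.
have sS n : s n.+1 = 1 - p + p * s n ^+ sigma by [].
have ext0 n : 0 <= extinction p n.
  elim: n => //= n IHn; rewrite exprn_ge0// addr_ge0 ?subr_ge0// mulr_ge0//.
  exact: ltW.
have s0 n : 0 <= s n by rewrite addr_ge0 ?subr_ge0// mulr_ge0// ltW.
have qfix := pq_fix hsigma q01; rewrite -/p in qfix.
have sq n : s n <= q.
  elim: n => [|n IHn].
    rewrite [leRHS]qfix /s/= mulr0 addr0 lerDl mulr_ge0 ?exprn_ge0 ?(ltW p0)//.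
    by case/andP: q01.
  rewrite sS [leRHS]qfix lerD2l ler_wpM2l ?(ltW p0)// lerXn2r ?nnegrE//.
  by case/andP: q01.
have snd : nondecreasing_seq s.
  apply/nondecreasing_seqP; elim=> [|n IHn].
    by rewrite sS {1}/s/= mulr0 addr0 lerDl mulr_ge0 ?exprn_ge0 ?(ltW p0).
  by rewrite sS [leRHS]sS lerD2l ler_wpM2l ?(ltW p0)// lerXn2r ?nnegrE.
have scv : cvgn s.
  by apply: nondecreasing_is_cvgn => //; exists q => _ [n _ <-].
suff <- : limn s = q by [].
apply: (pq_unique hsigma) => //.
- by apply: limr_ge => //; near=> n.
- by apply: limr_le => //; near=> n.
- rewrite -/p; apply: (@cvg_unique _ _ (s n.+1 @[n --> \oo])) => //.
    have h : s @ \oo --> limn s by [].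
    by move: h; rewrite -(cvg_shiftS s).
  apply: cvgD; first exact: cvg_cst.
  apply: cvgM; first exact: cvg_cst.
  exact: (cvg_comp _ _ scv (@exprn_continuous _ sigma _)).
Unshelve. all: by end_near. Qed.

Lemma pr_no_ray (q : R) f : 0 <= q <= 1 ->
  pr P (~` [set t | ray (w t) (pq sigma q) f]) = q.
Proof.
move=> q01; set p := pq sigma q.
have p01 : 0 <= p <= 1 by rewrite ltW ?pq_gt0 ?pq_le1.
pose A n := [set t | W f t <= p] `&` [set t | surv (w t) p n (upper_end f)].
have mA n : measurable (A n).
  by apply: measurableI; [exact: measurable_le_cst|exact: measurable_surv].
have rayE : [set t | ray (w t) p f] = \bigcap_n A n.
  apply/seteqP; split=> t; first by move=> [wf sf] n _; exact: (conj wf (sf n)).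
  by move=> h; split=> [|n]; [case: (h 0%N I)|case: (h n I)].
have cv : P (A n) @[n --> \oo] --> P (\bigcap_n A n).
  apply: nonincreasing_cvg_mu => //.
  - by apply: le_lt_trans (probability_le1 P (mA 0%N)) _; rewrite ltry.
  - exact: bigcapT_measurable.
  - apply/nonincreasing_seqP => n; apply/subsetPset => t [/= wf sf].
    by split=> //; exact: survS.
have mr := measurable_ray p f.
rewrite prC//; suff : pr P [set t | ray (w t) p f] = 1 - q by lra.
apply: (@cvg_unique _ _ (pr P (A n) @[n --> \oo])) => //.
  rewrite rayE; apply: fine_cvg; rewrite /pr fineK ?fin_num_measure//.
  exact: bigcapT_measurable.
have -> : (fun n => pr P (A n)) = (fun n => 1 - (1 - p + p * extinction p n)).
  apply/funext => n; have := pr_edge_surv p01 (pr_surv n (rcons f.1 f.2) p01).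
  by rewrite -surjective_pairing prC; [move=> <-; rewrite opprB addrC subrK|exact: (mA n)].
by apply: cvgB; [exact: cvg_cst|exact: extinction_cvg].
Qed.

End RayProbability.

(** * Subtrees without blocked edges *)

Lemma seq_argmax {R : realType} (T : eqType) (f : T -> R) (s : seq T) x :
  x \in s -> exists2 y, y \in s & forall z, z \in s -> f z <= f y.
Proof.
elim: s x => // a s IHs x _; case: s IHs => [_|b s IHs].
  by exists a; rewrite ?inE// => z; rewrite inE => /eqP->.
have [y ys ymax] := IHs b (mem_head _ _).
have [ay|ya] := leP (f a) (f y).
  exists y; first by rewrite inE ys orbT.
  by move=> z; rewrite inE => /predU1P[->//|/ymax].
exists a; first by rewrite mem_head.
move=> z; rewrite inE => /predU1P[->//|/ymax zy].
exact: le_trans zy (ltW ya).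
Qed.

Lemma prefix_meet (T : eqType) (s t : seq T) : exists u,
  [/\ prefix u s, prefix u t & forall v, prefix v s -> prefix v t -> prefix v u].
Proof.
elim: s t => [|a s IHs] t; first by exists [::]; split; rewrite ?prefix0s.
case: t => [|b t]; first by exists [::]; split; rewrite ?prefix0s.
have [->|ab] := eqVneq a b; last first.
  exists [::]; split; rewrite ?prefix0s// => -[//|c v].
  by rewrite !prefix_cons => /andP[/eqP-> _] /andP[/eqP ba]; rewrite ba eqxx in ab.
have [u [us ut um]] := IHs t; exists (b :: u); split; rewrite ?prefix_cons ?eqxx//.
move=> [|c v]; rewrite ?prefix0s// !prefix_cons => /andP[-> vs] /andP[_ vt].
by rewrite um.
Qed.

Section RayPaths.
Context {R : realType} {sigma : nat}.
Implicit Types (w : edge sigma -> R) (p : R) (u v z : vertex sigma).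

Lemma surv_leq w p n m z : (n <= m)%N -> surv w p m z -> surv w p n z.
Proof.
by move=> /subnK <-; elim: (m - n)%N => //= k IHk /(@survS _ _ w p (k + n)) /IHk.
Qed.

(** The step of König's lemma: if each of the finitely many children failed at some depth, then
    [surv] would fail one level beyond the largest of these. *)
Lemma ray_continue w p z : (forall n, surv w p n z) -> exists i, ray w p (z, i).
Proof.
move=> sz; apply: contrapT => nr.
have nex i : exists n, ~~ ((w (z, i) <= p) && surv w p n (rcons z i)).
  apply: contrapT => h; apply: nr; exists i; split.
    have /contrapT/andP[//] : ~ ~ (w (z, i) <= p) && surv w p 0 (rcons z i).
    by move=> k; apply: h; exists 0%N; exact/negP.
  move=> n; have /contrapT/andP[//] : ~ ~ (w (z, i) <= p) && surv w p n (rcons z i).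
  by move=> k; apply: h; exists n; exact/negP.
pose N := \max_(i < sigma) xchoose (nex i).
have /existsP[i /andP[wi si]] := sz N.+1.
have /negP := xchooseP (nex i); apply; apply/andP; split=> //.
by apply: surv_leq si; exact: (leq_bigmax i).
Qed.

Lemma surv_path w p v z : prefix v z -> (forall n, surv w p n z) ->
  (forall f, prefix v f.1 -> prefix (upper_end f) z -> w f <= p) ->
  forall n, surv w p n v.
Proof.
case/prefixP => s ->; elim: s v => [|i s IHs] v; first by rewrite cats0.
rewrite -cat_rcons => sz wz [//|n].
apply/existsP; exists i; rewrite wz ?prefix_refl ?prefix_prefix//=.
by apply: IHs => // f vf fz; apply: wz => //; exact: prefix_rconsW vf.
Qed.

End RayPaths.

Section GoodEvents.
Context {R : realType} {sigma : nat}.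
Variable S : seq (edge sigma).
Hypothesis uniqS : uniq S.
Hypothesis closedS : forall f g, g \in S -> prefix (upper_end f) (upper_end g) -> f \in S.
Implicit Types (w : edge sigma -> R) (e f g : edge sigma) (y z : vertex sigma) (p : R).

Lemma upper_end_inj : injective (@upper_end sigma).
Proof.
by move=> [z i] [z' i']; rewrite /upper_end => /rcons_inj[-> ->].
Qed.

Definition edges_above y : seq (edge sigma) := [seq e <- S | prefix y e.1].
Definition edges_low y e : seq (edge sigma) :=
  [seq f <- edges_above y | ~~ prefix (upper_end e) (upper_end f)].
Definition vertices_low y e : seq (vertex sigma) :=
  y :: [seq upper_end f | f <- edges_low y e].
(** The edges outside [S] at the vertices that stay behind when [e] is followed from [y]. By
    [ray_exits], an infinite path that starts at such a vertex and avoids [e] passes through one of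
    them. *)
Definition edges_off y e : seq (edge sigma) :=
  [seq f <- [seq (v, i) | v <- vertices_low y e, i <- enum 'I_sigma] | f \notin S].

Definition low w y p : Prop := forall f, f \in edges_above y -> w f <= p.
Definition good w y : Prop := forall e, e \in edges_above y ->
  forall u, prefix y u -> prefix u e.1 ->
  forall i, ~~ prefix (rcons u i) (upper_end e) -> ~ ray w (w e) (u, i).
Definition good_low w y p : Prop := low w y p /\ good w y.
(** [e] has the largest weight among the edges above [y], with distinct cutoffs
    for the weights so as to bound probabilities from both sides. *)
Definition piece w y e (a b c p : R) : Prop :=
  [/\ a < w e <= b, forall f, f \in edges_low y e -> w f <= c,
      forall f, f \in edges_off y e -> ~ ray w p f & good_low w (upper_end e) c].

Lemma edges_aboveE y e : (e \in edges_above y) = prefix y e.1 && (e \in S).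
Proof. by rewrite mem_filter. Qed.

Lemma edges_lowE y e f : (f \in edges_low y e) =
  [&& ~~ prefix (upper_end e) (upper_end f), prefix y f.1 & f \in S].
Proof. by rewrite mem_filter edges_aboveE. Qed.

Lemma edges_offE y e f : (f \in edges_off y e) =
  (f \notin S) && (f.1 \in vertices_low y e).
Proof.
rewrite mem_filter; congr (_ && _); case: f => v i.
apply/allpairsP/idP => [[[v' i'] /= [vl _ [-> _]]]//|vl].
by exists (v, i); split; rewrite //= mem_enum.
Qed.

Lemma edges_above_trans y e f : e \in edges_above y ->
  f \in edges_above (upper_end e) -> f \in edges_above y.
Proof.
rewrite !edges_aboveE => /andP[ye eS] /andP[ef ->]; rewrite andbT.
by apply: prefix_trans ye _; exact: prefix_rconsW ef.
Qed.

Lemma edges_above_cases y e f : e \in edges_above y -> f \in edges_above y ->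
  [\/ f = e, f \in edges_low y e | f \in edges_above (upper_end e)].
Proof.
rewrite edges_lowE !edges_aboveE => /andP[ye eS] /andP[yf fS].
have [|nef] := boolP (prefix (upper_end e) (upper_end f)); last first.
  by constructor 2; rewrite yf fS.
rewrite [upper_end f]/upper_end prefix_rconsE => /orP[/eqP|ef].
  by move/(@upper_end_inj e f) => ->; constructor 1.
by constructor 3; rewrite ef fS.
Qed.

Lemma good_above w y e : e \in edges_above y -> good w y -> good w (upper_end e).
Proof.
move=> ey gy f fe u eu; apply: gy; first exact: edges_above_trans fe.
move: ey; rewrite edges_aboveE => /andP[ye _].
by apply: prefix_trans ye _; exact: prefix_rconsW eu.
Qed.

Lemma vertices_low_above y e v : e \in edges_above y ->
  v \in vertices_low y e -> prefix y v /\ ~~ prefix (upper_end e) v.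
Proof.
rewrite edges_aboveE => /andP[ye _]; rewrite inE => /predU1P[->|/mapP[f]].
  split; first exact: prefix_refl.
  apply/negP => ey; have := prefix_trans ey ye.
  by case: e {ye ey} => z i; rewrite rcons_prefixF.
rewrite edges_lowE => /and3P[nef yf _] ->; split=> //.
exact: prefix_trans yf (prefix_rcons _ _).
Qed.

Lemma vertices_low_edge y e f : f \in S -> prefix y f.1 ->
  ~~ prefix (upper_end e) (upper_end f) -> upper_end f \in vertices_low y e.
Proof.
by move=> fS yf nef; rewrite inE map_f ?orbT// edges_lowE nef yf fS.
Qed.

(** [e] is an edge of largest weight, which must exceed p. An infinite path through an edge of
    [edges_off] with weights at most p would block [e]: it can be prolonged downwards to the path to
    [e] by edges of [S], whose weights are at most that of [e]. *)
Lemma good_low_upper w y p p' : p <= p' -> good_low w y p' -> ~ good_low w y p ->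
  exists2 e, e \in edges_above y & piece w y e p p' p' p.
Proof.
move=> pp' [lowy gy] nh.
have [f fy pf] : exists2 f, f \in edges_above y & p < w f.
  apply: contrapT => nex; apply: nh; split=> // f fy; rewrite leNgt.
  by apply/negP => pf; apply: nex; exists f.
have [e ey emax] := seq_argmax w fy; exists e => //.
have pe : p < w e by apply: lt_le_trans (emax f fy).
split.
- by rewrite pe lowy.
- by move=> g; rewrite mem_filter => /andP[_ /lowy].
- move=> g; rewrite edges_offE => /andP[gS gv] rg.
  have [yg neg] := vertices_low_above ey gv.
  have [ye eS] : prefix y e.1 /\ e \in S by move: ey; rewrite edges_aboveE => /andP[].
  have [u [ug ue um]] := prefix_meet g.1 e.1.
  have yu : prefix y u by apply: um.
  have rg' : forall n, surv w (w e) n g.1.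
    case=> // n; apply/existsP; exists g.2; rewrite -surjective_pairing.
    have [wg sg] := ray_le (ltW pe) rg.
    by apply/andP; split; [exact: wg|exact: sg].
  have [ueq|une] := eqVneq u g.1.
    apply: (gy e ey u yu ue g.2); last first.
      by rewrite ueq -surjective_pairing; exact: ray_le (ltW pe) rg.
    by rewrite ueq; apply: contra gS => /closedS; apply.
  have [j uj] := prefix_next ug une.
  have nj : ~~ prefix (rcons u j) (upper_end e).
    rewrite /upper_end prefix_rconsE negb_or; apply/andP; split.
      apply: contra neg => /eqP ej; rewrite /upper_end -ej; exact: uj.
    by apply/negP => /(um _ uj); rewrite rcons_prefixF.
  have gup : exists2 h, h \in edges_low y e & g.1 = upper_end h.
    move: gv; rewrite inE => /predU1P[gy'|/mapP[h hl ->]]; last by exists h.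
    by have := prefix_trans uj (_ : prefix g.1 u); rewrite gy' rcons_prefixF => /(_ yu).
  case: gup => h; rewrite edges_lowE => /and3P[_ yh hS] gh.
  have wle k : prefix u k.1 -> prefix (upper_end k) g.1 -> w k <= w e.
    move=> uk kg; apply: emax; rewrite edges_aboveE (prefix_trans yu uk)/=.
    by apply: (closedS hS); rewrite -gh.
  apply: (gy e ey u yu ue j nj); split.
    by apply: wle; rewrite /upper_end ?prefix_refl.
  apply: surv_path uj rg' _ => k ujk kg; apply: wle => //.
  exact: prefix_rconsW ujk.
- split; last exact: good_above gy.
  by move=> g /(edges_above_trans ey) /lowy.
Qed.

(** [S] has bounded depth, so the path leaves it; as it avoids [e], it does so at a vertex of
    [vertices_low]. *)
Lemma ray_exits w y e v i p p' : e \in edges_above y ->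
  v \in vertices_low y e -> p <= p' -> ray w p (v, i) ->
  (forall h, prefix (rcons v i) (upper_end h) -> w h <= p -> h != e) ->
  exists2 f, f \in edges_off y e & ray w p' f.
Proof.
move=> ey + pp'.
have [k kP] : exists k, forall g, g \in S -> (size (upper_end g) <= size v + k)%N.
  exists (\max_(g <- S) size (upper_end g)) => g gS.
  by apply: leq_trans (leq_addl _ _); apply: leq_bigmax_seq.
elim: k v i kP => [|k IHk] v i kP vl rv ne.
  exists (v, i); last exact: ray_le rv.
  rewrite edges_offE vl andbT; apply/negP => /kP.
  by rewrite /upper_end size_rcons addn0 ltnn.
have [viS|viS] := boolP ((v, i) \in S); last first.
  by exists (v, i); [rewrite edges_offE viS|exact: ray_le rv].
have [yv nev] := vertices_low_above ey vl.
case: rv => wv /ray_continue[j rj].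
apply: (IHk (rcons v i) j) => //.
- by move=> g gS; rewrite size_rcons addSnnS; exact: kP.
- apply: (@vertices_low_edge y e (v, i)) => //.
  rewrite /upper_end /= prefix_rconsE negb_or nev andbT.
  have /eqP vine : (v, i) != e by apply: ne; rewrite ?prefix_refl.
  by apply/eqP => evi; apply: vine; apply: upper_end_inj.
- by move=> h hp; apply: ne; exact: prefix_rconsW hp.
Qed.

(** Among the edges above [y] only [e] weighs more than p. A path blocking [f] that leaves above [e]
    is excluded by [goode]. Any other one avoids [e]: if [f] differs from [e] its weights are at
    most p, and if [f] is [e] it goes another way. It then exits through [edges_off], contrary to
    [noray]. *)
Lemma piece_lower w y e p p' : p <= p' -> e \in edges_above y ->
  piece w y e p p' p p' -> good_low w y p' /\ ~ good_low w y p.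
Proof.
move=> pp' ey [/andP[pe ep'] wlow noray [lowe goode]].
split; last by move=> [/(_ e ey)]; rewrite leNgt pe.
have wle f : f \in edges_above y -> f != e -> w f <= p.
  move=> fy fe; have [fe'|fl|fu] := edges_above_cases ey fy.
  - by rewrite fe' eqxx in fe.
  - exact: wlow.
  - exact: lowe.
split.
  move=> f fy; have [->//|/(wle f fy) h] := eqVneq f e; exact: le_trans pp'.
move=> f fy u yu uf i nuif rui.
have [eu|neu] := boolP (prefix (upper_end e) u).
  apply: (goode f _ u eu uf i nuif rui).
  by move: fy; rewrite !edges_aboveE => /andP[_ ->]; rewrite (prefix_trans eu uf).
have fS : f \in S by move: fy; rewrite edges_aboveE => /andP[].
have ul : u \in vertices_low y e.
  have [->|yneu] := eqVneq u y; first by rewrite inE eqxx.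
  case/lastP: u yu uf neu yneu {nuif rui} => [|u j] yu uf neu yneu.
    by move: yu; rewrite prefixs0 => /eqP yn; rewrite yn eqxx in yneu.
  apply: (@vertices_low_edge y e (u, j)) => //.
    apply: (closedS fS); exact: prefix_trans uf (prefix_rcons _ _).
  by move: yu; rewrite prefix_rconsE eq_sym (negbTE yneu).
have wf : w f <= p'.
  by have [->//|/(wle f fy) h] := eqVneq f e; exact: le_trans pp'.
have [g gl rg] : exists2 g, g \in edges_off y e & ray w p' g.
  apply: (ray_exits ey ul wf rui) => h uih wh; apply/eqP => he.
  have [fe|fe] := eqVneq f e.
    by rewrite he -fe in uih; rewrite uih in nuif.
  have := wle f fy fe; rewrite leNgt => /negP; apply.
  by apply: lt_le_trans wh; rewrite he.
exact: noray rg.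
Qed.

Lemma piece_disjoint w y e f p p' : e \in edges_above y -> f \in edges_above y ->
  piece w y e p p' p p' -> piece w y f p p' p p' -> e = f.
Proof.
move=> ey fy [_ wlow _ [lowe _]] [/andP[pf _] _ _ _].
have [//|fl|fu] := edges_above_cases ey fy.
- by have := wlow f fl; rewrite leNgt pf.
- by have := lowe f fu; rewrite leNgt pf.
Qed.

Lemma size_edges_low y e : e \in edges_above y ->
  (size (edges_above y) = (size (edges_low y e) + size (edges_above (upper_end e))).+1)%N.
Proof.
move=> ey; have [ye eS] : prefix y e.1 /\ e \in S.
  by move: ey; rewrite edges_aboveE => /andP[].
rewrite -(count_predC (fun f => ~~ prefix (upper_end e) (upper_end f)) (edges_above y)).
rewrite -size_filter -/(edges_low y e) -addnS; congr (_ + _)%N.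
rewrite -size_filter -[RHS]/(size (e :: edges_above (upper_end e))).
apply: perm_size; apply: uniq_perm.
- by rewrite !filter_uniq.
- rewrite cons_uniq edges_aboveE filter_uniq// andbT; case: e {ey ye eS} => z i.
  by rewrite /upper_end/= rcons_prefixF.
move=> f; rewrite mem_filter in_cons !edges_aboveE /= negbK.
apply/idP/idP => [/andP[ef /andP[yf fS]]|/predU1P[->|/andP[ef fS]]].
- move: ef; rewrite [upper_end f]/upper_end prefix_rconsE => /orP[/eqP|->].
    by move/(@upper_end_inj e f) => ->; rewrite eqxx.
  by rewrite fS orbT.
- by rewrite prefix_refl ye.
- rewrite fS (prefix_trans ye (prefix_rconsW ef)) andbT.
  by rewrite andbT; exact: prefix_trans ef (prefix_rcons _ _).
Qed.

(** With m edges left behind there are m + 1 vertices and sigma (m + 1) edges going up from them;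
    exactly m + 1 of these, the edges left behind and [e], lie in [S]. *)
Lemma size_edges_off y e : e \in edges_above y ->
  size (edges_off y e) = (sigma.-1 * (size (edges_low y e)).+1)%N.
Proof.
move=> ey; have [ye eS] : prefix y e.1 /\ e \in S.
  by move: ey; rewrite edges_aboveE => /andP[].
set A := [seq (v, i) | v <- vertices_low y e, i <- enum 'I_sigma].
have sA : size A = (sigma * (size (edges_low y e)).+1)%N.
  by rewrite size_allpairs size_enum_ord /= size_map mulnC.
have uV : uniq (vertices_low y e).
  rewrite /= map_inj_uniq ?filter_uniq ?andbT//; last exact: upper_end_inj.
  apply/mapP => -[f]; rewrite edges_lowE => /and3P[_ yf _] yE.
  by move: yf; rewrite yE; case: f {yE} => z i; rewrite /upper_end rcons_prefixF.
have uA : uniq A.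
  by apply: allpairs_uniq => //; [exact: enum_uniq|move=> [? ?] [? ?] _ _ [-> ->]].
have := count_predC (fun f => f \in S) A; rewrite sA.
rewrite -!size_filter -[in X in (_ + X)%N]/(edges_off y e).
have -> : size [seq f <- A | f \in S] = (size (edges_low y e)).+1.
  rewrite -[RHS]/(size (e :: edges_low y e)); apply: perm_size; apply: uniq_perm.
  - exact: filter_uniq.
  - by rewrite cons_uniq edges_lowE prefix_refl !filter_uniq.
  move=> f; rewrite mem_filter inE; apply/idP/idP.
    move=> /andP[fS /allpairsP[[v i] /= [vl _ fE]]].
    have [yv nev] := vertices_low_above ey vl.
    have [//|fe] := eqVneq f e; rewrite edges_lowE fS fE /= yv !andbT.
    rewrite /upper_end /= prefix_rconsE negb_or nev andbT.
    apply: contra fe => /eqP h; apply/eqP; apply: upper_end_inj.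
    by rewrite fE.
  have key g : g \in S -> prefix y g.1 -> ~~ prefix (upper_end e) g.1 -> g \in A.
    case: g => v i /= gS yv nev; apply/allpairsP; exists (v, i); split=> //=.
      have [->|yneu] := eqVneq v y; first by rewrite inE eqxx.
      case/lastP: v yv nev yneu gS => [|v j] yv nev yneu gS.
        by move: yv; rewrite prefixs0 => /eqP yn; rewrite yn eqxx in yneu.
      apply: (@vertices_low_edge y e (v, j)) => //.
        by apply: (closedS gS); rewrite /upper_end/= prefix_rcons.
      by move: yv; rewrite prefix_rconsE eq_sym (negbTE yneu).
    by rewrite mem_enum.
  move=> /predU1P[->|]; first by rewrite eS key//; case: (e) => z i; rewrite rcons_prefixF.
  rewrite edges_lowE => /and3P[nef yf fS]; rewrite fS key//.
  by apply: contra nef => /prefix_trans; apply; exact: prefix_rcons.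
move=> h; have -> : size (edges_off y e) =
    (sigma * (size (edges_low y e)).+1 - (size (edges_low y e)).+1)%N.
  by rewrite -h addKn.
by rewrite -[X in (_ - X)%N]mul1n -mulnBl subn1.
Qed.

End GoodEvents.

Lemma pr_bigcup0 {R : realType} {d : measure_display} {T : measurableType d}
    (P : probability T R) (J : countType) (F : J -> set T) :
  (forall j, measurable (F j)) -> (forall j, pr P (F j) = 0) ->
  measurable (\bigcup_j F j) /\ pr P (\bigcup_j F j) = 0.
Proof.
move=> mF F0; pose G n := if @unpickle J n is Some j then F j else set0.
have -> : \bigcup_j F j = \bigcup_n G n.
  apply/seteqP; split=> t.
    by move=> [j _ Fj]; exists (pickle j) => //; rewrite /G pickleK.
  by move=> [n _]; rewrite /G; case: unpickle => // j Fj; exists j.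
have mG n : measurable (G n) by rewrite /G; case: unpickle.
have mU : measurable (\bigcup_n G n) by exact: bigcupT_measurable.
split=> //; apply: EFin_inj; rewrite -prE//; apply/eqP.
rewrite eq_le measure_ge0 andbT.
apply: le_trans (generalized_Boole_inequality P mG mU) _.
rewrite eseries0// => n _ _ /=; rewrite prE//; congr EFin.
by rewrite /G; case: unpickle => [j|]; [exact: F0|exact: pr0].
Qed.

(** * The probability that no edge is blocked *)

Section GoodProbability.
Context {R : realType} {sigma : nat} {d : measure_display} {T : measurableType d}.
Context {P : probability T R}.
Variable W : edge sigma -> {RV P >-> R}.
Hypothesis iidW : iid_uniform W.
Hypothesis hsigma : (2 <= sigma)%N.
Variable S : seq (edge sigma).
Hypothesis uniqS : uniq S.
Hypothesis closedS : forall f g, g \in S -> prefix (upper_end f) (upper_end g) -> f \in S.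
Local Notation w t := (fun e => W e t).
Local Notation edges_above := (edges_above S).
Local Notation edges_low := (edges_low S).
Local Notation edges_off := (edges_off S).

Let ind : mutually_independent W. Proof. by case: iidW. Qed.

Definition good_set y p : set T := [set t | good_low S (w t) y p].

Lemma sig_low y p : sig W (above y) [set t | low S (w t) y p].
Proof.
have -> : [set t | low S (w t) y p] = \bigcap_f
    (if f \in edges_above y then [set t | W f t <= p] else setT).
  apply/seteqP; split=> t h f => [_|fy]; first by case: ifP => // /h.
  by have := h f Logic.I; rewrite fy.
apply: sig_bigcap => f; case: ifPn => [fy|_]; last exact: sigT.
apply: sig_le_cst; move: fy; rewrite edges_aboveE => /andP[].
by [].
Qed.

Lemma sig_good y : sig W (above y) [set t | good S (w t) y].
Proof.
pose cond (x : edge sigma * vertex sigma * 'I_sigma) :=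
  [&& x.1.1 \in edges_above y, prefix y x.1.2, prefix x.1.2 x.1.1.1 &
      ~~ prefix (rcons x.1.2 x.2) (upper_end x.1.1)].
have -> : [set t | good S (w t) y] = \bigcap_x
    (if cond x then ~` [set t | ray (w t) (W x.1.1 t) (x.1.2, x.2)] else setT).
  apply/seteqP; split=> t h.
    by move=> [[e u] i] _; case: ifPn => // /and4P[/= ey yu ue nui]; exact: h.
  move=> e ey u yu ue i nui; have := h (e, u, i) Logic.I.
  by rewrite /cond /= ey yu ue nui.
apply: sig_bigcap => -[[e u] i]; case: ifPn => [/and4P[/= ey yu ue nui]|_]; last first.
  exact: sigT.
apply: sigC; apply: sig_ray.
- move=> f yf; apply: sig_le => //.
  by move: ey; rewrite edges_aboveE => /andP[].
- exact: yu.
- by move=> f; rewrite /upper_end/= => /prefix_rconsW; exact: prefix_trans yu.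
Qed.

Lemma sig_good_set y p : sig W (above y) (good_set y p).
Proof. by apply: sigI; [exact: sig_low|exact: sig_good]. Qed.

Lemma measurable_good_set y p : measurable (good_set y p).
Proof. by apply: sig_measurable; exact: sig_good_set. Qed.

Definition piece_set y e a b c p : set T := [set t | piece S (w t) y e a b c p].

Lemma edges_off_incomparable y e f : e \in edges_above y ->
  f \in edges_off y e -> ~~ prefix (upper_end e) (upper_end f) /\
  ~~ prefix (upper_end f) (upper_end e).
Proof.
move=> ey; rewrite edges_offE => /andP[fS fv].
have [yf nef] := vertices_low_above ey fv.
have eS : e \in S by move: ey; rewrite edges_aboveE => /andP[].
split; last by apply: contra fS; exact: closedS.
rewrite [upper_end f]/upper_end prefix_rconsE negb_or nef andbT.
by apply: contra fS => /eqP/(@upper_end_inj _ e f) <-.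
Qed.

Lemma edges_off_incomparable2 y e f g : e \in edges_above y ->
  f \in edges_off y e -> g \in edges_off y e -> f != g ->
  ~~ prefix (upper_end f) (upper_end g).
Proof.
move=> ey; rewrite !edges_offE => /andP[fS fv] /andP[gS gv] fg.
rewrite [upper_end g]/upper_end prefix_rconsE negb_or; apply/andP; split.
  by apply: contra fg => /eqP/(@upper_end_inj _ f g)/eqP.
move: gv; rewrite inE => /predU1P[->|/mapP[h]].
  have [yf _] := vertices_low_above ey fv.
  apply/negP => /size_prefix; have := size_prefix yf.
  by rewrite /upper_end size_rcons => yf' fy; have := leq_ltn_trans yf' fy; rewrite ltnn.
rewrite edges_lowE => /and3P[_ _ hS] ->.
by apply: contra fS; exact: closedS.
Qed.

(** The event is an intersection over disjoint blocks of edges: [e] with everything above it, each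
    edge of [edges_low] by itself, and each edge of [edges_off] with everything above it. *)
Lemma pr_piece y e a b c q : e \in edges_above y -> 0 <= a -> a <= b -> b <= 1 ->
  0 <= c <= 1 -> 0 <= q <= 1 ->
  measurable (piece_set y e a b c (pq sigma q)) /\
  pr P (piece_set y e a b c (pq sigma q)) =
  (b - a) * c ^+ size (edges_low y e) * q ^+ size (edges_off y e) *
  pr P (good_set (upper_end e) c).
Proof.
move=> ey a0 ab b1 c01 q01.
have eS : e \in S by move: ey; rewrite edges_aboveE => /andP[].
pose A f : set T := if f == e then [set t | a < W e t <= b] `&` good_set (upper_end e) c
  else if f \in edges_low y e then [set t | W f t <= c]
  else ~` [set t | ray (w t) (pq sigma q) f].
pose D f : set (edge sigma) := if f \in edges_low y e then [set f] else from f.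
pose L := e :: edges_low y e ++ edges_off y e.
have e_low : e \notin edges_low y e by rewrite edges_lowE prefix_refl.
have off_nlow f : f \in edges_off y e -> f \notin edges_low y e.
  by rewrite edges_offE edges_lowE => /andP[/negbTE-> _]; rewrite !andbF.
have off_ne f : f \in edges_off y e -> f != e.
  by rewrite edges_offE => /andP[fS _]; apply: contraNneq fS => ->.
have low_ne f : f \in edges_low y e -> f != e by apply: contraTneq => ->.
have uV : uniq (vertices_low S y e).
  rewrite /= map_inj_uniq ?filter_uniq ?andbT//; last exact: upper_end_inj.
  apply/mapP => -[f]; rewrite edges_lowE => /and3P[_ yf _] yE.
  by move: yf; rewrite yE; case: f {yE} => z i; rewrite /upper_end rcons_prefixF.
have uoff : uniq (edges_off y e).
  apply: filter_uniq; apply: allpairs_uniq => //; first exact: enum_uniq.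
  by move=> [? ?] [? ?] _ _ [-> ->].
have uL : uniq L.
  rewrite /L cons_uniq mem_cat negb_or e_low cat_uniq uoff !filter_uniq//= andbT.
  apply/andP; split; first by apply/negP => /off_ne; rewrite eqxx.
  by apply/hasPn => f /off_nlow.
have sA f : f \in L -> sig W (D f) (A f).
  rewrite in_cons mem_cat /A /D => /orP[/eqP->|/orP[fl|fo]].
  - rewrite eqxx (negbTE e_low); apply: sigI.
      by apply: sig_itv; apply/fromP; left.
    apply: (sub_sig (_ : above (upper_end e) `<=` from e)); last exact: sig_good_set.
    by move=> g ?; apply/fromP; right.
  - by rewrite (negbTE (low_ne _ fl)) fl; exact: sig_le_cst.
  - rewrite (negbTE (off_ne _ fo)) (negbTE (off_nlow _ fo)).
    by apply: sigC; exact: sig_ray_cst.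
have dD f g : f \in L -> g \in L -> f != g -> D f `&` D g = set0.
  have low_from h k : h \in edges_low y e -> k \in L -> k \notin edges_low y e ->
      [set h] `&` from k = set0.
    move=> hl kL kl; apply/seteqP; split=> // x [-> kh].
    move: kL; rewrite in_cons mem_cat (negbTE kl)/= => /predU1P[ke|ko].
      by move: hl; rewrite edges_lowE -ke kh.
    move: ko; rewrite edges_offE => /andP[/negP kS _]; apply: kS.
    by apply: closedS kh; move: hl; rewrite edges_lowE => /and3P[].
  move=> fL gL fg; rewrite /D; case: ifPn => fl; case: ifPn => gl.
  - by apply/seteqP; split=> // x [-> /= fg']; rewrite fg' eqxx in fg.
  - exact: low_from.
  - by rewrite setIC; exact: low_from.
  move: fL gL; rewrite !in_cons !mem_cat (negbTE fl) (negbTE gl)/=.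
  move=> /predU1P[fe|fo] /predU1P[ge|go].
  - by rewrite fe ge eqxx in fg.
  - by rewrite fe; have [? ?] := edges_off_incomparable ey go; exact: from_disj.
  - by rewrite ge; have [? ?] := edges_off_incomparable ey fo; exact: from_disj.
  - apply: from_disj; first exact: edges_off_incomparable2 ey fo go fg.
    by apply: edges_off_incomparable2 ey go fo _; rewrite eq_sym.
have pE : piece_set y e a b c (pq sigma q) = \bigcap_(f in [set` L]) A f.
  apply/seteqP; split=> t.
    move=> [wab wl wo gl] f /=; rewrite in_cons mem_cat /A => /orP[/eqP->|/orP[fl|fo]].
    - by rewrite eqxx.
    - by rewrite (negbTE (low_ne _ fl)) fl; exact: wl.
    - by rewrite (negbTE (off_ne _ fo)) (negbTE (off_nlow _ fo)); exact: wo.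
  move=> h; have := h e (mem_head _ _); rewrite /A eqxx => -[wab gl]; split=> //.
    move=> f fl; have := h f; rewrite /= in_cons mem_cat fl orbT => /(_ isT).
    by rewrite /A (negbTE (low_ne _ fl)) fl.
  move=> f fo; have := h f; rewrite /= in_cons mem_cat fo !orbT => /(_ isT).
  by rewrite /A (negbTE (off_ne _ fo)) (negbTE (off_nlow _ fo)).
split.
  rewrite pE; apply: fin_bigcap_measurable => // f fL.
  by apply: sig_measurable; exact: sA.
rewrite pE (sig_indep_seq ind uL sA dD) /L big_cons big_cat /=.
have -> : pr P (A e) = (b - a) * pr P (good_set (upper_end e) c).
  rewrite /A eqxx; have s1 : sig W [set e] [set t | a < W e t <= b] by exact: sig_itv.
  have s2 : sig W (above (upper_end e)) (good_set (upper_end e) c).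
    exact: sig_good_set.
  by rewrite (sig_indep ind (edge_above_disj e) s1 s2) (pr_itv iidW).
have -> : \prod_(f <- edges_low y e) pr P (A f) = c ^+ size (edges_low y e).
  rewrite (eq_big_seq (fun=> c)); last first.
    by move=> f fl; rewrite /A (negbTE (low_ne _ fl)) fl (pr_le_cst iidW).
  by rewrite big_const_seq count_predT iter_mulr_1.
have -> : \prod_(f <- edges_off y e) pr P (A f) = q ^+ size (edges_off y e).
  rewrite (eq_big_seq (fun=> q)); last first.
    move=> f fo; rewrite /A (negbTE (off_ne _ fo)) (negbTE (off_nlow _ fo)).
    exact: pr_no_ray.
  by rewrite big_const_seq count_predT iter_mulr_1.
by ring.
Qed.

Lemma measurable_low y p : measurable [set t | low S (w t) y p].
Proof. by apply: sig_measurable; exact: sig_low. Qed.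

Lemma pr_low y p : 0 <= p <= 1 ->
  pr P [set t | low S (w t) y p] = p ^+ size (edges_above y).
Proof.
move=> p01.
have -> : [set t | low S (w t) y p] =
    \bigcap_(f in [set` edges_above y]) [set t | W f t <= p].
  by apply/seteqP; split=> t h f; exact: h.
rewrite (sig_indep_seq ind (D := fun f => [set f])) ?filter_uniq//.
- under eq_bigr => f _ do rewrite (pr_le_cst iidW)//.
  by rewrite big_const_seq count_predT iter_mulr_1.
- by move=> f _; exact: sig_le_cst.
- move=> f g _ _ fg; apply/seteqP; split=> // x [-> /= e].
  by rewrite e eqxx in fg.
Qed.

(** The level at q = 1 is the critical one, 1/sigma, at which there is almost surely no infinite
    path, so that only the bound on the weights remains. This is the boundary value for the integral
    equation. *)
Lemma pr_good_set1 y :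
  pr P (good_set y (pq sigma 1)) = pq sigma 1 ^+ size (edges_above y).
Proof.
set p := pq sigma 1; have p01 : 0 <= p <= 1 by rewrite ltW ?pq_gt0 ?pq_le1.
have mH := measurable_good_set y p; have mL := measurable_low y p.
have HL : good_set y p `<=` [set t | low S (w t) y p] by move=> t [].
apply/eqP; rewrite -(pr_low y p01) eq_le pr_le//=.
rewrite -subr_le0 -prD//.
have [||mU U0] := @pr_bigcup0 _ _ _ P (edge sigma) (fun f => [set t | ray (w t) p f]).
- by move=> f; exact: measurable_ray.
- move=> f; have := @pr_no_ray _ _ _ _ _ W iidW hsigma 1 f.
  rewrite prC; last exact: measurable_ray.
  by rewrite ler01 lexx -/p => /(_ isT); lra.
rewrite -U0; apply: pr_le => //; first exact: measurableD.
move=> t [lowt ngood]; apply: contrapT => nray; apply: ngood; split=> //.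
move=> e ey u _ _ i _ rui; apply: nray; exists (u, i) => //.
by apply: ray_le rui; exact: lowt.
Qed.

Lemma good_set_le y p p' : p <= p' -> good_set y p `<=` good_set y p'.
Proof.
by move=> pp' t [lowt goodt]; split=> // f fy; exact: le_trans (lowt f fy) pp'.
Qed.

(** The pieces cover the increment. In [pr_good_lower] the cutoffs are exchanged, which makes the
    pieces disjoint and contained in it; the two sums differ only by exchanging q and q' in the
    powers and in [good_set]. *)
Lemma pr_good_upper y q q' : 0 <= q <= 1 -> 0 <= q' <= 1 ->
  pq sigma q <= pq sigma q' ->
  pr P (good_set y (pq sigma q')) - pr P (good_set y (pq sigma q)) <=
  \sum_(e <- edges_above y) (pq sigma q' - pq sigma q) *
    pq sigma q' ^+ size (edges_low y e) * q ^+ size (edges_off y e) *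
    pr P (good_set (upper_end e) (pq sigma q')).
Proof.
move=> q01 q01'; set p := pq sigma q; set p' := pq sigma q' => pp'.
have p0 : 0 <= p by rewrite ltW// pq_gt0.
have p0' : 0 <= p' by rewrite ltW// pq_gt0.
have p1' : p' <= 1 by rewrite pq_le1.
rewrite -prD; [|exact: measurable_good_set|exact: measurable_good_set|exact: good_set_le].
pose F e := if e \in edges_above y then piece_set y e p p' p' p else set0.
have FP e : e \in edges_above y -> measurable (F e) /\ pr P (F e) =
    (p' - p) * p' ^+ size (edges_low y e) * q ^+ size (edges_off y e) *
    pr P (good_set (upper_end e) p').
  by move=> ey; rewrite /F ey; apply: pr_piece => //; rewrite p0' p1'.
have mF e : measurable (F e).
  by rewrite /F; case: ifP => // ey; have [] := FP e ey; rewrite /F ey.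
apply: le_trans (_ : pr P (\big[setU/set0]_(e <- edges_above y) F e) <= _).
  apply: pr_le; first by apply: measurableD; exact: measurable_good_set.
    exact: measurable_bigsetU.
  move=> t [gp' ngp]; have [e ey pe] := good_low_upper closedS pp' gp' ngp.
  by apply/bigsetUP; exists e => //; rewrite /F ey.
apply: le_trans (pr_bigsetU_le P _ mF) _.
by rewrite big_seq [leRHS]big_seq; apply: ler_sum => e ey; case: (FP e ey) => _ ->.
Qed.

Lemma pr_good_lower y q q' : 0 <= q <= 1 -> 0 <= q' <= 1 ->
  pq sigma q <= pq sigma q' ->
  \sum_(e <- edges_above y) (pq sigma q' - pq sigma q) *
    pq sigma q ^+ size (edges_low y e) * q' ^+ size (edges_off y e) *
    pr P (good_set (upper_end e) (pq sigma q)) <=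
  pr P (good_set y (pq sigma q')) - pr P (good_set y (pq sigma q)).
Proof.
move=> q01 q01'; set p := pq sigma q; set p' := pq sigma q' => pp'.
have p0 : 0 <= p by rewrite ltW// pq_gt0.
have p1 : p <= 1 by rewrite pq_le1.
have p1' : p' <= 1 by rewrite pq_le1.
rewrite -prD; [|exact: measurable_good_set|exact: measurable_good_set|exact: good_set_le].
pose F e := if e \in edges_above y then piece_set y e p p' p p' else set0.
have FP e : e \in edges_above y -> measurable (F e) /\ pr P (F e) =
    (p' - p) * p ^+ size (edges_low y e) * q' ^+ size (edges_off y e) *
    pr P (good_set (upper_end e) p).
  by move=> ey; rewrite /F ey; apply: pr_piece => //; rewrite p0 p1.
have mF e : measurable (F e).
  by rewrite /F; case: ifP => // ey; have [] := FP e ey; rewrite /F ey.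
apply: le_trans (_ : pr P (\big[setU/set0]_(e <- edges_above y) F e) <= _).
  rewrite pr_bigsetU ?filter_uniq//.
    rewrite big_seq [leRHS]big_seq; apply: ler_sum => e ey.
    by case: (FP e ey) => _ ->.
  move=> e f ey fy ef; apply/seteqP; split=> // t; rewrite /F ey fy => -[pe pf].
  by have := piece_disjoint ey fy pe pf; move/eqP; rewrite (negbTE ef).
apply: pr_le; first exact: measurable_bigsetU.
  by apply: measurableD; exact: measurable_good_set.
move=> t /bigsetUP[e ey]; rewrite /F ey => pe.
by have [] := piece_lower closedS pp' ey pe.
Qed.

End GoodProbability.

(** * The integral equation and its expansion *)

Section GoodIntegral.
Context {R : realType} {sigma : nat} {d : measure_display} {T : measurableType d}.
Context {P : probability T R}.
Variable W : edge sigma -> {RV P >-> R}.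
Hypothesis iidW : iid_uniform W.
Hypothesis hsigma : (2 <= sigma)%N.
Variable S : seq (edge sigma).
Hypothesis uniqS : uniq S.
Hypothesis closedS : forall f g, g \in S -> prefix (upper_end f) (upper_end g) -> f \in S.
Local Notation edges_above := (edges_above S).
Local Notation edges_low := (edges_low S).
Local Notation p_ := (@pq R sigma).

(** The power of [sigma] turns the probability [p ^+ m] for the [m] edges of the tree
    left behind, times the probabilities that the edges leaving these start no
    infinite path, into [bq q ^+ m]. *)
Definition Phi (y : vertex sigma) (q : R) : R :=
  sigma%:R ^+ size (edges_above y) * pr P (good_set W S y (p_ q)).

Definition rate (y : vertex sigma) (q : R) : R :=
  \sum_(e <- edges_above y)
    rhoq sigma q * (bq sigma q ^+ size (edges_low y e) * Phi (upper_end e) q).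

(** The bounds of [pr_good_upper] and [pr_good_lower], normalised and divided by the increment of
    the level; [s] governs the weights and [t] the extinction probabilities. On the diagonal this is
    the derivative of [Phi y] with respect to the level. *)
Let secant (y : vertex sigma) (s t : R) : R :=
  \sum_(e <- edges_above y) sigma%:R * clamp t ^+ sigma.-1 *
    (sigma%:R * p_ s * clamp t ^+ sigma.-1) ^+ size (edges_low y e) *
    Phi (upper_end e) s.

Lemma pq_clamp (q : R) : p_ (clamp q) = p_ q.
Proof.
by rewrite /pq /Dq; congr _^-1; apply: eq_bigr => j _; rewrite clamp_id// clamp_ge0 clamp_le1.
Qed.

Lemma secantP y (s t : R) : p_ s <= p_ t ->
  (p_ t - p_ s) * secant y s t <= Phi y t - Phi y s <= (p_ t - p_ s) * secant y t s.
Proof.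
move=> pst; have cl (x : R) : 0 <= clamp x <= 1 by rewrite clamp_ge0 clamp_le1.
have pst' : p_ (clamp s) <= p_ (clamp t) by rewrite !pq_clamp.
have s0 : 0 <= sigma%:R ^+ size (edges_above y) :> R by rewrite exprn_ge0.
have := pr_good_upper iidW hsigma uniqS closedS y (cl s) (cl t) pst'.
have := pr_good_lower iidW hsigma uniqS closedS y (cl s) (cl t) pst'.
rewrite !pq_clamp => lo hi; rewrite /Phi -mulrBr; apply/andP; split.
  apply: le_trans (ler_wpM2l s0 lo); rewrite !mulr_sumr big_seq [leRHS]big_seq.
  apply: ler_sum => e ey; rewrite le_eqVlt; apply/orP; left; apply/eqP.
  rewrite (size_edges_low uniqS ey) (size_edges_off uniqS closedS ey) /Phi.
  set m := size (edges_low y e); set n := size (edges_above _).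
  rewrite -addSn exprD exprM [in RHS]exprSr exprS !exprMn; ring.
apply: le_trans (ler_wpM2l s0 hi) _; rewrite !mulr_sumr big_seq [leRHS]big_seq.
apply: ler_sum => e ey; rewrite le_eqVlt; apply/orP; left; apply/eqP.
rewrite (size_edges_low uniqS ey) (size_edges_off uniqS closedS ey) /Phi.
set m := size (edges_low y e); set n := size (edges_above _).
rewrite -addSn exprD exprM [in LHS]exprSr [in LHS]exprS !exprMn; ring.
Qed.

(** Carathéodory's form of the differentiability of [Phi y] as a function of the
    level [p_ x]. *)
Lemma Phi_secant y x :
  (forall e, e \in edges_above y -> continuous (Phi (upper_end e))) ->
  exists theta : R -> R, [/\ forall z, Phi y z - Phi y x = theta z * (p_ z - p_ x),
    {for x, continuous theta} & theta x = secant y x x].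
Proof.
move=> cPhi; set s0 := secant y x x.
pose theta z := if p_ z == p_ x then s0 else (Phi y z - Phi y x) / (p_ z - p_ x).
have thx : theta x = s0 by rewrite /theta eqxx.
exists theta; split=> //.
  move=> z; rewrite /theta; case: eqVneq => [e|ne]; last first.
    by rewrite divfK// subr_eq0.
  have : p_ x <= p_ z by rewrite e.
  by move=> /(secantP y); rewrite e subrr !mul0r mulr0 => h; apply/eqP; rewrite eq_le andbC.
have cp : continuous p_ by exact: cont_pq.
have cc := @continuous_clamp R.
have c1 : (fun z => secant y x z) z @[z --> x] --> s0.
  have : continuous (fun z => secant y x z).
    by apply: cont_sum => e; cont.
  exact.
have c2 : (fun z => secant y z x) z @[z --> x] --> s0.
  have : continuous (fun z => secant y z x).
    have -> : (fun z => secant y z x) = fun z => \sum_(e <- edges_above y)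
      sigma%:R * clamp x ^+ sigma.-1 *
      (sigma%:R * p_ z * clamp x ^+ sigma.-1) ^+ size (edges_low y e) *
      (if e \in edges_above y then Phi (upper_end e) z else 0).
      by apply/funext => z; apply: eq_big_seq => e ey; rewrite ey.
    apply: cont_sum => e; case ey : (e \in edges_above y); last by cont.
    by have := cPhi e ey; move=> ?; cont.
  exact.
change (theta z @[z --> x] --> theta x); rewrite thx.
apply/cvgrPdist_le => eps e0.
have e2 : 0 < eps / 2 by lra.
move/cvgrPdist_le : c1 => /(_ _ e2) c1; move/cvgrPdist_le : c2 => /(_ _ e2) c2.
near=> z.
have h1 : `|s0 - secant y x z| <= eps / 2 by near: z.
have h2 : `|s0 - secant y z x| <= eps / 2 by near: z.
move: h1 h2; rewrite !ler_norml => /andP[h11 h12] /andP[h21 h22].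
rewrite /theta; case: eqVneq => [_|ne]; first by rewrite subrr; apply/andP; split; lra.
have [lt|lt] : p_ x < p_ z \/ p_ z < p_ x.
  by have [||e] := ltgtP (p_ x) (p_ z); [left|right|rewrite e eqxx in ne].
  have /andP[lo hi] := secantP y (ltW lt).
  have dpos : 0 < p_ z - p_ x by rewrite subr_gt0.
  rewrite mulrC -ler_pdivlMr// in lo; rewrite mulrC -ler_pdivrMr// in hi.
  by apply/andP; split; lra.
have /andP[lo hi] := secantP y (ltW lt).
have dpos : 0 < p_ x - p_ z by rewrite subr_gt0.
rewrite mulrC -ler_pdivlMr// in lo; rewrite mulrC -ler_pdivrMr// in hi.
have -> : (Phi y z - Phi y x) / (p_ z - p_ x) = (Phi y x - Phi y z) / (p_ x - p_ z).
  by rewrite -[Phi y z - _]opprB -[p_ z - _]opprB invrN mulrNN.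
by apply/andP; split; lra.
Unshelve. all: by end_near. Qed.

Lemma Phi1 y : Phi y 1 = 1.
Proof.
rewrite /Phi (pr_good_set1 iidW hsigma)// (@pq1 R sigma) -exprMn divff ?expr1n//.
by rewrite pnatr_eq0 -lt0n ltnW.
Qed.

(** Induction on the number of edges above [y]: continuity for the smaller trees makes [Phi y]
    differentiable in the level, by [Phi_secant], and the chain rule with the derivative [- rhoq] of
    the level gives the derivative in q. The value 1 at q = 1 fixes the constant. *)
Lemma Phi_integral y : continuous (Phi y) /\
  forall q : R, 0 <= q <= 1 -> Phi y q = 1 + wint_from (wq sigma) (rate y) q.
Proof.
have [n] := ubnP (size (edges_above y)); elim: n => // n IHn in y *.
rewrite ltnS => yn.
have cPhi e : e \in edges_above y -> continuous (Phi (upper_end e)).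
  move=> ey; have [] := IHn (upper_end e) _ => //.
  by apply: leq_trans yn; rewrite (size_edges_low uniqS ey) ltnS leq_addl.
have cp : continuous p_ by exact: cont_pq.
have cy : continuous (Phi y).
  move=> x; have [theta [thE thc thx]] := Phi_secant x cPhi.
  have -> : Phi y = fun z => Phi y x + theta z * (p_ z - p_ x).
    by apply/funext => z; rewrite -thE addrC subrK.
  apply: cvgD; first exact: cvg_cst.
  by apply: cvgM; [exact: thc|apply: cvgB; [exact: cp|exact: cvg_cst]].
split=> //.
have cr := @cont_rhoq R _ hsigma; have cb := @cont_bq R _ hsigma; have cw := @cont_wq R sigma.
have crate : continuous (rate y).
  have -> : rate y = fun q => \sum_(e <- edges_above y)
    rhoq sigma q * (bq sigma q ^+ size (edges_low y e) *
      (if e \in edges_above y then Phi (upper_end e) q else 0)).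
    by apply/funext => q; apply: eq_big_seq => e ey; rewrite ey.
  apply: cont_sum => e; case ey : (e \in edges_above y); last by cont.
  by have := cPhi e ey; move=> ?; cont.
have cE : continuous (fun q => 1 + wint_from (wq sigma) (rate y) q).
  by have := cont_wint_from cw crate; move=> ?; cont.
have dE (x : R) : 0 < x < 1 ->
    is_derive x 1 (fun q => 1 + wint_from (wq sigma) (rate y) q) (- (rate y x * wq sigma x)).
  move=> x01; rewrite -[- _]add0r; apply: is_deriveD.
  exact: is_derive_wint_from.
have dP (x : R) : 0 < x < 1 -> is_derive x 1 (Phi y) (- (rate y x * wq sigma x)).
  move=> x01; have [theta [thE thc thx]] := Phi_secant x cPhi.
  have /is_derive1_caratheodory[g [gE gc gx]] := is_derive_pq hsigma x01.
  apply/is_derive1_caratheodory; exists (fun z => theta z * g z); split.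
  - by move=> z; rewrite thE gE mulrA.
  - by apply: cvgM; [exact: thc|exact: gc].
  rewrite thx gx /rate /secant mulr_suml mulr_suml -sumrN; apply: eq_bigr => e _.
  rewrite /wq /bq clamp_id; last by case/andP: x01 => /ltW-> /ltW->.
  by rewrite !exprMn; ring.
move=> q q01; have := derive_eq01 cy cE dP dE q01.
have one : 0 <= (1 : R) <= 1 by rewrite ler01 lexx.
have := derive_eq01 cy cE dP dE one; rewrite Phi1 /wint_from subrr; lra.
Qed.

End GoodIntegral.

(** * Splitting a tree at a vertex *)

Section Children.
Context {sigma : nat}.
Variable S : seq (edge sigma).
Hypothesis uniqS : uniq S.
Hypothesis closedS : forall f g, g \in S -> prefix (upper_end f) (upper_end g) -> f \in S.
Local Notation edges_above := (edges_above S).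
Local Notation edges_low := (edges_low S).

Definition children (y : vertex sigma) := [seq c <- S | c.1 == y].

Lemma childP y c : c \in children y -> c \in edges_above y /\ c.1 = y.
Proof.
by rewrite mem_filter edges_aboveE => /andP[/eqP -> ->]; rewrite prefix_refl.
Qed.

Lemma perm_edges_above y : perm_eq (edges_above y)
  (flatten [seq c :: edges_above (upper_end c) | c <- children y]).
Proof.
apply: uniq_perm; first exact: filter_uniq.
  have : {subset children y <= children y} by [].
  have : uniq (children y) by exact: filter_uniq.
  elim: {-3}(children y) => //= c s IHs /andP[cs us] sub.
  have [cy c1] := childP (sub c (mem_head _ _)).
  have sub' : {subset s <= children y} by move=> e es; apply: sub; rewrite inE es orbT.
  change (uniq ((c :: edges_above (upper_end c)) ++
    flatten [seq c :: edges_above (upper_end c) | c <- s])).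
  rewrite cat_uniq IHs// andbT cons_uniq filter_uniq// andbT edges_aboveE.
  have /negbTE-> : ~~ prefix (upper_end c) c.1.
    by case: (c) => z i; rewrite /upper_end rcons_prefixF.
  apply/hasPn => f /flatten_mapP[e es fe]; have [ey e1] := childP (sub' e es).
  have ef : prefix (upper_end e) (upper_end f).
    move: fe; rewrite in_cons => /predU1P[->|]; first exact: prefix_refl.
    by rewrite edges_aboveE => /andP[h _]; apply: prefix_trans h (prefix_rcons _ _).
  apply/negP => fc; have cf : prefix (upper_end c) (upper_end f).
    move: fc; rewrite in_cons => /predU1P[->|]; first exact: prefix_refl.
    by rewrite edges_aboveE => /andP[h _]; apply: prefix_trans h (prefix_rcons _ _).
  have ce : c.2 = e.2.
    by move: cf ef; rewrite /upper_end c1 e1; exact: prefix_rcons_disj.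
  have cee : c = e by case: (c) (e) c1 e1 ce => ? ? [? ?] /= -> -> ->.
  by rewrite cee es in cs.
move=> f; apply/idP/flatten_mapP.
  rewrite edges_aboveE => /andP[yf fS].
  have yf' : prefix y (upper_end f) by apply: prefix_trans yf (prefix_rcons _ _).
  have yn : y != upper_end f.
    apply/eqP => yE; move: yf; rewrite yE; case: (f) => z i.
    by rewrite /upper_end rcons_prefixF.
  have [i yi] := prefix_next yf' yn.
  have cS : (y, i) \in S by apply: closedS fS _.
  exists (y, i); first by rewrite mem_filter eqxx.
  rewrite in_cons edges_aboveE fS andbT.
  move: yi; rewrite {1}[upper_end f]/upper_end prefix_rconsE => /orP[/eqP e|->].
    by rewrite [f]surjective_pairing; case/rcons_inj: e => -> ->; rewrite eqxx.
  by rewrite orbT.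
move=> [c /childP[cy c1]]; rewrite in_cons => /predU1P[->//|].
exact: edges_above_trans cy.
Qed.

Lemma big_edges_above {R : nmodType} (F : edge sigma -> R) y :
  \sum_(e <- edges_above y) F e =
  \sum_(c <- children y) (F c + \sum_(e <- edges_above (upper_end c)) F e).
Proof.
rewrite (perm_big _ (perm_edges_above y)) /= big_flatten big_map.
by apply: eq_bigr => c _; rewrite big_cons.
Qed.

Lemma edges_above_root : edges_above [::] = S.
Proof.
by rewrite /edges_above; apply/all_filterP/allP => e _; exact: prefix0s.
Qed.

Lemma size_edges_low_child y c f : c \in children y ->
  f \in edges_above (upper_end c) ->
  size (edges_low y f) = ((size (edges_low y c)).+1 + size (edges_low (upper_end c) f))%N.
Proof.
move=> /childP[cy c1] fc.
have fy := edges_above_trans cy fc.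
have := size_edges_low uniqS cy; have := size_edges_low uniqS fc.
by have := size_edges_low uniqS fy; lia.
Qed.

Lemma edges_low_child y c : c \in children y ->
  size (edges_low y c) = (size (edges_above y) - (size (edges_above (upper_end c))).+1)%N.
Proof.
by move=> /childP[cy c1]; have := size_edges_low uniqS cy; lia.
Qed.

(** The number of edges in the side branches left at depth [k] on the way to [z]. When [k] is at
    least the length of [z], both terms count the same edges and the truncated subtraction gives
    0. *)
Definition gap (z : vertex sigma) (k : nat) : nat :=
  (size (edges_above (take k z)) - (size (edges_above (take k.+1 z))).+1)%N.

Lemma gap_take z z' k n : take n z = take n z' -> (k < n)%N -> gap z k = gap z' k.
Proof.
move=> zz' kn; rewrite /gap.
by rewrite -(take_takel z kn) -(take_takel z (ltnW kn)) zz' !take_takel// ltnW.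
Qed.

End Children.

Lemma path_density_ext {R : realType} (rho bb ww : R -> R) g g' k :
  (forall j, (j <= k)%N -> g j = g' j) ->
  path_density rho bb ww g k = path_density rho bb ww g' k.
Proof.
elim: k => //= k IHk gg'; rewrite IHk; last by move=> j /leqW; exact: gg'.
by rewrite gg'.
Qed.

Lemma path_mass_ext g g' k :
  (forall j, (j <= k)%N -> g j = g' j) -> path_mass g k = path_mass g' k.
Proof.
elim: k => //= k IHk gg'; rewrite IHk; last by move=> j /leqW; exact: gg'.
by rewrite gg'.
Qed.

Lemma path_weight_ext {R : realType} g g' k :
  (forall j, (j <= k)%N -> g j = g' j) ->
  path_weight g k = path_weight g' k :> R.
Proof.
elim: k => //= k IHk gg'; rewrite IHk; last by move=> j /leqW; exact: gg'.
by rewrite (path_mass_ext (g' := g')) ?gg'// => j /leqW; exact: gg'.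
Qed.

(** * Expansion over the edges of the tree *)

Section ChainExpansion.
Context {R : realType} {sigma : nat} {d : measure_display} {T : measurableType d}.
Context {P : probability T R}.
Variable W : edge sigma -> {RV P >-> R}.
Hypothesis iidW : iid_uniform W.
Hypothesis hsigma : (2 <= sigma)%N.
Variable S : seq (edge sigma).
Hypothesis uniqS : uniq S.
Hypothesis closedS : forall f g, g \in S -> prefix (upper_end f) (upper_end g) -> f \in S.
Local Notation edges_above := (edges_above S).
Local Notation edges_low := (edges_low S).
Local Notation children := (children S).
Local Notation rho := (@rhoq R sigma).
Local Notation b := (@bq R sigma).
Local Notation ww := (@wq R sigma).
Local Notation I01 := (wint ww).
Local Notation Phi := (Phi W S).
Local Notation rate := (rate W S).
Local Notation step := (backbone_step rho b ww).

Let crho : continuous rho. Proof. exact: cont_rhoq. Qed.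
Let cb : continuous b. Proof. exact: cont_bq. Qed.
Let cww : continuous ww. Proof. exact: cont_wq. Qed.
Let ww_ge0 (q : R) : 0 <= q <= 1 -> 0 <= ww q. Proof. exact: wq_ge0. Qed.
Let cPhi y : continuous (Phi y).
Proof. by have [] := Phi_integral iidW hsigma uniqS closedS y. Qed.

Lemma cont_rate y : continuous (rate y).
Proof.
apply: cont_sum => e; have := @cPhi (upper_end e); move=> ?.
by have := crho; have := cb; move=> ? ?; cont.
Qed.

(** The density v_e for the edge e with upper end [z], whose index on its path is [(size z).-1]. *)
Definition edge_density (z : vertex sigma) : R -> R :=
  path_density rho b ww (gap S z) (size z).-1.

(** Integrated against the density of the edge below [y], this is the
    contribution of that edge and of all the edges above [y]. *)
Definition onward (y : vertex sigma) (q : R) : R := rho q * Phi y q + b q * rate y q.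

Lemma cont_onward y : continuous (onward y).
Proof.
have := crho; have := cb; have := @cPhi y; have := @cont_rate y.
by move=> ? ? ? ?; rewrite /onward; cont.
Qed.

Lemma cont_step (v : R -> R) : continuous v -> continuous (step v).
Proof.
move=> cv; have h1 := crho; have h2 := cb.
by apply: contD; [cont|apply: cont_wint_upto => //; cont].
Qed.

Lemma rate_children y q :
  rate y q = \sum_(c <- children y) b q ^+ size (edges_low y c) * onward (upper_end c) q.
Proof.
rewrite /rate (big_edges_above uniqS closedS); apply: eq_big_seq => c cc.
rewrite /onward mulrDr; congr (_ + _); first by ring.
rewrite /rate !mulr_sumr; apply: eq_big_seq => e ec.
by rewrite (size_edges_low_child uniqS cc ec) addSn exprS exprD; ring.
Qed.

(** The integral equation for [Phi y] is substituted: its constant 1 gives the term of the current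
    edge, and its integral is moved onto the density by [wint_upto_swap], which completes [b v] to a
    step. *)
Lemma wint_onward (v : R -> R) y : continuous v ->
  I01 (fun q => v q * onward y q) =
  I01 (fun q => rho q * v q) + I01 (fun q => step v q * rate y q).
Proof.
move=> cv; have h1 := crho; have h2 := cb; have h3 := @cPhi y; have h4 := @cont_rate y.
have crv : continuous (fun q => rho q * v q) by cont.
have cup := cont_wint_upto cww crv; have cdn := cont_wint_from cww h4.
have E : I01 (fun q => step v q * rate y q) =
    I01 (fun q => b q * v q * rate y q) + I01 (fun q => rho q * v q * wint_from ww (rate y) q).
  rewrite -wint_upto_swap// -wintD//; try by cont.
  by congr wint; apply/funext => q; rewrite /backbone_step mulrDl.
rewrite E -wintD//; try by cont.
rewrite -wintD//; try by cont.
apply: eq_wint => //; try by cont.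
  by have := @cont_onward y; move=> ?; cont.
move=> q q01; have [_ PhiE] := Phi_integral iidW hsigma uniqS closedS y.
by rewrite /onward PhiE//; ring.
Qed.

Lemma onward_children (v : R -> R) y : continuous v ->
  I01 (fun q => v q * rate y q) = \sum_(c <- children y)
    I01 (fun q => b q ^+ size (edges_low y c) * v q * onward (upper_end c) q).
Proof.
move=> cv; rewrite -wint_sum//; last first.
  by move=> c; have := @cont_onward (upper_end c); have := cb; move=> ? ?; cont.
congr wint; apply/funext => q; rewrite rate_children mulr_sumr.
by apply: eq_bigr => c _; ring.
Qed.

Lemma edge_density_child y c : c \in children y -> (0 < size y)%N ->
  edge_density (upper_end c) =
  fun q => b q ^+ size (edges_low y c) * step (edge_density y) q.
Proof.
move=> cc y0; have [_ c1] := childP cc.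
have ty : take (size y) (upper_end c) = y.
  by rewrite /upper_end c1 -cats1 take_size_cat.
rewrite /edge_density.
have -> : (size (upper_end c)).-1 = (size y).-1.+1.
  by rewrite /upper_end c1 size_rcons prednK.
apply/funext => q /=; congr (_ ^+ _ * _).
  rewrite prednK// /gap ty (edges_low_child uniqS cc).
  by rewrite -[in take _.+1 _]c1 -(size_rcons c.1 c.2) take_size.
congr (step _ q); apply: path_density_ext => j jy.
apply: (@gap_take _ _ _ _ _ (size y)); last by rewrite -(prednK y0) ltnS.
by rewrite ty take_size.
Qed.

Lemma cont_edge_density z : continuous (edge_density z).
Proof.
have h2 := cb; rewrite /edge_density; elim: (size z).-1 => [|k IHk]; first exact: cont_cst.
by have := cont_step IHk; move=> /= ?; cont.
Qed.

(** [wint_onward] splits off the term of one edge and [onward_children] distributes the rest over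
    the next edges, with the factor b^g for the branches not taken. *)
Lemma onward_expand y : (0 < size y)%N ->
  I01 (fun q => edge_density y q * onward y q) =
  I01 (fun q => rho q * edge_density y q) +
  \sum_(e <- edges_above y) I01 (fun q => rho q * edge_density (upper_end e) q).
Proof.
have [n] := ubnP (size (edges_above y)); elim: n => // n IHn in y *.
rewrite ltnS => yn y0; have cy := @cont_edge_density y.
rewrite wint_onward//; congr (_ + _).
rewrite onward_children; last exact: cont_step.
rewrite (big_edges_above uniqS closedS); apply: eq_big_seq => c cc.
have [cy' _] := childP cc.
rewrite -(IHn (upper_end c)).
- by congr wint; apply/funext => q; rewrite (edge_density_child cc).
- by apply: leq_trans yn; rewrite (size_edges_low uniqS cy') ltnS leq_addl.
- by rewrite /upper_end size_rcons.
Qed.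

(** At q = 0 the level is 1 and the integral runs over the whole interval. As nothing is left behind
    at the root, the edge there starts with the density 1. *)
Lemma Phi_expand :
  (forall c, c \in children [::] -> size (edges_low [::] c) = 0%N) ->
  Phi [::] 0 = 1 + \sum_(e <- S) I01 (fun q => rho q * edge_density (upper_end e) q).
Proof.
move=> root0; have [_ ->] := Phi_integral iidW hsigma uniqS closedS [::]; last first.
  by rewrite lexx ler01.
have cr := @cont_rate [::]; congr (_ + _).
rewrite /wint_from wint_upto0// subr0.
have -> : I01 (rate [::]) = I01 (fun q => 1 * rate [::] q).
  by congr wint; apply/funext => q; rewrite mul1r.
rewrite onward_children; last exact: cont_cst.
rewrite -[in RHS](edges_above_root S) (big_edges_above uniqS closedS).
apply: eq_big_seq => c cc; rewrite -onward_expand ?/upper_end ?size_rcons//.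
congr wint; apply/funext => q; rewrite root0// expr0 mul1r.
have [_ c1] := childP cc.
by rewrite /edge_density /upper_end c1.
Qed.

End ChainExpansion.

(** * The identity for masses and weights *)

Section TreeWeights.
Context {R : realType} {sigma : nat}.
Variable S : seq (edge sigma).
Hypothesis uniqS : uniq S.
Hypothesis closedS : forall f g, g \in S -> prefix (upper_end f) (upper_end g) -> f \in S.
Local Notation edges_above := (edges_above S).
Local Notation edges_low := (edges_low S).
Local Notation children := (children S).

Definition mass (z : vertex sigma) : nat := path_mass (gap S z) (size z).-1.
Definition weight (z : vertex sigma) : R := path_weight (gap S z) (size z).-1.

Lemma size_child y c : c \in children y -> (0 < size y)%N ->
  (size (upper_end c)).-1 = (size y).-1.+1.
Proof.
by move=> /childP[_ c1] y0; rewrite /upper_end c1 size_rcons prednK.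
Qed.

Lemma gap_child y c j : c \in children y -> (j < size y)%N ->
  gap S (upper_end c) j = gap S y j.
Proof.
move=> /childP[_ c1] jy; apply: (@gap_take _ _ _ _ _ (size y)) => //.
by rewrite /upper_end c1 -cats1 take_size_cat// take_size.
Qed.

Lemma gap_child_last y c : c \in children y ->
  gap S (upper_end c) (size y) = size (edges_low y c).
Proof.
move=> cc; have [_ c1] := childP cc; rewrite (edges_low_child uniqS cc) /gap.
rewrite {1}/upper_end c1 -cats1 take_size_cat//.
by rewrite -[in take _.+1 _]c1 -(size_rcons c.1 c.2) take_size.
Qed.

Lemma mass_child y c : c \in children y -> (0 < size y)%N ->
  mass (upper_end c) = ((mass y).+1 + size (edges_low y c))%N.
Proof.
move=> cc y0; rewrite /mass (size_child cc y0) /= prednK// gap_child_last//.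
congr (_.+1 + _)%N; apply: path_mass_ext => j jy.
by apply: gap_child => //; rewrite -(prednK y0) ltnS.
Qed.

Lemma weight_child y c : c \in children y -> (0 < size y)%N ->
  weight (upper_end c) * (mass (upper_end c))%:R = weight y * (mass y).+1%:R.
Proof.
move=> cc y0.
have m0 : (mass (upper_end c))%:R != 0 :> R.
  by rewrite (mass_child cc y0) pnatr_eq0.
have -> : weight (upper_end c) = weight y * (mass y).+1%:R / (mass (upper_end c))%:R.
  rewrite {1}/weight /mass (size_child cc y0) /=.
  have E j : (j <= (size y).-1)%N -> gap S (upper_end c) j = gap S y j.
    by move=> jy; apply: gap_child => //; rewrite -(prednK y0) ltnS.
  by rewrite (path_weight_ext E) (path_mass_ext E).
by rewrite divfK.
Qed.

Lemma children_parent e : e \in S -> e \in children e.1.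
Proof. by move=> eS; rewrite mem_filter eqxx. Qed.

Lemma parent_edge e : e \in S -> (0 < size e.1)%N ->
  exists2 f, f \in S & e.1 = upper_end f.
Proof.
case: e => z i eS /=; case/lastP: z eS => // z j eS _.
exists (z, j) => //; apply: closedS eS _.
by rewrite /upper_end /= prefix_rcons.
Qed.

Variable l : nat.
Hypothesis l_gt0 : (0 < l)%N.
Hypothesis stem : forall c, c \in S -> (size c.1 < l)%N ->
  size (edges_low c.1 c) = 0%N.

Lemma mass_size e : e \in S ->
  (mass (upper_end e) + (size (edges_above (upper_end e))).+1)%N = size S.
Proof.
have [n] := ubnP (size e.1); elim: n => // n IHn in e *; rewrite ltnS => en eS.
have ec := children_parent eS; have [ea _] := childP ec.
have := size_edges_low uniqS ea.
have [e0|] := posnP (size e.1).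
  have e1 : e.1 = [::] by apply: size0nil.
  rewrite stem ?e0// add0n e1 edges_above_root => ->.
  by rewrite /mass /upper_end size_rcons e0.
move=> e0 h; have [f fS ef] := parent_edge eS e0.
have := IHn f; rewrite fS -ef => /(_ _ isT) <-.
  rewrite (mass_child ec e0) h; lia.
by move: en; rewrite ef /upper_end size_rcons.
Qed.

(** Induction from the leaves down, with mass M and weight A. For a child c, [weight_child] gives
    A_c M_c = A (M + 1), and N - M_c is one plus the number of edges above c, so the children
    contribute A (M + 1)(N - 1 - M). Adding A (2M + 1 - N) gives A M (N - M), which vanishes for the
    edge at the root, where M = 0. *)
Lemma sum_weight_above e : e \in S ->
  weight (upper_end e) * (2 * (mass (upper_end e))%:R + 1 - (size S)%:R) +
  \sum_(f <- edges_above (upper_end e))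
     weight (upper_end f) * (2 * (mass (upper_end f))%:R + 1 - (size S)%:R) =
  weight (upper_end e) * (mass (upper_end e))%:R *
     ((size S)%:R - (mass (upper_end e))%:R).
Proof.
have [n] := ubnP (size (edges_above (upper_end e))).
elim: n => // n IHn in e *; rewrite ltnS => en eS.
set y := upper_end e in en *; have y0 : (0 < size y)%N by rewrite size_rcons.
have yS := mass_size eS; rewrite -/y in yS.
rewrite (big_edges_above uniqS closedS).
under eq_big_seq => c cc.
  have [cy c1] := childP cc.
  have cS : c \in S by move: cy; rewrite edges_aboveE => /andP[].
  rewrite IHn//; last first.
    by apply: leq_trans en; rewrite (size_edges_low uniqS cy) ltnS leq_addl.
  rewrite (weight_child cc y0).
  have -> : (size S)%:R - (mass (upper_end c))%:R =
      (size (edges_above (upper_end c))).+1%:R :> R.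
    by rewrite -(mass_size cS) natrD addrC addKr.
  over.
rewrite /= -mulr_sumr.
have -> : \sum_(c <- children y) (size (edges_above (upper_end c))).+1%:R =
    (size (edges_above y))%:R :> R.
  rewrite -sum1_size natr_sum (big_edges_above uniqS closedS).
  by apply: eq_bigr => c _; rewrite -natr_sum sum1_size -nat1r.
have -> : (size (edges_above y))%:R = (size S)%:R - 1 - (mass y)%:R :> R.
  by rewrite -yS natrD -[_.+1%:R]nat1r; ring.
by rewrite -[(mass y).+1%:R]nat1r; ring.
Qed.

Lemma sum_weight : (0 < size S)%N ->
  \sum_(f <- S) weight (upper_end f) * (2 * (mass (upper_end f))%:R + 1) =
  (size S)%:R * \sum_(f <- S) weight (upper_end f).
Proof.
move=> S0; apply/eqP; rewrite mulr_sumr -subr_eq0 -sumrB; apply/eqP.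
rewrite -[in LHS](edges_above_root S) (big_edges_above uniqS closedS) big_seq big1// => c cc.
have [cy c1] := childP cc.
have cS : c \in S by move: cy; rewrite edges_aboveE => /andP[].
have m0 : mass (upper_end c) = 0%N by rewrite /mass /upper_end c1.
have h := sum_weight_above cS; rewrite [in RHS]m0 mulr0n mulr0 mul0r in h.
rewrite -[RHS]h edges_above_root; congr (_ + _); first by ring.
by apply: eq_bigr => f _; ring.
Qed.

Lemma gap_stem e k : e \in S -> (k < l)%N -> gap S (upper_end e) k = 0%N.
Proof.
move=> eS kl; have [ek|ke] := leqP (size (upper_end e)) k.
  by rewrite /gap !take_oversize// ?(leq_trans ek)// subnS subnn.
have [i ki] : exists i, prefix (rcons (take k (upper_end e)) i) (upper_end e).
  apply: prefix_next; first exact: prefix_take.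
  by apply: contraTneq ke => <-; rewrite -leqNgt size_take_min geq_minl.
set c := (take k (upper_end e), i).
have cS : c \in S by apply: closedS eS _.
have sk : size c.1 = k by rewrite /c /= size_takel// ltnW.
have ec : upper_end c = take k.+1 (upper_end e).
  move: ki; rewrite prefixE size_rcons size_takel 1?ltnW// => /eqP h.
  by rewrite h.
rewrite /gap -ec -[take k _]/c.1 -(edges_low_child uniqS (children_parent cS)).
by rewrite stem// sk.
Qed.

Lemma edge_unique_stem e f : e \in S -> f \in S ->
  size (upper_end e) = size (upper_end f) -> (size (upper_end e) <= l)%N -> e = f.
Proof.
move=> eS fS ef el; apply: upper_end_inj; apply/eqP; apply: contraPT el => ne.
have [u [ue uf um]] := prefix_meet (upper_end e) (upper_end f).
have une : u != upper_end e.
  apply: contra ne => /eqP uE; rewrite uE in uf.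
  by apply/eqP/prefix_eq => //; rewrite ef.
have unf : u != upper_end f.
  apply: contra ne => /eqP uE; rewrite uE in ue.
  by apply/eqP/esym/prefix_eq => //; rewrite ef.
have [i ui] := prefix_next ue une; have [j uj] := prefix_next uf unf.
have cS : (u, i) \in S by exact: (@closedS (u, i) e eS ui).
have dS : (u, j) \in S by exact: (@closedS (u, j) f fS uj).
have ij : i != j.
  apply: contraT; rewrite negbK => /eqP ij; rewrite -ij in uj.
  by have := um _ ui uj; rewrite rcons_prefixF.
apply/negP; rewrite -ltnNge; apply: (@leq_ltn_trans (size u)); last first.
  by have := size_prefix ui; rewrite size_rcons.
rewrite leqNgt; apply/negP => ul.
have := stem cS ul; apply/eqP; rewrite -lt0n.
rewrite size_filter -has_count; apply/hasP; exists (u, j).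
  by rewrite edges_aboveE prefix_refl.
rewrite /upper_end /= prefix_rconsE rcons_prefixF orbF eqseq_rcons eqxx/=.
exact: ij.
Qed.

(** Up to depth l the tree is a single path. This bounds the number of edges too close to the root
    for the asymptotic estimate. *)
Lemma count_stem n : (n <= l)%N ->
  (count (fun e => size (upper_end e) <= n)%N S <= n)%N.
Proof.
move=> nl; rewrite -size_filter -(size_map (fun e => size (upper_end e))).
rewrite -[leqRHS](size_iota 1); apply: uniq_leq_size.
  rewrite map_inj_in_uniq ?filter_uniq// => e f.
  rewrite !mem_filter => /andP[en eS] /andP[fn fS] ef.
  by apply: edge_unique_stem => //; exact: leq_trans nl.
move=> k /mapP[e]; rewrite mem_filter => /andP[en _] ->.
by rewrite mem_iota add1n ltnS en andbT /upper_end size_rcons.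
Qed.

End TreeWeights.

(** * Asymptotics uniform in the tree *)

Section Asymptotics.
Context {R : realType} {sigma : nat} {d : measure_display} {T : measurableType d}.
Context {P : probability T R}.
Variable W : edge sigma -> {RV P >-> R}.
Hypothesis iidW : iid_uniform W.
Hypothesis hsigma : (2 <= sigma)%N.

Let k0_gt0 : 0 < (sigma%:R ^+ 2)^-1 :> R.
Proof. by rewrite invr_gt0 exprn_gt0// ltr0n ltnW. Qed.

Let C_ge0 : 0 <= 3 * sigma%:R ^+ 5 :> R.
Proof. by rewrite mulr_ge0// exprn_ge0. Qed.

Let rhoB (q : R) : 0 <= q <= 1 -> (sigma%:R ^+ 2)^-1 <= rhoq sigma q <= sigma%:R ^+ 2.
Proof. by move=> _; exact: rhoq_bound. Qed.

Let b_ge0 (q : R) : 0 <= q <= 1 -> 0 <= bq sigma q.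
Proof. by move=> _; exact: bq_ge0. Qed.

Let du (q : R) : 0 < q < 1 -> is_derive q 1 (uq sigma) (- wq sigma q).
Proof. by move=> _; exact: is_derive_uq. Qed.

Definition path_rhoq_cvg := path_rho_cvg (cont_rhoq hsigma) (cont_bq hsigma)
  (@cont_uq R sigma) (@cont_wq R sigma) k0_gt0 (kappaq_gt0 hsigma) (kappaq_le1 hsigma)
  C_ge0 rhoB (bqE hsigma) b_ge0 (@uq01 R sigma) (@wq_ge0 R sigma) (rhoq_kappaq hsigma)
  (@uq0 R sigma hsigma) (@uq1 R sigma) du.

Lemma rhoq_density_bound g k :
  0 <= wint (wq sigma) (fun q : R => rhoq sigma q *
        path_density (rhoq sigma) (bq sigma) (wq sigma) g k q) <= sigma%:R ^+ 2.
Proof.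
apply/andP; split.
  exact: (path_rho_ge0 (cont_rhoq hsigma) (cont_bq hsigma) (@cont_wq R sigma) k0_gt0 rhoB
    b_ge0 (@wq_ge0 R sigma)).
exact: (path_rho_le (cont_rhoq hsigma) (cont_bq hsigma) (@cont_uq R sigma) (@cont_wq R sigma)
  k0_gt0 rhoB (bqE hsigma) b_ge0 (@uq01 R sigma) (@wq_ge0 R sigma)
  (@uq0 R sigma hsigma) (@uq1 R sigma) du).
Qed.

(** Edges beyond depth [n1] contribute at most [eps / 2] each; the others are at most [n1] in number
    with bounded contributions, negligible against the size of [S]. *)
Lemma Phi_asymptotics (eps delta : R) : 0 < eps -> 0 < delta ->
  exists N0 : nat, forall (S : seq (edge sigma)) (l : nat), uniq S ->
    (forall f g, g \in S -> prefix (upper_end f) (upper_end g) -> f \in S) ->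
    (forall c, c \in S -> (size c.1 < l)%N -> size (edges_low S c.1 c) = 0%N) ->
    (0 < l)%N -> (N0 <= size S)%N -> delta * (size S)%:R <= l%:R ->
    `|Phi W S [::] 0 - kappaq sigma * \sum_(e <- S) weight S (upper_end e)|
      <= eps * (size S)%:R.
Proof.
move=> e0 d0; have e2 : 0 < eps / 2 by lra.
have [n1 [N0 H]] := path_rhoq_cvg e2 d0.
have s2 : 0 <= sigma%:R ^+ 2 :> R by rewrite exprn_ge0.
(* The 1 is the constant term of [Phi_expand]; an edge near the root contributes at most [sigma^2]
   from the integral and 1 from [kappaq] times its weight. *)
pose B : R := 1 + n1%:R * (sigma%:R ^+ 2 + 1).
have B0 : 0 <= B by rewrite addr_ge0// mulr_ge0// addr_ge0.
pose N1 := maxn N0 (maxn (Num.bound (B / (eps / 2))) (Num.bound (n1%:R / delta))).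
exists N1 => S l uS cS stem l0 NS dl.
have N0S : (N0 <= size S)%N by apply: leq_trans NS; rewrite leq_maxl.
have BS : B <= eps / 2 * (size S)%:R.
  rewrite mulrC -ler_pdivrMr//; apply: le_trans (ltW (archi_boundP _)) _.
    by rewrite divr_ge0// ltW.
  by rewrite ler_nat; apply: leq_trans NS; rewrite /N1 leq_max leq_max leqnn !orbT.
have n1l : (n1 <= l)%N.
  rewrite -(ler_nat R); apply: le_trans dl; rewrite mulrC -ler_pdivrMr//.
  apply: le_trans (ltW (archi_boundP _)) _; first by rewrite divr_ge0// ltW.
  by rewrite ler_nat; apply: leq_trans NS; rewrite /N1 leq_max leq_max leqnn !orbT.
rewrite (Phi_expand iidW hsigma uS cS); last first.
  move=> c cc; have [cy c1] := childP cc; rewrite -[in LHS]c1 stem ?c1//.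
  by move: cy; rewrite edges_aboveE => /andP[].
rewrite mulr_sumr -addrA -sumrB.
apply: le_trans (ler_normD _ _) _; rewrite normr1.
pose J (e : edge sigma) : R := wint (wq sigma) 
    (fun q => rhoq sigma q * edge_density S (upper_end e) q)
   - kappaq sigma * weight S (upper_end e).
have JB e : e \in S -> `|J e| <= eps / 2 +
    (size (upper_end e) <= n1)%N%:R * (sigma%:R ^+ 2 + 1).
  move=> eS; have [small|big] := leqP (size (upper_end e)) n1.
    rewrite mul1r; apply: le_trans (ler_normB _ _) _.
    have /andP[i0 i1] := rhoq_density_bound (gap S (upper_end e)) (size (upper_end e)).-1.
    rewrite (ger0_norm i0).
    have /andP[w0 w1] := @path_weight01 R (gap S (upper_end e)) (size (upper_end e)).-1.
    have k0 := @kappaq_gt0 R _ hsigma; have k1 := @kappaq_le1 R _ hsigma.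
    rewrite ger0_norm; last by rewrite mulr_ge0// ltW.
    have : kappaq sigma * weight S (upper_end e) <= 1 * 1 :> R by rewrite ler_pM// ltW.
    by move: i1; rewrite /edge_density; lra.
  rewrite mul0r addr0; apply: (H (size S) l) => //.
  - by move=> k kl; apply: (gap_stem uS cS stem eS kl).
  - by move: big; rewrite /upper_end size_rcons ltnS.
  - by have <- := mass_size uS cS l0 stem eS; rewrite leq_addr.
apply: le_trans (_ : 1 + \sum_(e <- S) (eps / 2 +
    (size (upper_end e) <= n1)%N%:R * (sigma%:R ^+ 2 + 1)) <= _).
  rewrite lerD2l; apply: le_trans (ler_norm_sum _ _ _) _.
  by rewrite big_seq [leRHS]big_seq; apply: ler_sum => e /JB.
rewrite big_split/= big_const_seq count_predT iter_addr_0 -mulr_suml.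
have -> : \sum_(e <- S) (size (upper_end e) <= n1)%N%:R =
   (count (fun e => size (upper_end e) <= n1)%N S)%:R :> R.
  by elim: (S) => [|e s IHs]; rewrite ?big_nil ?big_cons//= IHs natrD.
have : (count (fun e => size (upper_end e) <= n1)%N S)%:R * (sigma%:R ^+ 2 + 1)
     <= n1%:R * (sigma%:R ^+ 2 + 1) :> R.
  by rewrite ler_wpM2r ?addr_ge0// ler_nat; exact: (count_stem uS cS stem n1l).
by move: BS; rewrite /B -mulr_natr; lra.
Qed.

End Asymptotics.

(** * Invasion percolation and blocked edges *)

Section SpanEdges.
Context {sigma : nat}.
Implicit Types (x : seq (vertex sigma)) (e f : edge sigma).

Lemma path_edgesP (v s : vertex sigma) e :
  (e \in path_edges v s) = prefix v e.1 && prefix (upper_end e) (v ++ s).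
Proof.
elim: s v => [|i s IHs] v.
  rewrite cats0 in_nil; apply/esym/negbTE; rewrite negb_and -implybE.
  apply/implyP => ve; apply/negP => /size_prefix.
  by rewrite size_rcons; have := size_prefix ve; lia.
rewrite in_cons IHs cat_rcons; apply/idP/idP.
  move=> /predU1P[->|/andP[/prefix_rconsW -> ->//]].
  by rewrite prefix_refl /upper_end /= -cat_rcons prefix_prefix.
move=> /andP[ve es]; case: (eqVneq v e.1) => [ve1|ne].
  have := es; rewrite /upper_end -ve1 -cat_rcons.
  move=> /prefix_rcons_disj /(_ (prefix_prefix _ _)) e2.
  by rewrite [e]surjective_pairing -ve1 e2 eqxx.
have [j vj] := prefix_next ve ne.
have vje : prefix (rcons v j) (upper_end e) by apply: prefix_trans vj (prefix_rcons _ _).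
have := prefix_trans vje es; rewrite -cat_rcons.
move=> /prefix_rcons_disj /(_ (prefix_prefix _ _)) ji.
by rewrite ji in vj; rewrite vj cat_rcons es orbT.
Qed.

Lemma span_edgesP x e : (e \in span_edges x) = in_span x (upper_end e).
Proof.
rewrite /span_edges mem_undup; apply/flatten_mapP/hasP => -[y yx].
  by rewrite path_edgesP => /andP[_ ey]; exists y.
by move=> ey; exists y; rewrite // path_edgesP prefix0s.
Qed.

Lemma uniq_span_edges x : uniq (span_edges x).
Proof. exact: undup_uniq. Qed.

Lemma closed_span_edges x f e : e \in span_edges x ->
  prefix (upper_end f) (upper_end e) -> f \in span_edges x.
Proof.
rewrite !span_edgesP => /hasP[y yx ey] fe; apply/hasP; exists y => //.
exact: prefix_trans ey.
Qed.

End SpanEdges.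

Section Invasion.
Context {R : realType} {sigma : nat}.
Hypothesis sigma_gt0 : (0 < sigma)%N.
Variable w : edge sigma -> R.
Hypothesis injw : injective w.
Implicit Types (e f : edge sigma) (u y z : vertex sigma) (I : seq (vertex sigma)).

Lemma boundaryP I e : (e \in boundary I) = (e.1 \in I) && (upper_end e \notin I).
Proof.
rewrite mem_filter andbC; congr (_ && _); case: e => v i.
apply/allpairsP/idP => [[[v' i'] /= [vI _ [-> _]]]//|vI].
by exists (v, i); split; rewrite //= mem_enum.
Qed.

Lemma boundary_neq0 I z : z \in I -> exists e, e \in boundary I.
Proof.
move=> zI; pose i0 := Ordinal sigma_gt0.
have [y yI ymax] := seq_argmax (fun z => (size z)%:R : R) zI.
exists (y, i0); rewrite boundaryP yI /=; apply/negP => /ymax.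
by rewrite /upper_end size_rcons ler_nat ltnn.
Qed.

Lemma invadeP I z : z \in I -> exists2 e, e \in boundary I &
  (forall f, f \in boundary I -> w e <= w f) /\ invade w I = upper_end e :: I.
Proof.
move=> /boundary_neq0[e0 e0I].
have [e eI emin] := seq_argmax (fun e => - w e) e0I.
rewrite /invade; case E : (seq.filter _ _) => [|f s].
  have : e \in [seq e <- boundary I | all (fun f => w e <= w f) (boundary I)].
    rewrite mem_filter eI andbT; apply/allP => f fI.
    by rewrite -lerN2 emin.
  by rewrite E.
have : f \in [seq e <- boundary I | all (fun f => w e <= w f) (boundary I)].
  by rewrite E mem_head.
by rewrite mem_filter => /andP[/allP fmin fI]; exists f.
Qed.

Lemma root_invaded N : [::] \in invaded w N.
Proof.
elim: N => [|N IHN]; first by rewrite /invaded /= mem_head.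
have [e _ [_ E]] := invadeP IHN.
by rewrite /invaded iterS -/(invaded w N) E in_cons IHN orbT.
Qed.

Lemma invadedS N : exists2 e, e \in boundary (invaded w N) &
  (forall f, f \in boundary (invaded w N) -> w e <= w f) /\
  invaded w N.+1 = upper_end e :: invaded w N.
Proof. exact: invadeP (root_invaded N). Qed.

Lemma invaded_prefix N u z : z \in invaded w N -> prefix u z -> u \in invaded w N.
Proof.
elim: N u z => [|N IHN] u z.
  by rewrite /invaded /= inE => /eqP->; rewrite prefixs0 => /eqP->; rewrite inE.
have [e eI [_ ->]] := invadedS N; move: eI; rewrite boundaryP => /andP[eI _].
rewrite !in_cons => /predU1P[->|zI] uz; last by rewrite (IHN u z)// orbT.
move: uz; rewrite /upper_end prefix_rconsE => /orP[->//|ue].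
by rewrite (IHN _ _ eI ue) orbT.
Qed.

Lemma uniq_invaded N : uniq (invaded w N) /\ size (invaded w N) = N.+1.
Proof.
elim: N => [//|N [uN sN]]; have [e eI [_ ->]] := invadedS N.
by move: eI; rewrite boundaryP => /andP[_ eI]; rewrite /= eI uN sN.
Qed.

(** A finite cluster is left by every infinite path that starts in it, so at each stage an edge of
    weight at most p is available. *)
Lemma ray_boundary I u i p : u \in I -> ray w p (u, i) ->
  exists2 f, f \in boundary I & w f <= p /\ prefix (rcons u i) (upper_end f).
Proof.
have [k kP] : exists k, forall z, z \in I -> (size z <= size u + k)%N.
  exists (\max_(z <- I) size z) => z zI.
  by apply: leq_trans (leq_addl _ _); apply: leq_bigmax_seq.
elim: k u i kP => [|k IHk] u i kP uI rui.
  exists (u, i); last by split; [case: rui|exact: prefix_refl].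
  rewrite boundaryP uI; apply/negP => /kP.
  by rewrite /upper_end size_rcons addn0 ltnn.
have [uiI|uiI] := boolP (rcons u i \in I); last first.
  exists (u, i); first by rewrite boundaryP uI.
  by split; [case: rui|exact: prefix_refl].
case: rui => _ /ray_continue[j rj].
have [|//||f fI [wf uf]] := IHk (rcons u i) j.
- by move=> z /kP; rewrite size_rcons addSnnS.
- by [].
by exists f => //; split=> //; exact: prefix_rconsW uf.
Qed.

(** When [e] is invaded it is the lightest boundary edge, whereas the path leaving at [u] offers
    another boundary edge at most as heavy; distinct weights make this impossible. *)
Lemma ray_blocks e u i N : prefix u e.1 -> ~~ prefix (rcons u i) (upper_end e) ->
  ray w (w e) (u, i) -> upper_end e \notin invaded w N.
Proof.
move=> ue nui rui; elim: N => [|N IHN].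
  by rewrite /invaded /= inE -size_eq0 size_rcons.
have [f fI [fmin ->]] := invadedS N; rewrite in_cons negb_or IHN andbT.
apply/negP => /eqP/upper_end_inj ef; rewrite -ef in fI fmin.
have uI : u \in invaded w N.
  by move: fI; rewrite boundaryP => /andP[eI _]; exact: invaded_prefix eI ue.
have [g gI [wg ug]] := ray_boundary uI rui.
have : w e = w g by apply/eqP; rewrite eq_le fmin.
by move/injw => eg; rewrite eg ug in nui.
Qed.

Lemma path_boundary I u y : prefix u y -> u \in I -> y \notin I ->
  exists2 f, f \in boundary I & prefix u f.1 /\ prefix (upper_end f) y.
Proof.
case/prefixP => s ->; elim: s u => [|i s IHs] u; first by rewrite cats0 => ->.
rewrite -cat_rcons => uI yI; have [uiI|uiI] := boolP (rcons u i \in I).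
  have [f fI [uf fy]] := IHs _ uiI yI; exists f => //; split=> //.
  exact: prefix_rconsW uf.
exists (u, i); first by rewrite boundaryP uI.
by split; [exact: prefix_refl|exact: prefix_prefix].
Qed.

(** There are finitely many vertices of depth less than n, and each stage of the invasion adds a new
    vertex. *)
Lemma invaded_deep n : exists N, exists2 z, z \in invaded w N & (n <= size z)%N.
Proof.
pose L := flatten [seq [seq (tval t : vertex sigma) | t <- enum {: k.-tuple 'I_sigma}]
                  | k <- iota 0 n].
exists (size L); apply: contrapT => nex.
have [uI sI] := uniq_invaded (size L).
suff : (size (invaded w (size L)) <= size L)%N by rewrite sI ltnn.
apply: uniq_leq_size => // z zI.
have zn : (size z < n)%N.
  by rewrite ltnNge; apply/negP => nz; apply: nex; exists z.
apply/flatten_mapP; exists (size z); first by rewrite mem_iota.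
by apply/mapP; exists (in_tuple z); rewrite ?mem_enum.
Qed.

Lemma surv_along p v z : prefix v z ->
  (forall f, prefix v f.1 -> prefix (upper_end f) z -> w f <= p) ->
  surv w p (size z - size v) v.
Proof.
case/prefixP => s ->; rewrite size_cat addKn.
elim: s v => [//|i s IHs] v H /=; apply/existsP; exists i.
rewrite H ?prefix_refl//=; last by rewrite /upper_end -cat_rcons prefix_prefix.
apply: IHs => f vf fz; apply: H; first exact: prefix_rconsW vf.
by rewrite -cat_rcons.
Qed.

(** Some edge of the path from [u] to [y] is always available, so that no edge
    above [u] heavier than all of these is ever invaded. *)
Lemma invaded_weight_le N y u p f : (forall n, y \notin invaded w n) ->
  prefix u y ->
  (forall g, prefix u g.1 -> prefix (upper_end g) y -> w g <= p) ->
  upper_end f \in invaded w N -> prefix u f.1 -> w f <= p.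
Proof.
move=> yn uy gp; elim: N => [|N IHN].
  by rewrite /invaded /= inE -size_eq0 size_rcons.
have [e eI [emin ->]] := invadedS N; rewrite in_cons.
move=> /predU1P[/upper_end_inj-> ue|/IHN//].
have uI : u \in invaded w N.
  by move: eI; rewrite boundaryP => /andP[e1I _]; exact: invaded_prefix e1I ue.
have [g gI [ug gy]] := path_boundary uy uI (yn N).
exact: le_trans (emin g gI) (gp g ug gy).
Qed.

(** Pigeonhole: the invaded vertices are arbitrarily deep, so infinitely many
    of them leave the path to [y] by the same edge. *)
Lemma not_invaded_ray y : (forall n, y \notin invaded w n) ->
  exists e u i, [/\ prefix (upper_end e) y, prefix u e.1,
    ~~ prefix (rcons u i) (upper_end e) & ray w (w e) (u, i)].
Proof.
move=> yn.
have /choice[g gP] : forall k : 'I_(size y), exists e : edge sigma,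
    [/\ prefix (take k y) e.1, prefix (upper_end e) y &
        forall f, prefix (take k y) f.1 -> prefix (upper_end f) y -> w f <= w e].
  move=> k; have [i ki] : exists i, prefix (rcons (take k y) i) y.
    apply: prefix_next; first exact: prefix_take.
    by apply/eqP => /(congr1 size); rewrite size_takel 1?ltnW// => kE;
      have := ltn_ord k; rewrite kE ltnn.
  have c_in : (take k y, i) \in [seq f <- path_edges [::] y | prefix (take k y) f.1].
    by rewrite mem_filter prefix_refl path_edgesP prefix0s.
  have [e] := seq_argmax w c_in.
  rewrite mem_filter path_edgesP prefix0s /= => /andP[ke ey] emax.
  exists e; split=> // f kf fy; apply: emax.
  by rewrite mem_filter kf path_edgesP prefix0s.
(* The branch leaving the path to [y] at depth [k] through its edge [i] lasts n more levels with
   weights at most that of [g k]. A pair for which this holds for all n gives the required infinite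
   path. *)
pose ok (k : 'I_(size y)) i n := [/\ ~~ prefix (rcons (take k y) i) y, w (take k y, i) <= w (g k) &
  surv w (w (g k)) n (rcons (take k y) i)].
suff [k [i ki]] : exists (k : 'I_(size y)) i, forall n, ok k i n.
  have [ke ey _] := gP k; exists (g k), (take k y), i; split=> //.
    have [nki _ _] := ki 0%N; apply: contra nki => h; exact: prefix_trans h ey.
  by split=> [|n]; [have [] := ki 0%N|have [] := ki n].
apply: contrapT => nex.
have nn (x : 'I_(size y) * 'I_sigma) : exists n, ~ ok x.1 x.2 n.
  apply: contrapT => h; apply: nex; exists x.1, x.2 => n.
  by apply: contrapT => h'; apply: h; exists n.
have /choice[m mP] := nn.
(* By depth [M] each of the finitely many branches has failed; the branch of an invaded vertex that
   is deep enough contradicts this. *)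
pose M := \max_x m x.
have [N [z zI zM]] := invaded_deep (M + size y).+1.
have [u [uz uy um]] := prefix_meet z y.
have uneqz : u != z.
  by apply: contraTneq zM => <-; rewrite -leqNgt (leq_trans (size_prefix uy))// leq_addl.
have uneqy : u != y.
  apply: contra (yn N) => /eqP uE; apply: invaded_prefix zI _; by rewrite -uE.
have su : (size u < size y)%N.
  rewrite ltn_neqAle size_prefix// andbT; apply: contra uneqy => /eqP su.
  by apply/eqP; apply: prefix_eq => //; rewrite su.
have tu : take (size u) y = u by apply/eqP; move: uy; rewrite prefixE.
have [i ui] := prefix_next uz uneqz.
pose k := Ordinal su; apply: (mP (k, i)) => /=.
have [_ _ gmax] := gP k.
have wle f : prefix u f.1 -> prefix (upper_end f) z -> w f <= w (g k).
  move=> uf fz; apply: (invaded_weight_le (N := N) yn uy _ _ uf).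
    by move=> h uh hy; apply: gmax => //; rewrite /= tu.
  exact: invaded_prefix zI fz.
split; rewrite /= ?tu.
- by apply/negP => /(um _ ui); rewrite rcons_prefixF.
- by apply: wle => //; exact: prefix_refl.
- apply: surv_leq (surv_along ui _); last first.
    by move=> f uf; apply: wle; exact: prefix_rconsW uf.
  rewrite size_rcons; apply: (@leq_trans M); first exact: (leq_bigmax (k, i)).
  apply: (@leq_trans ((M + size y).+1 - (size u).+1)); last by rewrite leq_sub2r.
  by rewrite subSS -addnBA ?leq_addr// ltnW.
Qed.

Lemma invasion_cluster_good (x : seq (vertex sigma)) :
  (forall y, y \in x -> invasion_cluster w y) <-> good (span_edges x) w [::].
Proof.
split=> [xC e|gx y yx].
  rewrite edges_aboveE prefix0s span_edgesP => /hasP[y yx ey] u _ ue i nui rui.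
  have [N _ /= yN] := xC y yx.
  by have := ray_blocks N ue nui rui; rewrite (invaded_prefix yN ey).
apply: contrapT => ny.
have yn n : y \notin invaded w n by apply/negP => yI; apply: ny; exists n.
have [e [u [i [ey ue nui rui]]]] := not_invaded_ray yn.
apply: (gx e _ u _ ue i nui rui); last exact: prefix0s.
by rewrite edges_aboveE prefix0s span_edgesP; apply/hasP; exists y.
Qed.

End Invasion.

(** * The probability that the invasion reaches given vertices *)

Section InvasionProbability.
Context {R : realType} {sigma : nat} {d : measure_display} {T : measurableType d}.
Context {P : probability T R}.
Variable W : edge sigma -> {RV P >-> R}.
Hypothesis iidW : iid_uniform W.
Hypothesis hsigma : (2 <= sigma)%N.
Local Notation w t := (fun e => W e t).

Lemma sig_all (D : set (edge sigma)) (A : Type) (l : seq A) (c : A -> T -> bool) :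
  (forall a, sig W D [set t | c a t]) -> sig W D [set t | all (c^~ t) l].
Proof.
move=> sc; elim: l => [|a l IHl] /=.
  by rewrite (_ : [set _ | _] = setT); [exact: sigT|apply/seteqP].
rewrite (_ : [set _ | _] = [set t | c a t] `&` [set t | all (c^~ t) l]); last first.
  by apply/seteqP; split=> t /= => [/andP[]|[-> ->]].
exact: sigI.
Qed.

Lemma sig_filter (D : set (edge sigma)) (A : eqType) (l r : seq A) (c : A -> T -> bool) :
  (forall a, sig W D [set t | c a t]) ->
  sig W D [set t | [seq a <- l | c a t] = r].
Proof.
move=> sc; elim: l r => [|a l IHl] r /=.
  have [<-|nr] := eqVneq [::] r.
    by rewrite (_ : [set _ | _] = setT); [exact: sigT|apply/seteqP].
  rewrite (_ : [set _ | _] = ~` setT); first by apply: sigC; exact: sigT.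
  by rewrite setCT; apply/seteqP; split=> // t /= /eqP; rewrite (negbTE nr).
rewrite (_ : [set _ | _] =
  ([set t | c a t] `&` [set t | a :: [seq a <- l | c a t] = r]) `|`
  (~` [set t | c a t] `&` [set t | [seq a <- l | c a t] = r])); last first.
  apply/seteqP; split=> t /=.
    by case: (c a t); [left|right].
  by case=> [[-> ->]|[/negP/negbTE -> ->]].
apply: sigU; apply: sigI => //; last exact: sigC.
case: r => [|b r].
  rewrite (_ : [set _ | _] = ~` setT); first by apply: sigC; exact: sigT.
  by rewrite setCT; apply/seteqP; split=> // t /=.
have [<-|ab] := eqVneq a b.
  rewrite (_ : [set _ | _] = [set t | [seq a <- l | c a t] = r]) //.
  by apply/seteqP; split=> t /= => [[]|->].
rewrite (_ : [set _ | _] = ~` setT); first by apply: sigC; exact: sigT.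
by rewrite setCT; apply/seteqP; split=> // t /= [/eqP]; rewrite (negbTE ab).
Qed.

Lemma sig_invade (I J : seq (vertex sigma)) :
  sig W setT [set t | invade (w t) I = J].
Proof.
pose F t := [seq e <- boundary I | all (fun f => W e t <= W f t) (boundary I)].
pose G (r : seq (edge sigma)) := if r is e :: _ then upper_end e :: I else I.
have -> : [set t | invade (w t) I = J] =
    \bigcup_r ([set t | F t = r] `&` (if G r == J then setT else ~` setT)).
  apply/seteqP; split=> t /=.
    move=> IJ; exists (F t) => //; split=> //.
    by rewrite (_ : G (F t) = invade (w t) I) // IJ eqxx.
  move=> [r _ [Fr]]; case: eqVneq => [<- _|_ []//].
  by rewrite -Fr.
apply: sig_bigcup => r; apply: sigI; last by case: ifP => _; [|apply: sigC]; exact: sigT.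
apply: sig_filter => e; apply: (sig_all _ (c := fun f t => W e t <= W f t)) => f.
exact: sig_le.
Qed.

(** The stages take values in the countable type of finite sequences of vertices, so the event is a
    countable union over the preceding stage. *)
Lemma sig_invaded N I : sig W setT [set t | invaded (w t) N = I].
Proof.
elim: N I => [|N IHN] I.
  have [<-|nI] := eqVneq [:: [::]] I.
    by rewrite (_ : [set _ | _] = setT); [exact: sigT|apply/seteqP].
  rewrite (_ : [set _ | _] = ~` setT); first by apply: sigC; exact: sigT.
  by rewrite setCT; apply/seteqP; split=> // t /= /eqP; rewrite (negbTE nI).
have -> : [set t | invaded (w t) N.+1 = I] =
    \bigcup_J ([set t | invaded (w t) N = J] `&` [set t | invade (w t) J = I]).
  apply/seteqP; split=> t /=; first by move=> h; exists (invaded (w t) N).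
  by move=> [J _ [/= <- <-]].
by apply: sig_bigcup => J; apply: sigI => //; exact: sig_invade.
Qed.

Lemma sig_invasion_cluster (y : vertex sigma) :
  sig W setT [set t | invasion_cluster (w t) y].
Proof.
have -> : [set t | invasion_cluster (w t) y] =
    \bigcup_N \bigcup_(J : seq (vertex sigma)) ([set t | invaded (w t) N = J] `&`
      (if y \in J then setT else ~` setT)).
  apply/seteqP; split=> t /=.
    by move=> [N _ /= yN]; exists N => //; exists (invaded (w t) N) => //=; rewrite yN.
  move=> [N _ [J _ [/= NJ]]]; case: ifP => [yJ _|_ []//].
  by exists N => //=; rewrite NJ.
apply: sig_bigcup => N; apply: sig_bigcup => J; apply: sigI; first exact: sig_invaded.
by case: ifP => _; [|apply: sigC]; exact: sigT.
Qed.

(** The level at q = 0 is 1. Outside the null set where two weights coincide or a weight is not in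
    (0, 1], reaching [x] means that no edge is blocked, and the bound 1 on the weights holds by
    itself. *)
Lemma pr_invasion (x : seq (vertex sigma)) :
  pr P [set t | forall y, y \in x -> invasion_cluster (w t) y] =
  (sigma%:R ^+ span_size x)^-1 * Phi W (span_edges x) [::] 0.
Proof.
have uS := uniq_span_edges x; have cS := @closed_span_edges _ x.
rewrite /Phi edges_above_root // -/(span_size x) pq0//.
rewrite mulrA mulVf ?mul1r; last first.
  by rewrite expf_neq0// pnatr_eq0 -lt0n ltnW.
set E := [set t | _].
have mE : measurable E.
  apply: (@sig_measurable _ _ _ _ _ W setT).
  rewrite (_ : E = \bigcap_y (if y \in x then [set t | invasion_cluster (w t) y] else setT)).
    apply: sig_bigcap => y; case: ifP => _; first exact: sig_invasion_cluster.
    exact: sigT.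
  apply/seteqP; split=> t h y => [_|yx]; first by case: ifP => // /h.
  by have := h y I; rewrite yx.
have mG : measurable (good_set W (span_edges x) [::] 1).
  exact: measurable_good_set.
pose F (ef : edge sigma * edge sigma) : set T :=
  if ef.1 == ef.2 then set0 else [set t | W ef.1 t = W ef.2 t].
have [mF F0] : measurable (\bigcup_ef F ef) /\ pr P (\bigcup_ef F ef) = 0.
  apply: pr_bigcup0 => -[e f]; rewrite /F /=; case: eqVneq => // ef.
  - exact: measurable_tie.
  - exact: pr0.
  - exact: (pr_tie iidW).
pose B (e : edge sigma) : set T := ~` [set t | 0 < W e t <= 1].
have mB e : measurable (B e).
  by apply: measurableC; apply: (@sig_measurable _ _ _ _ _ W setT); exact: sig_itv.
have [mBU B0] : measurable (\bigcup_e B e) /\ pr P (\bigcup_e B e) = 0.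
  by apply: pr_bigcup0 => // e; exact: (pr_outside iidW).
pose N := (\bigcup_ef F ef) `|` (\bigcup_e B e).
have mN : measurable N by exact: measurableU.
have N0 : pr P N <= 0 by have := prU_le P mF mBU; rewrite F0 B0 addr0.
have EG t : ~ N t -> (E t <-> good_set W (span_edges x) [::] 1 t).
  move=> Nt.
  have injt : injective (w t).
    move=> e f ef; apply: contrapT => ne; apply: Nt; left; exists (e, f) => //.
    by rewrite /F /=; case: eqVneq.
  rewrite /E /= (invasion_cluster_good (ltnW hsigma) injt); split=> [gt|[]//].
  split=> // f _; have [/andP[]//|nf] := boolP (0 < W f t <= 1).
  by exfalso; apply: Nt; right; exists f => //; exact/negP.
have le_pr (A C : set T) : measurable A -> measurable C ->
    (forall t, ~ N t -> A t -> C t) -> pr P A <= pr P C.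
  move=> mA mC AC; apply: le_trans (_ : pr P (C `|` N) <= _).
    apply: pr_le => //; first exact: measurableU.
    by move=> t At; have [Nt|Nt] := pselect (N t); [right|left; exact: AC].
  by apply: le_trans (prU_le P mC mN) _; rewrite gerDl.
apply/eqP; rewrite eq_le; apply/andP; split; apply: le_pr => // t Nt; by apply EG.
Qed.

End InvasionProbability.

(** * Nodes and segments *)

Section Geometry.
Context {sigma : nat} {dV : Order.disp_t} {V : finBPOrderType dV}.
Variables (x : seq (vertex sigma)) (pos : V -> vertex sigma).
Hypothesis x_neq0 : x != [::].
Hypothesis posE : forall v w : V, prefix (pos v) (pos w) = (v <= w)%O.
Hypothesis nodeP : forall u, is_node x u <-> exists v, pos v = u.
Implicit Types (u v w : V) (e f : edge sigma).
Local Notation S := (span_edges x).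
Let uS := uniq_span_edges x.
Let cS := @closed_span_edges _ x.

Lemma pos_inj : injective pos.
Proof.
by move=> v w vw; apply/eqP; rewrite eq_le -!posE vw prefix_refl.
Qed.

Lemma pos_bot : pos \bot%O = [::].
Proof.
have [v v0] : exists v, pos v = [::] by apply/nodeP; rewrite /is_node eqxx.
have : prefix (pos \bot%O) (pos v) by rewrite posE le0x.
by rewrite v0 prefixs0 => /eqP.
Qed.

Lemma pos_neq0 v : v != \bot%O -> pos v != [::].
Proof. by apply: contra => /eqP v0; apply/eqP/pos_inj; rewrite v0 pos_bot. Qed.

Lemma in_span_prefix (u u' : vertex sigma) : prefix u u' -> in_span x u' -> in_span x u.
Proof. by move=> uu' /hasP[y yx uy]; apply/hasP; exists y => //; exact: prefix_trans uy. Qed.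

Lemma in_span_pos v : in_span x (pos v).
Proof.
have /orP[/eqP->|/orP[vx|]] : is_node x (pos v) by apply/nodeP; exists v.
- by case: x x_neq0 => // y s _; apply/hasP; exists y; rewrite ?mem_head ?prefix0s.
- by apply/hasP; exists (pos v) => //; exact: prefix_refl.
move=> /card_gt1P[i [_ [iS _ _]]]; move: iS; rewrite inE.
by apply: in_span_prefix; exact: prefix_rcons.
Qed.

Lemma edge_in_span e v : prefix (upper_end e) (pos v) -> e \in S.
Proof. by move=> ev; rewrite span_edgesP; apply: in_span_prefix ev (in_span_pos v). Qed.

Lemma branch_node (z : vertex sigma) i j : i != j ->
  in_span x (rcons z i) -> in_span x (rcons z j) -> exists v, pos v = z.
Proof.
move=> ij zi zj; apply/nodeP; rewrite /is_node; apply/orP; right; apply/orP; right.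
by apply/card_gt1P; exists i, j; rewrite !inE.
Qed.

(** The last common vertex on the ways to two nodes is one of them or a branching vertex, hence a
    node in any case. *)
Lemma lower_node e v w : prefix (upper_end e) (pos v) -> prefix (upper_end e) (pos w) ->
  exists u, [/\ (u <= v)%O, (u <= w)%O & prefix (upper_end e) (pos u)].
Proof.
move=> ev ew; have [m [mv mw mm]] := prefix_meet (pos v) (pos w).
have em := mm _ ev ew.
have [mE|nv] := eqVneq m (pos v); first by exists v; split=> //; rewrite -posE -mE.
have [mE|nw] := eqVneq m (pos w); first by exists w; split=> //; rewrite -posE -mE.
have [i mi] := prefix_next mv nv; have [j mj] := prefix_next mw nw.
have ij : i != j.
  apply/eqP => ij; rewrite -ij in mj.
  by have := mm _ mi mj; rewrite rcons_prefixF.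
have [u um] : exists u, pos u = m.
  by apply: (branch_node ij); [apply: in_span_prefix mi _|apply: in_span_prefix mj _];
    exact: in_span_pos.
by exists u; rewrite -!posE um.
Qed.

Lemma segment_exists e : e \in S -> exists v,
  prefix (upper_end e) (pos v) /\ forall w, prefix (upper_end e) (pos w) -> (v <= w)%O.
Proof.
rewrite span_edgesP => /hasP[y yx ey].
have [v0 v0y] : exists v, pos v = y by apply/nodeP; rewrite /is_node yx orbT.
have ev0 : prefix (upper_end e) (pos v0) by rewrite v0y.
case: (@arg_minnP _ v0 (fun v => prefix (upper_end e) (pos v)) (fun v => size (pos v)) ev0).
move=> v ev vmin; exists v; split=> // w ew.
have [u [uv uw eu]] := lower_node ev ew.
suff -> : v = u by [].
apply: pos_inj; apply/esym/prefix_eq; first by rewrite posE.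
exact: vmin.
Qed.

Lemma below_total v u w : (u <= v)%O -> (w <= v)%O -> (u <= w)%O || (w <= u)%O.
Proof.
rewrite -!posE => uv wv; have [le|/ltnW le] := leqP (size (pos u)) (size (pos w)).
  by rewrite (prefix_size_le uv wv).
by rewrite (prefix_size_le wv uv) ?orbT.
Qed.

Lemma node_belowP v : v != \bot%O ->
  (node_below v < v)%O /\ forall u, (u < v)%O -> (u <= node_below v)%O.
Proof.
move=> v0; rewrite /node_below; case: pickP => [w /andP[wv /forallP wmax]|none] /=.
  split=> // u uv; have /orP[//|wu] := below_total (ltW uv) (ltW wv).
  have := wmax u; rewrite uv andbT lt_neqAle wu andbT negbK => /eqP->.
  exact: lexx.
have bv : (\bot < v)%O by rewrite lt0x.
case: (@arg_maxnP _ \bot%O (fun u => (u < v)%O) (fun u => size (pos u)) bv) => w wv wmax.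
exfalso; have := none w; rewrite wv /= => /negP; apply; apply/forallP => u.
apply/negP => /andP[wu uv]; have := wmax u uv; apply/negP; rewrite -ltnNge ltn_neqAle.
rewrite size_prefix ?posE ?(ltW wu)// andbT; apply/eqP => su.
have : w = u by apply: pos_inj; apply: prefix_eq; rewrite ?posE ?(ltW wu)// su.
by move=> wu'; rewrite wu' ltxx in wu.
Qed.

Definition in_segment v e := prefix (pos (node_below v)) e.1 && prefix (upper_end e) (pos v).

Lemma in_segmentP v e : v != \bot%O -> in_segment v e <->
  prefix (upper_end e) (pos v) /\ forall w, prefix (upper_end e) (pos w) -> (v <= w)%O.
Proof.
move=> v0; have [bv bmax] := node_belowP v0; split.
  move=> /andP[be ev]; split=> // w ew; have [u [uv uw eu]] := lower_node ev ew.
  move: uv; rewrite le_eqVlt => /predU1P[<-//|/bmax ub].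
  have : prefix (upper_end e) e.1.
    by apply: prefix_trans eu _; apply: prefix_trans be; rewrite posE.
  by case: (e) => z i; rewrite /upper_end rcons_prefixF.
move=> [ev vmin]; rewrite /in_segment ev andbT.
have bv' : prefix (pos (node_below v)) (pos v) by rewrite posE ltW.
have [le|lt] := leqP (size (upper_end e)) (size (pos (node_below v))).
  have /vmin := prefix_size_le ev bv' le.
  by move=> /le_lt_trans/(_ bv); rewrite ltxx.
have := prefix_size_le bv' ev (ltnW lt); rewrite /upper_end prefix_rconsE => /orP[/eqP eb|//].
by move: lt; rewrite eb /upper_end ltnn.
Qed.

Lemma in_segment_unique v w e : v != \bot%O -> w != \bot%O ->
  in_segment v e -> in_segment w e -> v = w.
Proof.
move=> v0 w0 /(in_segmentP e v0)[ev vmin] /(in_segmentP e w0)[ew wmin].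
by apply/eqP; rewrite eq_le vmin// wmin.
Qed.

Lemma edge_segment e : e \in S -> exists2 v, v != \bot%O & in_segment v e.
Proof.
move=> /segment_exists[v [ev vmin]].
have v0 : v != \bot%O.
  apply/eqP => v0; move: ev; rewrite v0 pos_bot prefixs0 -size_eq0.
  by rewrite /upper_end size_rcons.
by exists v => //; apply/in_segmentP.
Qed.

Lemma sum_segments {A : nmodType} (F : edge sigma -> A) :
  \sum_(e <- S) F e = \sum_(v | v != \bot%O) \sum_(e <- S | in_segment v e) F e.
Proof.
rewrite (exchange_big_dep xpredT)//= big_seq [RHS]big_seq; apply: eq_bigr => e eS.
have [v v0 ve] := edge_segment eS.
rewrite (big_pred1 v)// => w; apply/andP/eqP => [[w0 we]|->//].
exact: in_segment_unique ve.
Qed.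

Lemma sum_path_edges {A : nmodType} (F : vertex sigma -> A) (z s : vertex sigma) :
  \sum_(e <- path_edges z s) F (upper_end e) = \sum_(i < size s) F (z ++ take i.+1 s).
Proof.
elim: s z => [|j s IHs] z /=; first by rewrite big_nil big_ord0.
rewrite big_cons big_ord_recl IHs /= take0 cats1; congr (_ + _).
by apply: eq_bigr => i _; rewrite cat_rcons.
Qed.

Lemma uniq_path_edges (z s : vertex sigma) : uniq (path_edges z s).
Proof.
elim: s z => //= j s IHs z; rewrite IHs andbT path_edgesP negb_and.
by rewrite rcons_prefixF.
Qed.

Definition segment_length v : nat := (size (pos v) - size (pos (node_below v)))%N.

Definition segment_word v : vertex sigma := drop (size (pos (node_below v))) (pos v).

Lemma segment_wordE v : v != \bot%O ->
  pos (node_below v) ++ segment_word v = pos v /\ size (segment_word v) = segment_length v.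
Proof.
move=> v0; have [bv _] := node_belowP v0.
split; last by rewrite size_drop.
have : prefix (pos (node_below v)) (pos v) by rewrite posE ltW.
by rewrite prefixE => /eqP {1}<-; rewrite cat_take_drop.
Qed.

Lemma sum_segment {A : nmodType} (F : vertex sigma -> A) v : v != \bot%O ->
  \sum_(e <- S | in_segment v e) F (upper_end e) =
  \sum_(i < segment_length v) F (pos (node_below v) ++ take i.+1 (segment_word v)).
Proof.
move=> v0; have [vE <-] := segment_wordE v0.
rewrite -sum_path_edges -big_filter; apply: perm_big; apply: uniq_perm.
- exact: filter_uniq.
- exact: uniq_path_edges.
move=> e; rewrite mem_filter path_edgesP vE /in_segment.
by case: (boolP (prefix (upper_end e) (pos v))) => [/edge_in_span->|_]; rewrite ?andbT ?andbF.
Qed.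

(** If a side branch left at the lower end of [e], this would be a node strictly between
    [node_below v] and [v]. *)
Lemma edges_low_segment v e : v != \bot%O -> in_segment v e ->
  e.1 != pos (node_below v) -> size (edges_low S e.1 e) = 0%N.
Proof.
move=> v0 /andP[be ev] ne; apply/eqP; rewrite -leqn0 leqNgt size_filter -has_count.
apply/hasP => -[f]; rewrite edges_aboveE => /andP[ef fS] nef.
have eS := edge_in_span ev.
have ef' : prefix e.1 (upper_end f) by apply: prefix_trans ef (prefix_rcons _ _).
have ene : e.1 != upper_end f.
  by apply/eqP => h; move: ef; rewrite h; case: (f) => z i; rewrite rcons_prefixF.
have [j ej] := prefix_next ef' ene.
have ij : e.2 != j by apply/eqP => ej2; move: nef; rewrite {1}/upper_end ej2 ej.
have [w wE] : exists w, pos w = e.1.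
  apply: (branch_node ij).
    by have := eS; rewrite span_edgesP.
  by apply: in_span_prefix ej _; rewrite -span_edgesP.
have [bv bmax] := node_belowP v0.
have wv : (w < v)%O.
  rewrite lt_neqAle -posE wE (prefix_trans (prefix_rcons e.1 e.2) ev) andbT.
  apply/eqP => wv; have := size_prefix ev; rewrite -wv wE /upper_end size_rcons.
  by rewrite ltnn.
have := bmax w wv; rewrite -posE wE => eb.
by move: ne; rewrite (prefix_anti be eb) eqxx.
Qed.

Hypothesis degree1 : root_degree V = 1%N.

(** Descending from any node by [node_below] ends at a node just above the bottom, and the degree
    leaves a single one. *)
Lemma first_node_exists : exists2 v1, v1 != \bot%O /\ node_below v1 = \bot%O &
  forall v, v != \bot%O -> (v1 <= v)%O.
Proof.
have /cards1P[v1 v1E] : #|[set v : V | (v != \bot%O) && (node_below v == \bot%O)]%SET| == 1%N.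
  by apply/eqP.
have : v1 \in [set v : V | (v != \bot%O) && (node_below v == \bot%O)]%SET.
  by rewrite v1E inE.
rewrite inE => /andP[v10 /eqP v1b]; exists v1 => // v.
have [n] := ubnP (size (pos v)); elim: n => // n IHn in v *; rewrite ltnS => vn v0.
have [bv bmax] := node_belowP v0.
have [b0|b0] := eqVneq (node_below v) \bot%O.
  have : v \in [set v : V | (v != \bot%O) && (node_below v == \bot%O)]%SET.
    by rewrite inE v0 b0 eqxx.
  by rewrite v1E inE => /eqP ->.
apply: le_trans (ltW bv); apply: IHn => //; apply: leq_trans vn.
rewrite ltn_neqAle size_prefix ?posE ?(ltW bv)// andbT; apply/eqP => sb.
have e : node_below v = v by apply: pos_inj; apply: prefix_eq; rewrite ?posE ?(ltW bv)// sb.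
by rewrite e ltxx in bv.
Qed.

(** Below [v1] there is no node except the root, and all branches of the tree leave the root in the
    direction of [v1]. *)
Lemma stem_span v1 : v1 != \bot%O -> node_below v1 = \bot%O ->
  (forall v, v != \bot%O -> (v1 <= v)%O) ->
  (0 < size (pos v1))%N /\
  forall c, c \in S -> (size c.1 < size (pos v1))%N -> size (edges_low S c.1 c) = 0%N.
Proof.
move=> v10 v1b v1min; split; first by rewrite lt0n size_eq0 pos_neq0.
move=> c cS' cl; have [v v0 /[dup] vc /andP[bc cv]] := edge_segment cS'.
have [bv _] := node_belowP v0.
have b0 : node_below v = \bot%O.
  apply/eqP; apply: contraT => /v1min; rewrite -posE => v1bv.
  by have := size_prefix (prefix_trans v1bv bc); rewrite leqNgt cl.
have [c1|c1] := eqVneq c.1 (pos (node_below v)); last exact: edges_low_segment vc c1.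
rewrite b0 pos_bot in c1.
apply/eqP; rewrite -leqn0 leqNgt size_filter -has_count.
apply/hasP => -[f]; rewrite edges_aboveE => /andP[_ fS] /negP; apply.
have [v' v'0 /andP[_ fv']] := edge_segment fS.
have s1 : size (upper_end c) = 1%N by rewrite /upper_end size_rcons c1.
have cv1 : prefix (upper_end c) (pos v1).
  apply: (prefix_size_le cv); first by rewrite posE v1min.
  by rewrite s1 lt0n size_eq0 pos_neq0.
have cv' : prefix (upper_end c) (pos v') by apply: prefix_trans cv1 _; rewrite posE v1min.
by apply: prefix_size_le cv' fv' _; rewrite s1 /upper_end size_rcons.
Qed.

Local Notation below := node_below.
Local Notation rem w v := (remaining_size x (pos w) (pos v)).

Lemma edge_toward w v : (w < v)%O -> exists e, [/\ e \in S, e.1 = pos w &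
  upper_end e = take (size (pos w)).+1 (pos v)].
Proof.
move=> wv; have wv' : prefix (pos w) (pos v) by rewrite posE ltW.
have nwv : pos w != pos v by apply: contraTneq wv => /pos_inj ->; rewrite ltxx.
have [i wi] := prefix_next wv' nwv; exists (pos w, i); split=> //.
  exact: (@edge_in_span _ v).
by move: wi; rewrite prefixE size_rcons => /eqP ->.
Qed.

Lemma remaining_low e v : upper_end e = take (size e.1).+1 (pos v) ->
  remaining_size x e.1 (pos v) = size (edges_low S [::] e).
Proof.
by move=> ev; rewrite /remaining_size -ev size_filter edges_above_root.
Qed.

Lemma remaining_between w u v : (w < u)%O -> (u <= v)%O -> rem w v = rem w u.
Proof.
move=> wu uv; rewrite /remaining_size; have : prefix (pos u) (pos v) by rewrite posE.
rewrite prefixE => /eqP <-; rewrite take_takel//.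
rewrite ltn_neqAle size_prefix ?posE ?(ltW wu)// andbT; apply/eqP => s.
have : w = u by apply: pos_inj; apply: prefix_eq; rewrite ?posE ?(ltW wu)// s.
by move=> e; rewrite e ltxx in wu.
Qed.

Lemma segment_length_gt0 v : v != \bot%O -> (0 < segment_length v)%N.
Proof.
move=> v0; have [bv _] := node_belowP v0; rewrite subn_gt0.
rewrite ltn_neqAle size_prefix ?posE ?(ltW bv)// andbT; apply/eqP => s.
have : below v = v by apply: pos_inj; apply: prefix_eq; rewrite ?posE ?(ltW bv)// s.
by move=> e; rewrite e ltxx in bv.
Qed.

Definition segment_vertex v i : vertex sigma :=
  pos (below v) ++ take i.+1 (segment_word v).

Lemma segment_vertex_edge v i : v != \bot%O -> (i < segment_length v)%N ->
  exists e, [/\ e \in S, in_segment v e, upper_end e = segment_vertex v i &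
    e.1 = pos (below v) ++ take i (segment_word v)].
Proof.
move=> v0 iv; have [vE sv] := segment_wordE v0.
have := iv; rewrite -sv => iw.
have [a _] : exists a : 'I_sigma, true.
  by case: (segment_word v) iw => // a *; exists a.
pose e : edge sigma := (pos (below v) ++ take i (segment_word v), nth a (segment_word v) i).
have eE : upper_end e = segment_vertex v i.
  by rewrite /upper_end /= rcons_cat -take_nth.
have ev : prefix (upper_end e) (pos v).
  by rewrite eE -vE /segment_vertex prefix_catr// eqxx prefix_take.
exists e; split=> //; first exact: (@edge_in_span _ v).
by rewrite /in_segment ev andbT prefix_prefix.
Qed.

Lemma segment_vertex_last v : v != \bot%O ->
  segment_vertex v (segment_length v).-1 = pos v.
Proof.
move=> v0; have [vE sv] := segment_wordE v0.
by rewrite /segment_vertex prednK ?segment_length_gt0// take_oversize ?sv.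
Qed.

Lemma segment_vertex_first v : v != \bot%O ->
  segment_vertex v 0 = take (size (pos (below v))).+1 (pos v).
Proof.
move=> v0; have [vE sv] := segment_wordE v0.
by rewrite /segment_vertex -[in RHS]vE take_cat ltnNge leqnSn /= subSnn.
Qed.

Variable R : realType.

(** The factor pi_v before the limit, with n_w and M in place of t_w and m. *)
Definition discrete_weight v : R := \prod_(w | (\bot < w)%O && (w < v)%O)
  (((segment_length w)%:R + (rem (below w) v)%:R) / (rem w v)%:R).

Let stemE : exists l, (0 < l)%N /\
  forall c, c \in S -> (size c.1 < l)%N -> size (edges_low S c.1 c) = 0%N.
Proof.
have [v1 [v10 v1b] v1min] := first_node_exists.
by exists (size (pos v1)); exact: stem_span v1b v1min.
Qed.

(** Links the masses to the numbers M: what has been traversed or left behind before [e] is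
    everything except [e] and the edges above it. *)
Lemma mass_low e : e \in S -> mass S (upper_end e) = size (edges_low S [::] e).
Proof.
move=> eS; have [l [l0 stem]] := stemE; have := mass_size uS cS l0 stem eS.
have er : e \in edges_above S [::] by rewrite edges_above_root.
have := size_edges_low uS er; rewrite edges_above_root => -> /eqP.
by rewrite -addnS eqn_add2r => /eqP.
Qed.

Lemma segment_mass v i : v != \bot%O -> (i < segment_length v)%N ->
  mass S (segment_vertex v i) = (rem (below v) v + i)%N.
Proof.
move=> v0; have [bv _] := node_belowP v0; elim: i => [|i IHi] iv.
  have [e [eS e1 eE]] := edge_toward bv.
  rewrite segment_vertex_first// addn0 -eE mass_low// -(@remaining_low e v) e1//.
have [c [cS' cv cE c1]] := segment_vertex_edge v0 iv.
have cc := children_parent cS'; rewrite -cE (mass_child uS cc); last first.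
  by rewrite c1 size_cat size_take; have [_ ->] := segment_wordE v0; case: ifP => _; lia.
have -> : size (edges_low S c.1 c) = 0%N.
  apply: (edges_low_segment v0 cv); rewrite c1; apply/eqP => /(congr1 size).
  have [_ sw] := segment_wordE v0; have iw : (i.+1 <= size (segment_word v))%N by rewrite sw ltnW.
  by rewrite size_cat size_takel//; lia.
by rewrite addn0 c1 -/(segment_vertex v i) IHi ?(ltnW iv)// addnS.
Qed.

(** Nothing is left behind inside a segment, so the mass grows by 1 and the weight is unchanged. *)
Lemma segment_weight_const v i : v != \bot%O -> (i < segment_length v)%N ->
  weight S (segment_vertex v i) = weight S (segment_vertex v 0) :> R.
Proof.
move=> v0; elim: i => [//|i IHi] iv.
have [c [cS' cv cE c1]] := segment_vertex_edge v0 iv.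
have cc := children_parent cS'.
have s0 : (0 < size c.1)%N.
  by rewrite c1 size_cat size_take; have [_ ->] := segment_wordE v0; case: ifP => _; lia.
have := @weight_child R _ _ uS _ _ cc s0.
have -> : mass S (upper_end c) = (mass S c.1).+1.
  by rewrite cE c1 -/(segment_vertex v i) !segment_mass// ?addnS// ltnW.
rewrite cE c1 -/(segment_vertex v i) IHi ?(ltnW iv)// => /mulIf; apply.
by rewrite pnatr_eq0.
Qed.

(** Induction along the nodes. Passing the node w below v multiplies the weight by the mass at the
    end of the segment of w plus 1, which is n_w + M for [below w], over the mass at the start of
    the segment of v. The other factors agree for w and v by [remaining_between]. *)
Lemma segment_weight v i : v != \bot%O -> (i < segment_length v)%N ->
  weight S (segment_vertex v i) = discrete_weight v.
Proof.
have [n] := ubnP (size (pos v)); elim: n => // n IHn in v i *; rewrite ltnS => vn v0 iv.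
rewrite segment_weight_const//; have [bv bmax] := node_belowP v0.
have n0 := segment_length_gt0 v0.
have [c [cS' cv cE c1]] := segment_vertex_edge v0 n0.
have [b0|b0] := eqVneq (below v) \bot%O.
  rewrite /discrete_weight big_pred0; last first.
    move=> w; apply/negP => /andP[w0 /bmax]; rewrite b0 => wb.
    by have := lt_le_trans w0 wb; rewrite ltxx.
  rewrite /weight /segment_vertex b0 pos_bot /= size_take.
  by have [_ ->] := segment_wordE v0; case: (segment_length v) n0 => // -[].
have cc := children_parent cS'.
rewrite take0 cats0 in c1.
have s0 : (0 < size c.1)%N by rewrite c1 lt0n size_eq0 pos_neq0.
have := @weight_child R _ _ uS _ _ cc s0; rewrite cE segment_mass// addn0 c1.
have nb := segment_length_gt0 b0.
have lt_b : ((segment_length (below v)).-1 < segment_length (below v))%N.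
  by rewrite prednK.
have -> : weight S (pos (below v)) = discrete_weight (below v) :> R.
  rewrite -(segment_vertex_last b0) IHn//; apply: leq_trans vn.
  by move: n0; rewrite subn_gt0.
have -> : mass S (pos (below v)) =
    (rem (below (below v)) (below v) + (segment_length (below v)).-1)%N.
  by rewrite -(segment_mass b0 lt_b) segment_vertex_last.
have [bbv _] := node_belowP b0.
have rem0 : (rem (below v) v)%:R != 0 :> R.
  have [e [eS e1 eE]] := edge_toward bv.
  rewrite -e1 (@remaining_low e v) ?e1// -mass_low//.
  rewrite eE -segment_vertex_first// -cE (mass_child uS cc s0).
  by rewrite pnatr_eq0.
move=> H; apply: (mulIf rem0); rewrite H.
rewrite /discrete_weight [in RHS](bigD1 (below v))/=; last by rewrite lt0x b0 bv.
rewrite (remaining_between bbv (ltW bv)).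
rewrite mulrAC divfK//.
have -> : (rem (below (below v)) (below v) + (segment_length (below v)).-1).+1%:R
  = (segment_length (below v))%:R + (rem (below (below v)) (below v))%:R :> R.
  by rewrite -natrD -addnS prednK// addnC.
rewrite [RHS]mulrC; congr (_ * _); apply: eq_big => w.
  apply/idP/idP => [/andP[w0 wb]|/andP[/andP[w0 /bmax wb] wn]].
    by rewrite w0 (lt_trans wb bv) lt_eqF.
  by rewrite w0 lt_neqAle wn wb.
move=> /andP[w0 wb]; have w0' : w != \bot%O by rewrite -lt0x.
have [bw _] := node_belowP w0'.
rewrite (remaining_between wb (ltW bv)).
by rewrite (remaining_between (lt_trans bw wb) (ltW bv)).
Qed.

(** In a segment of n edges the masses run from M to M + n - 1, so the terms 2 m + 1 add up to 2 n M
    + n^2. This produces the quadratic expression of the theorem. *)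
Lemma sum_discrete_weight :
  (size S)%:R * \sum_(e <- S) weight S (upper_end e) =
  \sum_(v | v != \bot%O) discrete_weight v *
    (2 * (segment_length v)%:R * (rem (below v) v)%:R + (segment_length v)%:R ^+ 2) :> R.
Proof.
have [v1 [v10 v1b] v1min] := first_node_exists.
have [l0 stem] := stem_span v10 v1b v1min.
rewrite -(sum_weight uS cS l0 stem); last first.
  have [e eS _] : exists2 e, e \in S & true.
    have bv1 : (\bot < v1)%O by rewrite lt0x.
    by have [e [eS _ _]] := edge_toward bv1; exists e.
  by case: (S) eS.
rewrite sum_segments; apply: eq_bigr => v v0.
rewrite (sum_segment (fun z => weight S z * (2 * (mass S z)%:R + 1)) v0).
under eq_bigr => i _.
  rewrite -/(segment_vertex v i) segment_weight// segment_mass//; over.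
rewrite /= -mulr_sumr; congr (_ * _).
elim: (segment_length v) => [|n IHn]; first by rewrite big_ord0; ring.
by rewrite big_ord_recr/= IHn natrD -nat1r; ring.
Qed.

(** The segment below [u] belongs to the branch emerging from [w] towards [v]. *)
Definition deleted w v u := [exists u0, [&& (w < u0)%O, (u0 <= v)%O & (u0 <= u)%O]].

(** The branch that is cut off starts with the first edge of a segment, so that every segment is
    deleted or kept as a whole. *)
Lemma remaining_sum w v : (w < v)%O ->
  rem w v = (\sum_(u | (u != \bot%O) && ~~ deleted w v u) segment_length u)%N.
Proof.
move=> wv; have [e1 [e1S e11 e1E]] := edge_toward wv.
rewrite -e11 (@remaining_low e1 v) ?e11// size_filter edges_above_root.
rewrite -sum1_count big_mkcond /= sum_segments.
rewrite [RHS]big_mkcondr; apply: eq_bigr => u u0.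
have [u1 u10 /[dup] /(in_segmentP _ u10)[e1u1 u1min] /andP[b1e e1u1']] := edge_segment e1S.
have e1v : prefix (upper_end e1) (pos v) by rewrite e1E prefix_take.
have delE : deleted w v u = prefix (upper_end e1) (pos u).
  apply/existsP/idP => [[u' /and3P[wu' u'v u'u]]|e1u].
    apply: (@prefix_trans _ (pos u')); last by rewrite posE.
    apply: (prefix_size_le e1v); first by rewrite posE.
    rewrite /upper_end size_rcons e11 ltn_neqAle size_prefix ?posE ?(ltW wu')// andbT.
    apply/eqP => s; have : w = u' by apply: pos_inj; apply: prefix_eq; rewrite ?posE ?(ltW wu')// s.
    by move=> wE; rewrite wE ltxx in wu'.
  exists u1; rewrite !u1min// !andbT lt_neqAle -posE -e11.
  rewrite (prefix_trans (prefix_rcons e1.1 e1.2) e1u1) andbT.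
  apply/eqP => wu1; have := size_prefix e1u1; rewrite -wu1 -e11 /upper_end size_rcons.
  by rewrite ltnn.
have segE e : in_segment u e -> prefix (upper_end e1) (upper_end e) = deleted w v u.
  move=> /andP[be eu]; rewrite delE; apply/idP/idP => [/prefix_trans|e1u]; first exact.
  have := u1min u e1u; rewrite le_eqVlt => /predU1P[u1u|u1u].
    have [bu _] := node_belowP u10.
    apply: (prefix_size_le e1u eu); rewrite /upper_end !size_rcons ltnS.
    rewrite e11; apply: leq_trans (size_prefix be).
    have [_ bmax] := node_belowP u0; apply: size_prefix; rewrite posE; apply: bmax.
    rewrite -u1u lt_neqAle -posE -e11.
    rewrite (prefix_trans (prefix_rcons e1.1 e1.2) e1u1) andbT.
    apply/eqP => wu1; have := size_prefix e1u1; rewrite -wu1 -e11 /upper_end size_rcons.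
    by rewrite ltnn.
  have [_ bmax] := node_belowP u0.
  apply: prefix_trans e1u1 _; apply: prefix_trans (_ : prefix _ e.1) _.
    by apply: prefix_trans be; rewrite posE bmax.
  exact: prefix_rcons.
rewrite (eq_bigr (fun=> if deleted w v u then 0 else 1)%N); last first.
  by move=> e /segE <-; case: prefix.
case: (deleted w v u) => /=; first by rewrite big1.
rewrite (sum_segment (fun=> 1%N) u0).
by rewrite sum1_card card_ord.
Qed.

End Geometry.

(** * The scaling limit *)

Section Limit.
Context {R : realType} {sigma k : nat} {dV : Order.disp_t} {V : finBPOrderType dV}.
Variable t : V -> R.
Hypothesis k_gt0 : (0 < k)%N.
Hypothesis t_gt0 : forall v, v != \bot%O -> 0 < t v.
Local Notation F := (sharp sigma k t).
Local Notation N c := ((span_size (tval c.1))%:R : R).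
Local Notation rem c w v := (remaining_size (tval c.1) (c.2 w) (c.2 v)).
Implicit Types (c : config sigma k V) (v w : V).

Lemma config_neq0 c : tval c.1 != [::].
Proof. by rewrite -size_eq0 size_tuple -lt0n. Qed.

Lemma near_geometry : F [set c | has_geometry c].
Proof. by exists (0%N, 1) => [|c []]//=; exact: ltr01. Qed.

Lemma near_span_size n : F [set c : config sigma k V | (n <= span_size c.1)%N].
Proof. by exists (n, 1) => [|c []]//=; exact: ltr01. Qed.

Lemma segment_cvg v : v != \bot%O -> (segment_size c v)%:R / N c @[c --> F] --> t v.
Proof.
move=> v0; apply/cvgrPdist_lt => e e0; exists (0%N, e) => // c [_ _ /(_ v v0)].
by rewrite /= distrC.
Qed.

Definition limit_remaining w v : R := \sum_(u | (u != \bot%O) && ~~ deleted w v u) t u.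

Lemma remaining_cvg w v : (w < v)%O ->
  (rem c w v)%:R / N c @[c --> F] --> limit_remaining w v.
Proof.
move=> wv.
have : (\sum_(u | (u != \bot%O) && ~~ deleted w v u) (segment_size c u)%:R / N c)
    @[c --> F] --> limit_remaining w v.
  by apply: cvg_big => [|u /andP[u0 _]]; [exact: add_continuous|exact: segment_cvg].
apply: cvg_trans; apply: near_eq_cvg; near=> c.
have [_ posE nodeP] : has_geometry c by near: c; exact: near_geometry.
by rewrite (remaining_sum (config_neq0 c) posE nodeP wv) natr_sum mulr_suml.
Unshelve. all: by end_near. Qed.

Lemma deleted_self w v : (w < v)%O -> ~~ deleted w v w.
Proof.
move=> wv; apply/existsP => -[u /and3P[wu _ uw]].
by have := lt_le_trans wu uw; rewrite ltxx.
Qed.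

(** The segment that ends at [w] is never deleted. This makes the quotients in pi_v continuous in
    the limit. *)
Lemma limit_remaining_gt0 w v : w != \bot%O -> (w < v)%O -> 0 < limit_remaining w v.
Proof.
move=> w0 wv; rewrite /limit_remaining (bigD1 w) ?w0 ?deleted_self//=.
apply: ltr_pwDl; first exact: t_gt0.
by apply: sumr_ge0 => u /andP[/andP[u0 _] _]; exact/ltW/t_gt0.
Qed.

Definition discrete_limit c : R := \sum_(v | v != \bot%O)
  (2^-1 * ((segment_size c v)%:R / N c) ^+ 2
   + (segment_size c v)%:R / N c * ((rem c (node_below v) v)%:R / N c))
  * \prod_(w | (\bot < w)%O && (w < v)%O)
      (((segment_size c w)%:R / N c + (rem c (node_below w) v)%:R / N c)
       / ((rem c w v)%:R / N c)).

Lemma discrete_limit_cvg : ProperFilter F -> discrete_limit @ F -->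
  \sum_(v | v != \bot%O)
    (2^-1 * t v ^+ 2 + t v * scaled_remaining sigma k t (node_below v) v)
    * branch_weight sigma k t v.
Proof.
move=> FF; have [c [_ posE _]] := filter_ex near_geometry.
have scaledE w v : (w < v)%O -> scaled_remaining sigma k t w v = limit_remaining w v.
  by move=> wv; apply: cvg_lim => //; exact: remaining_cvg.
have scaled_cvg w v : (w < v)%O ->
    (rem c w v)%:R / N c @[c --> F] --> scaled_remaining sigma k t w v.
  by move=> wv; rewrite scaledE//; exact: remaining_cvg.
apply: cvg_big => [|v v0]; first exact: add_continuous.
have [bv _] := node_belowP posE v0.
apply: cvgM.
  apply: cvgD; last by apply: cvgM; [exact: segment_cvg|exact: scaled_cvg].
  apply: cvgM; first exact: cvg_cst.
  by apply: cvgM; exact: segment_cvg.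
apply: cvg_big => [|w /andP[w0 wv]]; first exact: mul_continuous.
rewrite lt0x in w0; have [bw _] := node_belowP posE w0.
apply: cvgM.
  by apply: cvgD; [exact: segment_cvg|apply: scaled_cvg; exact: lt_trans wv].
by apply: cvgV; [rewrite scaledE// gt_eqF// limit_remaining_gt0|exact: scaled_cvg].
Qed.

(** An exact identity: already before the limit the sum over segments is the normalised sum of the
    weights, so only [Phi] has to be estimated. *)
Lemma discrete_limitE c : has_geometry c -> (0 < span_size c.1)%N -> root_degree V = 1%N ->
  discrete_limit c =
  (2 * N c)^-1 * \sum_(e <- span_edges c.1) weight (span_edges c.1) (upper_end e).
Proof.
move=> [_ posE nodeP] N0 degree1.
have n0 : N c != 0 by rewrite pnatr_eq0 -lt0n.
apply: (mulfI n0); rewrite mulrCA.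
rewrite (sum_discrete_weight (config_neq0 c) posE nodeP degree1 R) !mulr_sumr.
apply: eq_bigr => v v0.
have -> : \prod_(w | (\bot < w)%O && (w < v)%O)
      (((segment_size c w)%:R / N c + (rem c (node_below w) v)%:R / N c)
       / ((rem c w v)%:R / N c)) = discrete_weight c.1 c.2 R v.
  apply: eq_bigr => w _; rewrite -mulrDl invfM invrK mulrACA mulVf// mulr1.
  by [].
rewrite -/(segment_length c.2 v) /segment_size -/(segment_length c.2 v).
by field.
Qed.

End Limit.

Theorem corollary1p4 (R : realType) (sigma r : nat)
  (hsigma : (2 <= sigma)%N) (hr : (2 <= r)%N)
  (d : measure_display) (Omega : measurableType d) (P : probability Omega R)
  (W : edge sigma -> {RV P >-> R}) (hW : iid_uniform W)
  (dV : Order.disp_t) (V : finBPOrderType dV) (t : V -> R)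
  (ht : forall v : V, v != \bot%O -> 0 < t v <= 1)
  (ht1 : \sum_(v : V | v != \bot%O) t v = 1)
  (hroot : root_degree V = 1%N) :
  (fun c : config sigma r.-1 V =>
     ((sigma%:R - 1) * (span_size c.1)%:R)^-1 * sigma%:R ^+ (span_size c.1).+1
     * fine (P [set omega | forall y, y \in tval c.1 ->
                  invasion_cluster (fun e => W e omega) y]))
  @ sharp sigma r.-1 t
  --> \sum_(v : V | v != \bot%O)
        (2^-1 * t v ^+ 2
         + t v * scaled_remaining sigma r.-1 t (node_below v) v)
        * branch_weight sigma r.-1 t v.
Proof.
have r0 : (0 < r.-1)%N by case: r hr => [|[]].
have t0 v : v != \bot%O -> 0 < t v by move=> /ht/andP[].
(* If no large tree has this geometry with nearly these proportions, the filter is degenerate and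
   converges to every point. *)
have [empty|proper] := pselect (sharp sigma r.-1 t set0).
  by move=> A _; apply: filterS empty; exact: sub0set.
have FF : ProperFilter (sharp sigma r.-1 t).
  apply: Build_ProperFilter_ex => A FA; apply: contra_notP proper => A0.
  by apply: filterS FA => c Ac; apply: A0; exists c.
have gL := discrete_limit_cvg r0 t0 FF.
have sigma1 : 0 < sigma%:R - 1 :> R by rewrite subr_gt0 ltr1n.
have sigma0 : 0 < sigma%:R :> R by rewrite ltr0n; exact: leq_trans hsigma.
have [c0 [_ posE0 _]] := filter_ex (near_geometry t).
have [v1 [v10 v1b] v1min] := first_node_exists posE0 hroot.
rewrite -[X in _ --> X]addr0.
set f := (f in f @ _ --> _).
(* The limit of [discrete_limit] is the right one, so only its difference from [f] has to vanish. *)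
apply: (@cvg_trans _ ((fun c => discrete_limit c + (f c - discrete_limit c))
    @ sharp sigma r.-1 t)).
  by apply: near_eq_cvg; near=> c; rewrite addrC subrK.
apply: cvgD => //.
apply/cvgrPdist_le => e e0.
(* Chosen to cancel the factor [sigma / ((sigma - 1) N)] that multiplies the error of
   [Phi_asymptotics] below. *)
have eps0 : 0 < e * ((sigma%:R - 1) / sigma%:R) by rewrite mulr_gt0// divr_gt0.
(* The stem is the segment of [v1], which eventually has at least half of its limiting proportion of
   the edges. *)
have del0 : 0 < t v1 / 2 by rewrite divr_gt0// t0.
have /cvgrPdist_le seg1 := @segment_cvg R sigma r.-1 dV V t v1 v10.
have [N0 asym] := Phi_asymptotics hW hsigma eps0 del0.
near=> c.
have gc : has_geometry c by near: c; exact: near_geometry.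
have Nc : (maxn 1 N0 <= span_size c.1)%N by near: c; exact: near_span_size.
have tc : `|t v1 - (segment_size c v1)%:R / (span_size c.1)%:R| <= t v1 / 2.
  by near: c; exact: seg1.
move: Nc; rewrite geq_max => /andP[N1 NN0].
have n0 : 0 < (span_size c.1)%:R :> R by rewrite ltr0n.
rewrite sub0r normrN.
rewrite (discrete_limitE r0 gc N1 hroot).
have := pr_invasion hW hsigma c.1; rewrite /f /pr => ->.
have [_ posE nodeP] := gc.
have [l0 stem] := stem_span (config_neq0 r0 c) posE nodeP v10 v1b v1min.
have := asym (span_edges c.1) (size (c.2 v1)) (uniq_span_edges _) (@closed_span_edges _ _)
  stem l0 NN0.
have -> : t v1 / 2 * (size (span_edges c.1))%:R <= (size (c.2 v1))%:R.
  have := tc; rewrite /segment_size v1b (pos_bot posE nodeP) subn0.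
  rewrite ler_norml => /andP[_ h].
  by rewrite -ler_pdivlMr// -/(span_size c.1); lra.
move=> /(_ isT); rewrite -/(span_size c.1).
set A := Phi _ _ _ _; set B := \sum_(_ <- _) _ => AB.
have sp : sigma%:R ^+ span_size c.1 != 0 :> R by rewrite expf_neq0// gt_eqF.
have -> : ((sigma%:R - 1) * (span_size c.1)%:R)^-1 * sigma%:R ^+ (span_size c.1).+1
    * (sigma%:R ^- span_size c.1 * A) - (2 * (span_size c.1)%:R)^-1 * B =
  (A - kappaq sigma * B) * (sigma%:R / ((sigma%:R - 1) * (span_size c.1)%:R)) :> R.
  by rewrite exprS /kappaq; field; rewrite sp !gt_eqF.
rewrite normrM [X in _ * X]ger0_norm; last by rewrite divr_ge0 ?mulr_ge0 ?ltW.
rewrite -ler_pdivlMr; last by rewrite divr_gt0// mulr_gt0.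
apply: le_trans AB _; rewrite le_eqVlt; apply/orP; left; apply/eqP.
by field; rewrite !gt_eqF.
Unshelve. all: by end_near. Qed.
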